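(* Let $S$ be an integral domain, $n\ge2$, and let $\mathcal A_{n,S,r}(u_1,\dots,u_r)$ be the cyclotomic BMW algebras (parameters $\rho,q,\Omega,u_1,\dots,u_r$) or the degenerate cyclotomic BMW algebras (parameters $\Omega,u_1,\dots,u_r$) over $S$. Assume that the left ideal $\mathcal A_{2,S,r}(u_1,\dots,u_r)\,e_1$ is torsion free over $S$, that the parameters are $d$-semi-admissible with $0<d<r$, and that $(y_1-u_1)\cdots(y_1-u_d)e_1=0$ in $\mathcal A_{2,S,r}(u_1,\dots,u_r)$. Let $\theta:\mathcal A_{n,S,r}(u_1,\dots,u_r)\to\mathcal A_{n,S,d}(u_1,\dots,u_d)$ be the surjective algebra homomorphism taking generators to generators. Then $\theta$ induces an isomorphism from the ideal generated by $e_{n-1}$ in $\mathcal A_{n,S,r}(u_1,\dots,u_r)$ onto the ideal generated by $e_{n-1}$ in $\mathcal A_{n,S,d}(u_1,\dots,u_d)$.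
   Context: **Degenerate algebras.** Let $n\ge1$, $S$ a commutative ring with $1$, $\Omega=(\omega_a)_{a\ge0}$ a sequence in $S$. The degenerate affine BMW algebra $\widehat{\mathcal N}_{n,S}(\Omega)$ is the unital associative $S$-algebra with generators $s_i,e_i$ ($1\le i<n$), $y_j$ ($1\le j\le n$) and relations (for all indices for which they make sense): (1) $s_i^2=1$; (2) $s_is_j=s_js_i$ if $|i-j|>1$, $s_is_{i+1}s_i=s_{i+1}s_is_{i+1}$, $s_iy_j=y_js_i$ if $j\ne i,i+1$; (3) $e_i^2=\omega_0e_i$; (4) $e_1y_1^ae_1=\omega_ae_1$ for $a>0$; (5) $s_ie_j=e_js_i$ and $e_ie_j=e_je_i$ if $|i-j|>1$, $e_iy_j=y_je_i$ if $j\ne i,i+1$, $y_iy_j=y_jy_i$; (6) $e_is_i=e_i=s_ie_i$, $s_ie_{i+1}e_i=s_{i+1}e_i$, $e_ie_{i+1}s_i=e_is_{i+1}$, $e_{i+1}e_is_{i+1}=e_{i+1}s_i$, $s_{i+1}e_ie_{i+1}=s_ie_{i+1}$, $e_{i+1}e_ie_{i+1}=e_{i+1}$, $e_ie_{i+1}e_i=e_i$; (7) $s_iy_i-y_{i+1}s_i=e_i-1$, $y_is_i-s_iy_{i+1}=e_i-1$; (8) $e_i(y_i+y_{i+1})=0=(y_i+y_{i+1})e_i$. For $r\ge1$ and $u_1,\dots,u_r\in S$, the degenerate cyclotomic BMW algebra $\mathcal N_{n,S,r}(\Omega;u_1,\dots,u_r)$ is the quotient of $\widehat{\mathcal N}_{n,S}(\Omega)$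 by the relation $(y_1-u_1)\cdots(y_1-u_r)=0$. **Non-degenerate algebras.** Let $\rho,q\in S$ be invertible and $\Omega=(\omega_a)_{a\ge0}$ a sequence in $S$ with $\rho^{-1}-\rho=(q^{-1}-q)(\omega_0-1)$. The affine BMW algebra $\widehat{\mathcal W}_{n,S}(\rho,q,\Omega)$ is the unital associative $S$-algebra with generators $y_1^{\pm1}$, $g_i^{\pm1}$, $e_i$ ($1\le i\le n-1$) and relations: (1) $g_ig_i^{-1}=g_i^{-1}g_i=1$, $y_1y_1^{-1}=y_1^{-1}y_1=1$; (2) $g_ig_{i+1}g_i=g_{i+1}g_ig_{i+1}$, $g_ig_j=g_jg_i$ if $|i-j|\ge2$, $y_1g_1y_1g_1=g_1y_1g_1y_1$, $y_1g_j=g_jy_1$ if $j\ge2$; (3) $e_i^2=\omega_0e_i$; (4) $e_1y_1^je_1=\omega_je_1$ for $j\ge1$; (5) $g_ie_j=e_jg_i$ and $e_ie_j=e_je_i$ if $|i-j|\ge2$, $y_1e_j=e_jy_1$ if $j\ge2$; (6) $g_ie_i=e_ig_i=\rho^{-1}e_i$, $e_ig_{i\pm1}e_i=\rho e_i$, $e_ie_{i\pm1}e_i=e_i$, $g_ig_{i\pm1}e_i=e_{i\pm1}e_i$, $e_ig_{i\pm1}g_i=e_ie_{i\pm1}$; (7) $g_i-g_i^{-1}=(q-q^{-1})(1-e_i)$; (8) $e_1y_1g_1y_1g_1=e_1=g_1y_1g_1y_1e_1$. For $r\ge1$ and invertible $u_1,\dots,u_r\in S$, the cyclotomic BMW algebra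 $\mathcal W_{n,S,r}(\rho,q,\Omega;u_1,\dots,u_r)$ is the quotient of $\widehat{\mathcal W}_{n,S}(\rho,q,\Omega)$ by $(y_1-u_1)\cdots(y_1-u_r)=0$. $\mathcal A_{n,S,r}(u_1,\dots,u_r)$ denotes either $\mathcal W_{n,S,r}(\rho,q,\Omega;u_1,\dots,u_r)$ or $\mathcal N_{n,S,r}(\Omega;u_1,\dots,u_r)$; $\mathcal A_{n,S,d}(u_1,\dots,u_d)$ has the same $\rho,q,\Omega$ (resp. $\Omega$), so the homomorphism $\theta$ exists. ''Ideal'' means two-sided ideal. The parameters are $d$-semi-admissible ($0<d<r$) if $\{e_1,y_1e_1,\dots,y_1^{d-1}e_1\}$ is linearly independent over $S$ in $\mathcal A_{2,S,r}(u_1,\dots,u_r)$ but $\{e_1,y_1e_1,\dots,y_1^de_1\}$ is linearly dependent. (Under the torsion-freeness assumption, after renumbering the $u_i$ one always has $(y_1-u_1)\cdots(y_1-u_d)e_1=0$; the numbering is assumed chosen this way.) *)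

(* Defs.v *)
From HB Require Import structures.
From mathcomp Require Import all_boot all_algebra.
From mathcomp Require Import generic_quotient monalg.
From mathcomp Require Import boolp classical_sets functions.

Set Implicit Arguments.
Unset Strict Implicit.
Unset Printing Implicit Defensive.

Import GRing.Theory.

Local Open Scope classical_set_scope.
Local Open Scope ring_scope.
Local Open Scope quotient_scope.

Section Ideals.
Variable R : pzRingType.

Definition two_sided_ideal (I : set R) : Prop :=
  [/\ I 0, forall x y, I x -> I y -> I (x + y)
    & forall a x b, I x -> I (a * x * b)].

Definition ideal_gen (X : set R) : set R := smallest two_sided_ideal X.

Definition left_ideal_gen (e : R) : set R := range (fun a => a * e).

Lemma ideal_gen_ideal (X : set R) : two_sided_ideal (ideal_gen X).
Proof.
split=> [J [[]] //|x y Ix Iy J JX|a x b Ix J JX].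
- by have [[_ JD _] _] := JX; apply: JD; [apply: Ix|apply: Iy].
- by have [[_ _ JM] _] := JX; apply: JM; apply: Ix.
Qed.

End Ideals.

(* The quotient may be the zero ring, hence the [pz] structures here and     *)
(* below, and the absence of [lalgType] and [algType] instances, which       *)
(* require 1 != 0; see [palg_scalerAl], ..., [cyc_scalerAr] instead.         *)
Section RingQuotient.
Variables (R : pzRingType) (X : set R).

Definition ideal_eq (x y : R) : bool := `[< ideal_gen X (x - y) >].

Let IX := ideal_gen_ideal X.

Lemma ideal_gen0 : ideal_gen X 0. Proof. by have [] := IX. Qed.

Lemma ideal_genD x y :
  ideal_gen X x -> ideal_gen X y -> ideal_gen X (x + y).
Proof. by have [_ + _] := IX; apply. Qed.

Lemma ideal_genMl a x : ideal_gen X x -> ideal_gen X (a * x).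
Proof. by have [_ _ M] := IX => /(M a _ 1); rewrite mulr1. Qed.

Lemma ideal_genMr a x : ideal_gen X x -> ideal_gen X (x * a).
Proof. by have [_ _ M] := IX => /(M 1 _ a); rewrite mul1r. Qed.

Lemma ideal_genN x : ideal_gen X x -> ideal_gen X (- x).
Proof.
by move/(ideal_genMl (-1)); rewrite mulN1r.
Qed.

Lemma ideal_eq_equiv : equiv_class_of ideal_eq.
Proof.
split=> [x|x y|y x z].
- by apply/asboolP; rewrite subrr; apply: ideal_gen0.
- by apply/asboolP/asboolP => /ideal_genN; rewrite opprB.
- move=> /asboolP xy /asboolP yz; apply/asboolP.
  by rewrite -(subrKA y); apply: ideal_genD.
Qed.

Canonical ideal_equiv := EquivRelPack ideal_eq_equiv.
Canonical ideal_encModRel := defaultEncModRel ideal_eq.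

Definition ring_quot : Type := {eq_quot ideal_eq}.
HB.instance Definition _ := Choice.on ring_quot.
HB.instance Definition _ := EqQuotient.on ring_quot.

Lemma ring_quot_eq (x y : R) :
  ideal_gen X (x - y) <-> \pi_ring_quot x = \pi_ring_quot y.
Proof.
by split=> [xy|/eqmodP/asboolP //]; apply/eqmodP/asboolP.
Qed.

(* The locks prevent unification from unfolding the quotient. *)
Fact rq_key : unit. Proof. exact: tt. Qed.
Definition rq_zero := locked_with rq_key (\pi_ring_quot 0).
Definition rq_one := locked_with rq_key (\pi_ring_quot 1).
Definition rq_opp :=
  locked_with rq_key (fun x : ring_quot => \pi_ring_quot (- repr x)).
Definition rq_add := locked_with rq_key
  (fun x y : ring_quot => \pi_ring_quot (repr x + repr y)).
Definition rq_mul := locked_with rq_key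
  (fun x y : ring_quot => \pi_ring_quot (repr x * repr y)).
Canonical rq_zero_unlockable := [unlockable of rq_zero].
Canonical rq_one_unlockable := [unlockable of rq_one].
Canonical rq_opp_unlockable := [unlockable fun rq_opp].
Canonical rq_add_unlockable := [unlockable fun rq_add].
Canonical rq_mul_unlockable := [unlockable fun rq_mul].

Lemma ring_quotP (x : ring_quot) : {a | x = \pi_ring_quot a}.
Proof. by exists (repr x); rewrite reprK. Qed.

Lemma repr_eq x : ideal_gen X (repr (\pi_ring_quot x) - x).
Proof. by apply/ring_quot_eq; rewrite reprK. Qed.

Lemma rq_oppE x : rq_opp (\pi_ring_quot x) = \pi_ring_quot (- x).
Proof.
rewrite unlock; apply/ring_quot_eq.
by rewrite -opprD; apply: ideal_genN; apply: repr_eq.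
Qed.

Lemma rq_addE x y :
  rq_add (\pi_ring_quot x) (\pi_ring_quot y) = \pi_ring_quot (x + y).
Proof.
rewrite unlock; apply/ring_quot_eq.
by rewrite opprD addrACA; apply: ideal_genD; apply: repr_eq.
Qed.

Lemma rq_mulE x y :
  rq_mul (\pi_ring_quot x) (\pi_ring_quot y) = \pi_ring_quot (x * y).
Proof.
rewrite unlock; apply/ring_quot_eq.
rewrite -(subrKA (x * repr (\pi_ring_quot y))) -mulrBl -mulrBr.
by apply: ideal_genD; [apply: ideal_genMr | apply: ideal_genMl];
   apply: repr_eq.
Qed.

Lemma rq_addA : associative rq_add.
Proof.
by move=> /ring_quotP[x ->] /ring_quotP[y ->] /ring_quotP[z ->];
  rewrite !rq_addE addrA.
Qed.

Lemma rq_addC : commutative rq_add.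
Proof.
by move=> /ring_quotP[x ->] /ring_quotP[y ->];
  rewrite !rq_addE addrC.
Qed.

Lemma rq_add0 : left_id rq_zero rq_add.
Proof.
by move=> /ring_quotP[x ->]; rewrite [rq_zero]unlock rq_addE add0r.
Qed.

Lemma rq_addN : left_inverse rq_zero rq_opp rq_add.
Proof.
by move=> /ring_quotP[x ->]; rewrite rq_oppE rq_addE addNr [rq_zero]unlock.
Qed.

HB.instance Definition _ :=
  GRing.isZmodule.Build ring_quot rq_addA rq_addC rq_add0 rq_addN.

Lemma rq_mulA : associative rq_mul.
Proof.
by move=> /ring_quotP[x ->] /ring_quotP[y ->] /ring_quotP[z ->];
  rewrite !rq_mulE mulrA.
Qed.

Lemma rq_mul1 : left_id rq_one rq_mul.
Proof.
by move=> /ring_quotP[x ->]; rewrite [rq_one]unlock rq_mulE mul1r.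
Qed.

Lemma rq_mulr1 : right_id rq_one rq_mul.
Proof.
by move=> /ring_quotP[x ->]; rewrite [rq_one]unlock rq_mulE mulr1.
Qed.

Lemma rq_mulDl : left_distributive rq_mul rq_add.
Proof.
by move=> /ring_quotP[x ->] /ring_quotP[y ->] /ring_quotP[z ->];
  rewrite !(rq_mulE, rq_addE) mulrDl.
Qed.

Lemma rq_mulDr : right_distributive rq_mul rq_add.
Proof.
by move=> /ring_quotP[x ->] /ring_quotP[y ->] /ring_quotP[z ->];
  rewrite !(rq_mulE, rq_addE) mulrDr.
Qed.

HB.instance Definition _ := GRing.Zmodule_isPzRing.Build ring_quot
  rq_mulA rq_mul1 rq_mulr1 rq_mulDl rq_mulDr.

Definition rq_pi : R -> ring_quot := locked_with rq_key \pi_ring_quot.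
Canonical rq_pi_unlockable := [unlockable fun rq_pi].

Lemma rq_pi_nmod : nmod_morphism rq_pi.
Proof.
split=> [|x y]; first by rewrite unlock -[RHS]/rq_zero [RHS]unlock.
by rewrite unlock -rq_addE.
Qed.

HB.instance Definition _ :=
  GRing.isNmodMorphism.Build R ring_quot rq_pi rq_pi_nmod.

Lemma rq_pi_monoid : monoid_morphism rq_pi.
Proof.
split=> [|x y]; first by rewrite unlock -[RHS]/rq_one [RHS]unlock.
by rewrite unlock -rq_mulE.
Qed.

HB.instance Definition _ :=
  GRing.isMonoidMorphism.Build R ring_quot rq_pi rq_pi_monoid.

Lemma rq_pi_eq0 x : rq_pi x = 0 <-> ideal_gen X x.
Proof.
have := ring_quot_eq x 0; rewrite subr0 => xX.
by rewrite -(rmorph0 rq_pi) /= [rq_pi]unlock; apply: iff_sym.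
Qed.

Lemma rq_pi_surj (x : ring_quot) : exists a, x = rq_pi a.
Proof. by exists (repr x); rewrite unlock reprK. Qed.

Lemma rq_pi_repr (x : ring_quot) : rq_pi (repr x) = x.
Proof. by rewrite unlock reprK. Qed.

Lemma repr_rq_pi x : ideal_gen X (repr (rq_pi x) - x).
Proof. by apply/rq_pi_eq0; rewrite rmorphB /= rq_pi_repr subrr. Qed.

End RingQuotient.

Lemma malg_scalerAr (S : comNzRingType) (K : monomType) (c : S)
    (x y : {malg S[K]}) : c *: (x * y) = x * (c *: y).
Proof.
have cC (z : {malg S[K]}) : c%:MP * z = z * c%:MP.
  rewrite !malgM_def fgmulUg fgmulgU; apply: eq_bigr => k _.
  by rewrite mul1m mulm1 mulrC.
by rewrite -!mul_malgC mulrA cC mulrA.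
Qed.

(* Algebra over S presented by generators in I and relations E: the quotient *)
(* of the free S-algebra on I by the ideal generated by the x - y with E x y *)
Section PresentedAlgebra.
Variables (S : comNzRingType) (I : choiceType).

Definition free_alg : Type := {malg S[{fmonom I}]}.
HB.instance Definition _ := GRing.Lalgebra.on free_alg.

Definition gen (i : I) : free_alg := mkmalgU (fmu i) 1.

Lemma free_scalerAr (c : S) (x y : free_alg) : c *: (x * y) = x * (c *: y).
Proof. exact: malg_scalerAr. Qed.

Definition relators (E : free_alg -> free_alg -> Prop) : set free_alg :=
  [set p | exists x y, E x y /\ p = x - y].

Variable E : free_alg -> free_alg -> Prop.

Definition palg : Type := ring_quot (relators E).
HB.instance Definition _ := GRing.PzRing.on palg.

Definition palg_pi (x : free_alg) : palg := rq_pi (relators E) x.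
HB.instance Definition _ := GRing.isNmodMorphism.Build free_alg palg palg_pi
  (rq_pi_nmod (relators E)).
HB.instance Definition _ := GRing.isMonoidMorphism.Build free_alg palg palg_pi
  (rq_pi_monoid (relators E)).

Definition palg_scale : S -> palg -> palg :=
  locked_with rq_key (fun (c : S) x => palg_pi c%:A * x).
Canonical palg_scale_unlockable := [unlockable fun palg_scale].

Lemma palg_pi_scale c x : palg_pi (c *: x) = palg_scale c (palg_pi x).
Proof. by rewrite unlock -rmorphM -scalerAl mul1r. Qed.

Lemma palg_scaleA a b x :
  palg_scale a (palg_scale b x) = palg_scale (a * b) x.
Proof.
by have [z ->] := rq_pi_surj x; rewrite -!palg_pi_scale scalerA.
Qed.

Lemma palg_scale1 : left_id 1 palg_scale.
Proof.
by move=> x; have [z ->] := rq_pi_surj x; rewrite -palg_pi_scale scale1r.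
Qed.

Lemma palg_scaleDr : right_distributive palg_scale +%R.
Proof. by move=> c x y; rewrite unlock mulrDr. Qed.

Lemma palg_scaleDl x : {morph palg_scale^~ x : a b / a + b}.
Proof. by move=> a b; rewrite unlock scalerDl rmorphD mulrDl. Qed.

HB.instance Definition _ := GRing.Zmodule_isLmodule.Build S palg
  palg_scaleA palg_scale1 palg_scaleDr palg_scaleDl.

Lemma palg_pi_scalable : scalable palg_pi.
Proof. exact: palg_pi_scale. Qed.

HB.instance Definition _ := GRing.isScalable.Build S free_alg palg *:%R palg_pi
  palg_pi_scalable.

Lemma palg_pi_surj (x : palg) : exists a, x = palg_pi a.
Proof. exact: rq_pi_surj. Qed.

Lemma palg_pi_rel x y : E x y -> palg_pi x = palg_pi y.
Proof.
move=> Exy; apply/subr0_eq; rewrite -rmorphB; apply/rq_pi_eq0.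
by apply: sub_gen_smallest; exists x, y.
Qed.

Lemma palg_scalerAl (c : S) (x y : palg) : c *: (x * y) = (c *: x) * y.
Proof. by rewrite -![_ *: _]/(palg_scale _ _) unlock mulrA. Qed.

Lemma palg_scalerAr (c : S) (x y : palg) : c *: (x * y) = x * (c *: y).
Proof.
have [a ->] := palg_pi_surj x; have [b ->] := palg_pi_surj y.
rewrite -rmorphM -[LHS]palg_pi_scale -[c *: palg_pi b]palg_pi_scale -rmorphM.
by congr (palg_pi _); apply: free_scalerAr.
Qed.

End PresentedAlgebra.

(* The quotient of the algebra presented by E by the relation                *)
(* (y - u_1) ... (y - u_r) = 0, where u = [:: u_1; ...; u_r].                *)
Section CyclotomicQuotient.
Variables (S : comNzRingType) (I : choiceType).
Variables (E : free_alg S I -> free_alg S I -> Prop) (y : palg E) (u : seq S).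

Definition cyc_poly : palg E := \prod_(c <- u) (y - c *: (1 : palg E)).

Definition cyc_alg : Type := ring_quot [set cyc_poly].
HB.instance Definition _ := GRing.PzRing.on cyc_alg.

Definition cyc_pi (x : palg E) : cyc_alg := rq_pi [set cyc_poly] x.
HB.instance Definition _ := GRing.isNmodMorphism.Build (palg E) cyc_alg cyc_pi
  (rq_pi_nmod [set cyc_poly]).
HB.instance Definition _ := GRing.isMonoidMorphism.Build (palg E) cyc_alg cyc_pi
  (rq_pi_monoid [set cyc_poly]).

Definition cyc_scale : S -> cyc_alg -> cyc_alg :=
  locked_with rq_key (fun (c : S) x => cyc_pi (c *: (1 : palg E)) * x).
Canonical cyc_scale_unlockable := [unlockable fun cyc_scale].

Lemma cyc_pi_scale c x : cyc_pi (c *: x) = cyc_scale c (cyc_pi x).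
Proof. by rewrite unlock -rmorphM -palg_scalerAl mul1r. Qed.

Lemma cyc_scaleA a b x : cyc_scale a (cyc_scale b x) = cyc_scale (a * b) x.
Proof.
by have [z ->] := rq_pi_surj x; rewrite -!cyc_pi_scale scalerA.
Qed.

Lemma cyc_scale1 : left_id 1 cyc_scale.
Proof.
by move=> x; have [z ->] := rq_pi_surj x; rewrite -cyc_pi_scale scale1r.
Qed.

Lemma cyc_scaleDr : right_distributive cyc_scale +%R.
Proof. by move=> c x z; rewrite unlock mulrDr. Qed.

Lemma cyc_scaleDl x : {morph cyc_scale^~ x : a b / a + b}.
Proof. by move=> a b; rewrite unlock scalerDl rmorphD mulrDl. Qed.

HB.instance Definition _ := GRing.Zmodule_isLmodule.Build S cyc_alg
  cyc_scaleA cyc_scale1 cyc_scaleDr cyc_scaleDl.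

Lemma cyc_pi_scalable : scalable cyc_pi.
Proof. exact: cyc_pi_scale. Qed.

HB.instance Definition _ := GRing.isScalable.Build S (palg E) cyc_alg *:%R
  cyc_pi cyc_pi_scalable.

Lemma cyc_pi_surj (x : cyc_alg) : exists a, x = cyc_pi a.
Proof. exact: rq_pi_surj. Qed.

Lemma cyc_pi_poly : cyc_pi cyc_poly = 0.
Proof. by apply/rq_pi_eq0; apply: sub_gen_smallest. Qed.

Lemma cyc_scalerAl (c : S) (x z : cyc_alg) : c *: (x * z) = (c *: x) * z.
Proof. by rewrite -![_ *: _]/(cyc_scale _ _) unlock mulrA. Qed.

Lemma cyc_scalerAr (c : S) (x z : cyc_alg) : c *: (x * z) = x * (c *: z).
Proof.
have [a ->] := cyc_pi_surj x; have [b ->] := cyc_pi_surj z.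
rewrite -rmorphM -[LHS]cyc_pi_scale -[c *: cyc_pi b]cyc_pi_scale -rmorphM.
by congr (cyc_pi _); apply: palg_scalerAr.
Qed.

End CyclotomicQuotient.

(* The algebra morphism taking generators to generators from the quotient by *)
(* (y - u_1) ... (y - u_r) onto the quotient by (y - u_1) ... (y - u_d):     *)
(* both are quotients of [palg E], see [theta_pi] and [theta_surj].          *)
Section Theta.
Variables (S : comNzRingType) (I : choiceType).
Variables (E : free_alg S I -> free_alg S I -> Prop) (y : palg E).
Variables (u : seq S) (d : nat).

Definition theta (x : cyc_alg y u) : cyc_alg y (take d u) :=
  cyc_pi y (take d u) (repr x).

Lemma theta_pi (a : palg E) : theta (cyc_pi y u a) = cyc_pi y (take d u) a.
Proof.
have sub : ideal_gen [set cyc_poly y u]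
    `<=` ideal_gen [set cyc_poly y (take d u)]; last first.
  apply/subr0_eq; rewrite /theta -rmorphB; apply/rq_pi_eq0.
  by apply: sub; apply: repr_rq_pi.
apply: smallest_sub; first exact: ideal_gen_ideal.
move=> _ ->.
have -> : cyc_poly y u = cyc_poly y (take d u) * cyc_poly y (drop d u).
  by rewrite /cyc_poly -big_cat cat_take_drop.
by apply: ideal_genMr; apply: sub_gen_smallest.
Qed.

Lemma theta_nmod : nmod_morphism theta.
Proof.
split; first by rewrite -(rmorph0 (cyc_pi y u)) theta_pi rmorph0.
move=> x z; have [[a ->] [b ->]] := (cyc_pi_surj x, cyc_pi_surj z).
by rewrite -rmorphD !theta_pi rmorphD.
Qed.

Lemma theta_monoid : monoid_morphism theta.
Proof.
split; first by rewrite -(rmorph1 (cyc_pi y u)) theta_pi rmorph1.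
move=> x z; have [[a ->] [b ->]] := (cyc_pi_surj x, cyc_pi_surj z).
by rewrite -rmorphM !theta_pi rmorphM.
Qed.

Lemma theta_scalable : scalable theta.
Proof.
move=> c x; have [a ->] := cyc_pi_surj x.
by rewrite -linearZ !theta_pi linearZ.
Qed.

HB.instance Definition _ :=
  GRing.isNmodMorphism.Build (cyc_alg y u) (cyc_alg y (take d u)) theta
    theta_nmod.
HB.instance Definition _ :=
  GRing.isMonoidMorphism.Build (cyc_alg y u) (cyc_alg y (take d u)) theta
    theta_monoid.
HB.instance Definition _ :=
  GRing.isScalable.Build S (cyc_alg y u) (cyc_alg y (take d u)) *:%R theta
    theta_scalable.

Lemma theta_surj (x : cyc_alg y (take d u)) : exists z, x = theta z.
Proof.
by have [a ->] := cyc_pi_surj x; exists (cyc_pi y u a); rewrite theta_pi.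
Qed.

End Theta.

Arguments theta {S I E} y u d _.

Section LinearAlgebra.
Variables (S : comNzRingType) (V : lmodType S).

Definition torsion_free (U : set V) : Prop :=
  forall (c : S) (x : V), U x -> c *: x = 0 -> c = 0 \/ x = 0.

Definition lin_indep (m : nat) (v : nat -> V) : Prop :=
  forall c : 'I_m -> S, \sum_(i < m) c i *: v i = 0 -> forall i, c i = 0.

Definition semi_admissible (d : nat) (v : nat -> V) : Prop :=
  lin_indep d v /\ ~ lin_indep d.+1 v.

End LinearAlgebra.

Definition far (i j : nat) : bool := (i.+1 < j)%N || (j.+1 < i)%N.
Definition adj (i j : nat) : bool := (j == i.+1) || (i == j.+1).

(* Degenerate affine BMW algebra. Indices start at 1: s_i and e_i are        *)
(* generators for 0 < i < n, and y_j for 0 < j <= n. The functions [ds],     *)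
(* [de], [dy] take the junk value 0 outside of these ranges.                 *)
Section Degenerate.
Variables (S : comNzRingType) (n : nat).

Definition dgen : choiceType :=
  ({i : nat | (0 < i < n)%N} + {i : nat | (0 < i < n)%N}
   + {j : nat | (0 < j <= n)%N})%type.

Definition ds (i : nat) : free_alg S dgen :=
  oapp (fun k => gen S (inl (inl k) : dgen)) 0 (insub i).
Definition de (i : nat) : free_alg S dgen :=
  oapp (fun k => gen S (inl (inr k) : dgen)) 0 (insub i).
Definition dy (j : nat) : free_alg S dgen :=
  oapp (fun k => gen S (inr k : dgen)) 0 (insub j).

Variable Omega : nat -> S.

Inductive dBMW_rel : free_alg S dgen -> free_alg S dgen -> Prop :=
| d_ss i : (0 < i < n)%N -> dBMW_rel (ds i ^+ 2) 1
| d_ss_far i j : (0 < i < n)%N -> (0 < j < n)%N -> far i j ->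
    dBMW_rel (ds i * ds j) (ds j * ds i)
| d_braid i : (0 < i)%N -> (i.+1 < n)%N ->
    dBMW_rel (ds i * ds i.+1 * ds i) (ds i.+1 * ds i * ds i.+1)
| d_sy i j : (0 < i < n)%N -> (0 < j <= n)%N -> j != i -> j != i.+1 ->
    dBMW_rel (ds i * dy j) (dy j * ds i)
| d_ee i : (0 < i < n)%N -> dBMW_rel (de i ^+ 2) (Omega 0%N *: de i)
| d_eye a : (0 < a)%N -> (1 < n)%N ->
    dBMW_rel (de 1 * dy 1 ^+ a * de 1) (Omega a *: de 1)
| d_se_far i j : (0 < i < n)%N -> (0 < j < n)%N -> far i j ->
    dBMW_rel (ds i * de j) (de j * ds i)
| d_ee_far i j : (0 < i < n)%N -> (0 < j < n)%N -> far i j ->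
    dBMW_rel (de i * de j) (de j * de i)
| d_ey i j : (0 < i < n)%N -> (0 < j <= n)%N -> j != i -> j != i.+1 ->
    dBMW_rel (de i * dy j) (dy j * de i)
| d_yy i j : (0 < i <= n)%N -> (0 < j <= n)%N ->
    dBMW_rel (dy i * dy j) (dy j * dy i)
| d_es i : (0 < i < n)%N -> dBMW_rel (de i * ds i) (de i)
| d_se i : (0 < i < n)%N -> dBMW_rel (ds i * de i) (de i)
| d_see i : (0 < i)%N -> (i.+1 < n)%N ->
    dBMW_rel (ds i * de i.+1 * de i) (ds i.+1 * de i)
| d_ees i : (0 < i)%N -> (i.+1 < n)%N ->
    dBMW_rel (de i * de i.+1 * ds i) (de i * ds i.+1)
| d_ees' i : (0 < i)%N -> (i.+1 < n)%N ->
    dBMW_rel (de i.+1 * de i * ds i.+1) (de i.+1 * ds i)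
| d_see' i : (0 < i)%N -> (i.+1 < n)%N ->
    dBMW_rel (ds i.+1 * de i * de i.+1) (ds i * de i.+1)
| d_eee i : (0 < i)%N -> (i.+1 < n)%N ->
    dBMW_rel (de i.+1 * de i * de i.+1) (de i.+1)
| d_eee' i : (0 < i)%N -> (i.+1 < n)%N ->
    dBMW_rel (de i * de i.+1 * de i) (de i)
| d_skein i : (0 < i < n)%N ->
    dBMW_rel (ds i * dy i - dy i.+1 * ds i) (de i - 1)
| d_skein' i : (0 < i < n)%N ->
    dBMW_rel (dy i * ds i - ds i * dy i.+1) (de i - 1)
| d_eyy i : (0 < i < n)%N -> dBMW_rel (de i * (dy i + dy i.+1)) 0
| d_yye i : (0 < i < n)%N -> dBMW_rel ((dy i + dy i.+1) * de i) 0.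

Definition affine_dBMW : Type := palg dBMW_rel.
Definition affine_dy1 : affine_dBMW := palg_pi dBMW_rel (dy 1).

Variable u : seq S.

Definition cyc_dBMW : Type := cyc_alg affine_dy1 u.

Definition dS (i : nat) : cyc_dBMW :=
  cyc_pi affine_dy1 u (palg_pi dBMW_rel (ds i)).
Definition dE (i : nat) : cyc_dBMW :=
  cyc_pi affine_dy1 u (palg_pi dBMW_rel (de i)).
Definition dY (j : nat) : cyc_dBMW :=
  cyc_pi affine_dy1 u (palg_pi dBMW_rel (dy j)).

End Degenerate.

(* Affine BMW algebra. Indices start at 1: [cg i] and [ce i] are generators  *)
(* for 0 < i < n and take the junk value 0 otherwise. In [cgen], the boolean *)
(* tells the formal inverse (false) from the generator itself (true).        *)
(* Invertibility of rho, q and the u_i, and the condition                    *)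
(* rho^-1 - rho = (q^-1 - q) (omega_0 - 1), are left as hypotheses.          *)
Section NonDegenerate.
Variables (S : comUnitRingType) (n : nat).

Definition cgen : choiceType :=
  (bool + {i : nat | (0 < i < n)%N} * bool + {i : nat | (0 < i < n)%N})%type.

Definition cy : free_alg S cgen := gen S (inl (inl true) : cgen).
Definition cyV : free_alg S cgen := gen S (inl (inl false) : cgen).
Definition cg (i : nat) : free_alg S cgen :=
  oapp (fun k => gen S (inl (inr (k, true)) : cgen)) 0 (insub i).
Definition cgV (i : nat) : free_alg S cgen :=
  oapp (fun k => gen S (inl (inr (k, false)) : cgen)) 0 (insub i).
Definition ce (i : nat) : free_alg S cgen :=
  oapp (fun k => gen S (inr k : cgen)) 0 (insub i).

Variables (rho q : S) (Omega : nat -> S).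

Inductive cBMW_rel : free_alg S cgen -> free_alg S cgen -> Prop :=
| c_ggV i : (0 < i < n)%N -> cBMW_rel (cg i * cgV i) 1
| c_gVg i : (0 < i < n)%N -> cBMW_rel (cgV i * cg i) 1
| c_yyV : cBMW_rel (cy * cyV) 1
| c_yVy : cBMW_rel (cyV * cy) 1
| c_braid i : (0 < i)%N -> (i.+1 < n)%N ->
    cBMW_rel (cg i * cg i.+1 * cg i) (cg i.+1 * cg i * cg i.+1)
| c_gg_far i j : (0 < i < n)%N -> (0 < j < n)%N -> far i j ->
    cBMW_rel (cg i * cg j) (cg j * cg i)
| c_ygyg : (1 < n)%N ->
    cBMW_rel (cy * cg 1 * cy * cg 1) (cg 1 * cy * cg 1 * cy)
| c_yg j : (1 < j < n)%N -> cBMW_rel (cy * cg j) (cg j * cy)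
| c_ee i : (0 < i < n)%N -> cBMW_rel (ce i ^+ 2) (Omega 0%N *: ce i)
| c_eye j : (0 < j)%N -> (1 < n)%N ->
    cBMW_rel (ce 1 * cy ^+ j * ce 1) (Omega j *: ce 1)
| c_ge_far i j : (0 < i < n)%N -> (0 < j < n)%N -> far i j ->
    cBMW_rel (cg i * ce j) (ce j * cg i)
| c_ee_far i j : (0 < i < n)%N -> (0 < j < n)%N -> far i j ->
    cBMW_rel (ce i * ce j) (ce j * ce i)
| c_ye j : (1 < j < n)%N -> cBMW_rel (cy * ce j) (ce j * cy)
| c_ge i : (0 < i < n)%N -> cBMW_rel (cg i * ce i) (rho^-1 *: ce i)
| c_eg i : (0 < i < n)%N -> cBMW_rel (ce i * cg i) (rho^-1 *: ce i)
| c_ege i j : (0 < i < n)%N -> (0 < j < n)%N -> adj i j ->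
    cBMW_rel (ce i * cg j * ce i) (rho *: ce i)
| c_eee i j : (0 < i < n)%N -> (0 < j < n)%N -> adj i j ->
    cBMW_rel (ce i * ce j * ce i) (ce i)
| c_gge i j : (0 < i < n)%N -> (0 < j < n)%N -> adj i j ->
    cBMW_rel (cg i * cg j * ce i) (ce j * ce i)
| c_egg i j : (0 < i < n)%N -> (0 < j < n)%N -> adj i j ->
    cBMW_rel (ce i * cg j * cg i) (ce i * ce j)
| c_skein i : (0 < i < n)%N ->
    cBMW_rel (cg i - cgV i) ((q - q^-1) *: (1 - ce i))
| c_eygyg : (1 < n)%N -> cBMW_rel (ce 1 * cy * cg 1 * cy * cg 1) (ce 1)
| c_gygye : (1 < n)%N -> cBMW_rel (cg 1 * cy * cg 1 * cy * ce 1) (ce 1).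

Definition affine_cBMW : Type := palg cBMW_rel.
Definition affine_cy1 : affine_cBMW := palg_pi cBMW_rel cy.

Variable u : seq S.

Definition cyc_cBMW : Type := cyc_alg affine_cy1 u.

Definition cG (i : nat) : cyc_cBMW :=
  cyc_pi affine_cy1 u (palg_pi cBMW_rel (cg i)).
Definition cE (i : nat) : cyc_cBMW :=
  cyc_pi affine_cy1 u (palg_pi cBMW_rel (ce i)).
Definition cY : cyc_cBMW :=
  cyc_pi affine_cy1 u (palg_pi cBMW_rel cy).

End NonDegenerate.

Lemma theta_dS (S : comNzRingType) n (Omega : nat -> S) u d i :
  theta (affine_dy1 n Omega) u d (dS n Omega u i) = dS n Omega (take d u) i.
Proof. exact: theta_pi. Qed.

Lemma theta_dE (S : comNzRingType) n (Omega : nat -> S) u d i :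
  theta (affine_dy1 n Omega) u d (dE n Omega u i) = dE n Omega (take d u) i.
Proof. exact: theta_pi. Qed.

Lemma theta_dY (S : comNzRingType) n (Omega : nat -> S) u d i :
  theta (affine_dy1 n Omega) u d (dY n Omega u i) = dY n Omega (take d u) i.
Proof. exact: theta_pi. Qed.

Lemma theta_cG (S : comUnitRingType) n (rho q : S) Omega u d i :
  theta (affine_cy1 n rho q Omega) u d (cG n rho q Omega u i)
  = cG n rho q Omega (take d u) i.
Proof. exact: theta_pi. Qed.

Lemma theta_cE (S : comUnitRingType) n (rho q : S) Omega u d i :
  theta (affine_cy1 n rho q Omega) u d (cE n rho q Omega u i)
  = cE n rho q Omega (take d u) i.
Proof. exact: theta_pi. Qed.

Lemma theta_cY (S : comUnitRingType) n (rho q : S) Omega u d :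
  theta (affine_cy1 n rho q Omega) u d (cY n rho q Omega u)
  = cY n rho q Omega (take d u).
Proof. exact: theta_pi. Qed.

(* Main.v *)
Require Import Defs.
From HB Require Import structures.
From mathcomp Require Import all_boot all_fingroup all_algebra.
From mathcomp Require Import mpoly ring zify.
From mathcomp Require monalg.
From mathcomp Require Import boolp classical_sets functions.

Set Implicit Arguments.
Unset Strict Implicit.
Unset Printing Implicit Defensive.

Import GRing.Theory.

Local Open Scope classical_set_scope.
Local Open Scope ring_scope.

(* Let p = (y_1 - u_1) ... (y_1 - u_d). An anti-involution turns p e_1 = 0   *)
(* into e_1 p = 0, so it is enough to work in the quotient T of the affine   *)
(* algebra by p e_1 and e_1 p: the ideal of e_{n-1} in A_r embeds into A_d   *)
(* as soon as the ideals (p) and (e_{n-1}) of T meet in 0. These two ideals  *)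
(* annihilate each other, so (p) is a bimodule over Q = T / (e_{n-1}). The   *)
(* ring Q satisfies the relations of an affine Hecke algebra, and acts on    *)
(* its generic principal series, where the PBW monomials are linearly        *)
(* independent. With t_i = s_{i-1} ... s_1 and t_i' = s_1 ... s_{i-1}, one   *)
(* has t_i p t_i' = y_i^d + lower terms, so (p) is spanned by the elements   *)
(* y^m t_i p t_i' w where w is a reduced word and the exponents of y_1, ..., *)
(* y_{i-1} in y^m are less than d. The images of these in Q have the         *)
(* distinct leading terms y^m y_i^d w, hence (p) maps injectively to Q. In   *)
(* the non-degenerate case s_i stands for g_i, and a power of the central    *)
(* element y_1 ... y_n is used to clear the inverses of the y_i.             *)

(** * PBW spans in affine Hecke algebras *)

(** Let A be the affine algebra and p = (y_1 - u_1) ... (y_1 - u_d). In A_r one has p e_1 = 0, and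
    also e_1 p = 0 because the relations are stable under reversal of words. So A_r is a quotient of
    T = A / (p e_1, e_1 p), and A_d is T / (p). Since theta is surjective and preserves e_{n-1}, it
    maps one ideal onto the other. An element of the first ideal killed by theta lifts to an element
    of A lying both in (e_{n-1}) and in (p), so injectivity follows once these two ideals meet in 0
    in T ([theta_bij]).

    That disjointness is [ideals_disjoint]. In T one has p x e_j = 0 = e_j x p for all x
    ([dbmw_annihilates], [cbmw_annihilates]). Hence a product h p h' depends only on the images of h
    and h' in Q = T / (e_{n-1}); this is the bracket [br]. What remains is that T -> Q is injective
    on (p), which is [ideal_gen_inj]. The ring Q satisfies the affine Hecke relations, and its PBW
    monomials y^m w are independent because they act independently on the principal series
    ([word_indep], [calibrated_rep]).

    All y_i and all s_i with i > 1 commute with p, so left factors can be brought to the form y^m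
    t_i with t_i a coset word ([layer_pbw2]). By [conj_top], t_i p t_i' = y_i^d + lower terms. This
    is used twice. As a rewriting rule for y_l^d it brings the exponents of the variables before y_i
    below d ([layer_red]). It also gives the leading monomial y^m y_i^d w of a reduced bracket in Q;
    there y_i is the first variable whose exponent is at least d, so distinct reduced brackets have
    distinct leading monomials ([red_lead]), and a combination that vanishes in Q is trivial
    ([layer_inj]). *)

Section Exponents.
Variable n : nat.
Implicit Types m : 'X_{1..n}.

Definition Um (i k : nat) : 'X_{1..n} := [multinom (j == i :> nat) * k | j < n].

Lemma UmE i k (j : 'I_n) : Um i k j = ((j == i :> nat) * k)%N.
Proof. by rewrite mnmE. Qed.

Lemma mnm_ind_nat (P : 'X_{1..n} -> Prop) :
  P 0%MM -> (forall i m, (i < n)%N -> P m -> P (Um i 1 + m)%MM) ->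
  forall m, P m.
Proof.
move=> P0 PS m; have [k] := ubnP (mdeg m); elim: k m => // k IHk m lemk.
have [->//|/eqP/mnmP m0] := eqVneq m 0%MM.
have [i mi] : exists i : 'I_n, (0 < m i)%N.
  apply: contrapT => /forallNP mn; apply: m0 => i.
  by rewrite mnm0E; apply/eqP; rewrite -leqn0 leqNgt; apply/negP/mn.
have mE : m = (Um i 1 + (m - Um i 1))%MM.
  apply/mnmP=> j; rewrite !mnmE; case: eqP => [/val_inj->|_]; lia.
rewrite mE; apply: PS => //; apply: IHk; move: lemk.
rewrite {1}mE mdegD; suff -> : mdeg (Um i 1) = 1%N by lia.
rewrite mdegE (bigD1 i) //= UmE eqxx big1 // => j /negPf.
by rewrite UmE -val_eqE /= => ->.
Qed.

Lemma mdeg_Um i k : (i < n)%N -> mdeg (Um i k) = k.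
Proof.
move=> lt_i; rewrite mdegE (bigD1 (Ordinal lt_i)) //= UmE eqxx mul1n big1 ?addn0 //.
by move=> j /negPf; rewrite UmE -val_eqE /= => ->.
Qed.

(* A weighting of the variables in which [y_i ^ d] outweighs every monomial  *)
(* of degree at most [d] in [y_0 .. y_i] whose exponent of [y_i] is below d. *)
Definition wt (d : nat) m : nat := (\sum_(i < n) m i * d.+1 ^ i)%N.

Lemma wtD d m m' : wt d (m + m')%MM = (wt d m + wt d m')%N.
Proof. by rewrite -big_split; apply: eq_bigr => i _; rewrite mnmDE mulnDl. Qed.

Lemma wtU d i k : (i < n)%N -> wt d (Um i k) = (k * d.+1 ^ i)%N.
Proof.
move=> lt_i; rewrite /wt (bigD1 (Ordinal lt_i)) //= UmE eqxx mul1n big1 ?addn0 //.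
by move=> j /negPf; rewrite UmE -val_eqE /= => ->.
Qed.

Definition below (d j : nat) m : Prop :=
  [/\ (mdeg m <= d)%N, forall i : 'I_n, (j < i)%N -> m i = 0%N
    & forall i : 'I_n, i = j :> nat -> (m i < d)%N].

Lemma wt_below d j m : (j < n)%N -> below d j m -> (wt d m < d * d.+1 ^ j)%N.
Proof.
move=> lt_j [degm m0 mj]; pose oj := Ordinal lt_j.
have {}mj : (m oj < d)%N by apply: mj.
move: degm; rewrite mdegE /wt (bigD1 oj) //= [X in (X < _)%N](bigD1 oj) //=.
set A := (\sum_(i < n | i != oj) m i)%N.
set B := (\sum_(i < n | i != oj) m i * d.+1 ^ i)%N => degm.
(* The other variables that occur have index below [j], hence weight at most (d+1)^(j-1); the factor
   d+1 is moved to the left to avoid this exponent. *)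
suff BA : (B * d.+1 <= A * d.+1 ^ j)%N.
  rewrite -(ltn_pmul2r (ltn0Sn d)) mulnDl.
  have D0 : (0 < d.+1 ^ j)%N by rewrite expn_gt0.
  move: (d.+1 ^ j)%N D0 BA => D D0 BA; nia.
rewrite /A /B !big_distrl; apply: leq_sum => i ne_i.
have [lt_ji|le_ij] := ltnP j i; first by rewrite m0.
have lt_ij : (i < j)%N by rewrite ltn_neqAle le_ij andbT.
rewrite [X in (X <= _)%N](_ : _ = m i * d.+1 ^ i.+1)%N; last by rewrite expnSr mulnA.
by rewrite leq_mul2l leq_exp2l ?lt_ij ?orbT //; case: (d) mj.
Qed.

End Exponents.

(** * Coset words and the braid relations *)

Record braid_rel (Q : pzRingType) (n : nat) (s : nat -> Q) : Prop := BraidRel {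
  ah_far : forall i j, (i.+1 < j)%N -> (j.+1 < n)%N -> s i * s j = s j * s i;
  ah_braid : forall i, (i.+2 < n)%N -> s i * s i.+1 * s i = s i.+1 * s i * s i.+1
}.

Section CosetWords.
Variables (Q : pzRingType) (n : nat) (s : nat -> Q).
Hypothesis BR : braid_rel n s.

(* [ts i] would be the inverse of [t i] with [sV] in place of [s].            *)
Fixpoint t (i : nat) : Q := if i is j.+1 then s j * t j else 1.
Fixpoint ts (i : nat) : Q := if i is j.+1 then ts j * s j else 1.

Lemma t_far k i : (i < k)%N -> (k.+1 < n)%N -> s k * t i = t i * s k.
Proof.
elim: i => [|i IHi] lt_i lt_k /=; first by rewrite mulr1 mul1r.
by rewrite mulrA -(ah_far BR lt_i lt_k) -mulrA IHi ?mulrA // ltnW.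
Qed.

Lemma ts_far k i : (i < k)%N -> (k.+1 < n)%N -> s k * ts i = ts i * s k.
Proof.
elim: i => [|i IHi] lt_i lt_k /=; first by rewrite mulr1 mul1r.
by rewrite mulrA IHi ?(ltnW lt_i) // -!mulrA (ah_far BR lt_i lt_k).
Qed.

(** Conjugation by the cycle [t i] shifts the generators by one; the first case, [i = k.+2], is the
    braid relation. With [ts_shift] it carries [s k] through [t i] as [s k.+1], which commutes with
    p, and then through [ts i] back to [s k]. *)
Lemma t_shift k i : (k.+1 < i)%N -> (i < n)%N -> s k * t i = t i * s k.+1.
Proof.
elim: i => // i IHi lt_k lt_i /=; have [lt_ki|] := ltnP k.+1 i.
  by rewrite mulrA (ah_far BR lt_ki lt_i) -mulrA IHi ?mulrA // ltnW.
move=> le_ik; have ik : i = k.+1 by lia.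
rewrite {}ik in lt_i *; clear IHi lt_k le_ik.
by rewrite /= !mulrA (ah_braid BR) // -!mulrA t_far.
Qed.

Lemma ts_shift k i : (k.+1 < i)%N -> (i < n)%N -> s k.+1 * ts i = ts i * s k.
Proof.
elim: i => // i IHi lt_k lt_i /=; have [lt_ki|] := ltnP k.+1 i.
  by rewrite mulrA IHi ?(ltnW lt_i) // -!mulrA (ah_far BR lt_ki lt_i).
move=> le_ik; have ik : i = k.+1 by lia.
rewrite {}ik in lt_i *; clear IHi lt_k le_ik.
by rewrite /= !mulrA ts_far // -!mulrA !(mulrA (s _)) (ah_braid BR).
Qed.

End CosetWords.

(* The affine Hecke algebra, in a presentation covering both the degenerate  *)
(* ((a, b) = (1, 0)) and the non-degenerate ((a, b) = (0, q - q^-1)) cases.   *)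
Record affine_hecke (S : comNzRingType) (Q : pzRingType) (kap : S -> Q)
    (n : nat) (a b : S) (s y : nat -> Q) : Prop := AffineHecke {
  ah_central : forall c x, kap c * x = x * kap c;
  ah_ss : forall i, (i.+1 < n)%N -> s i * s i = kap b * s i + 1;
  ah_br :> braid_rel n s;
  ah_sy : forall i, (i.+1 < n)%N ->
    s i * y i = y i.+1 * s i - (kap a + kap b * y i.+1);
  ah_sy' : forall i, (i.+1 < n)%N ->
    s i * y i.+1 = y i * s i + (kap a + kap b * y i.+1);
  ah_sy_far : forall i j, (i.+1 < n)%N -> (j < n)%N -> j != i -> j != i.+1 ->
    s i * y j = y j * s i;
  ah_yy : forall i j, (i < n)%N -> (j < n)%N -> y i * y j = y j * y i
}.

Section Hecke.
Variables (S : comNzRingType) (Q : pzRingType) (kap : {rmorphism S -> Q}).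
Variables (n : nat) (a b : S) (s y : nat -> Q).
Hypothesis AH : affine_hecke kap n a b s y.

Let kapC := ah_central AH.

(** The finite Hecke algebra on [j] strands, as the span of words built from the left. Both [j = 0]
    and [j = 1] give the scalars alone. *)
Inductive inW (j : nat) : Q -> Prop :=
| inW_kap c : inW j (kap c)
| inW_D v w : inW j v -> inW j w -> inW j (v + w)
| inW_sM i v : (i.+1 < j)%N -> inW j v -> inW j (s i * v).

Lemma inW1 j : inW j 1. Proof. by rewrite -(rmorph1 kap); apply: inW_kap. Qed.

Lemma inWZ j c v : inW j v -> inW j (kap c * v).
Proof.
elim=> [k|u w _ + _|i w lt_i _ IHw].
- by rewrite -rmorphM; apply: inW_kap.
- by rewrite mulrDr; apply: inW_D.
- by rewrite mulrA kapC -mulrA; apply: (inW_sM lt_i).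
Qed.

Lemma inWN j v : inW j v -> inW j (- v).
Proof. by move/(inWZ (-1)); rewrite rmorphN1 mulN1r. Qed.

Lemma inWM j v w : inW j v -> inW j w -> inW j (v * w).
Proof.
move=> + Ww; elim=> [c|u v' _ + _|i v' lt_i _].
- exact: inWZ.
- by rewrite mulrDl; apply: inW_D.
- by rewrite -mulrA; apply: (inW_sM lt_i).
Qed.

Lemma inWs j i : (i.+1 < j)%N -> inW j (s i).
Proof. by move=> lt_i; rewrite -[s i]mulr1; apply: inW_sM (inW1 _). Qed.

Lemma inW_mono j k v : (j <= k)%N -> inW j v -> inW k v.
Proof.
move=> le_jk; elim=> [c|u w _ + _|i w lt_i _]; [exact: inW_kap|exact: inW_D|].
by apply: (inW_sM (leq_trans lt_i le_jk)).
Qed.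

(** The inverse of [s i], read off the quadratic relation. *)
Definition sV i := s i - kap b.

Lemma sVK i : (i.+1 < n)%N -> s i * sV i = 1.
Proof. by move=> lt_i; rewrite mulrBr (ah_ss AH) // kapC addrAC subrr add0r. Qed.

Lemma inW_sV j i : (i.+1 < j)%N -> inW j (sV i).
Proof. by move=> lt_i; apply: inW_D; [apply: inWs|apply/inWN/inW_kap]. Qed.

Definition mon (m : 'X_{1..n}) : Q := \prod_(i < n) y i ^+ m i.

Lemma mon0 : mon 0%MM = 1.
Proof. by rewrite /mon big1 // => i _; rewrite mnm0E. Qed.

Lemma monD m m' : mon (m + m')%MM = mon m * mon m'.
Proof.
rewrite /mon -prodrM_comm => [|i j _ _].
  by apply: eq_bigr => i _; rewrite mnmDE exprD.
exact/commrX/commr_sym/commrX/(ah_yy AH).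
Qed.

Lemma monC m m' : mon m * mon m' = mon m' * mon m.
Proof. by rewrite -!monD addmC. Qed.

Lemma monU i k : (i < n)%N -> mon (Um n i k) = y i ^+ k.
Proof.
move=> lt_i; rewrite /mon.
rewrite (eq_bigr (fun j : 'I_n => if j == Ordinal lt_i then y i ^+ k else 1)).
  rewrite -big_mkcond /= (big_pred1 (Ordinal lt_i)) //.
move=> j _; rewrite UmE -val_eqE /=; case: eqP => [->|]; last by rewrite mul0n.
by rewrite mul1n.
Qed.

Lemma monS i m : (i < n)%N -> mon (Um n i 1 + m)%MM = y i * mon m.
Proof. by move=> lt_i; rewrite monD monU. Qed.

Lemma s_monC i (m : 'X_{1..n}) : (i.+1 < n)%N ->
  (forall j : 'I_n, j = i :> nat \/ j = i.+1 :> nat -> m j = 0%N) ->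
  s i * mon m = mon m * s i.
Proof.
move=> lt_i m0; rewrite /mon; apply/commr_prod => j _.
have [ji|ne_ji] := eqVneq (j : nat) i; first by rewrite m0; [exact: commr1|left].
have [ji|ne_ji'] := eqVneq (j : nat) i.+1; first by rewrite m0; [exact: commr1|right].
exact/commrX/(ah_sy_far AH).
Qed.

(** [X] bounds the exponents and [j] the words; the two together express that a term is lower than a
    given leading term. *)
Inductive pbw_span (X : 'X_{1..n} -> Prop) (j : nat) : Q -> Prop :=
| pbw0 : pbw_span X j 0
| pbw_gen m w : X m -> inW j w -> pbw_span X j (mon m * w)
| pbwD u v : pbw_span X j u -> pbw_span X j v -> pbw_span X j (u + v).

Lemma pbw_mono (X X' : 'X_{1..n} -> Prop) j j' u :
  (forall m, X m -> X' m) -> (j <= j')%N -> pbw_span X j u -> pbw_span X' j' u.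
Proof.
move=> XX' le_j; elim=> [|m w Xm Ww|v w _ + _]; [exact: pbw0| |exact: pbwD].
by apply: pbw_gen (XX' _ Xm) (inW_mono le_j Ww).
Qed.

Lemma pbw_Mr X j u w : pbw_span X j u -> inW j w -> pbw_span X j (u * w).
Proof.
move=> Xu Ww; elim: Xu => [|m v Xm Wv|v v' _ + _].
- by rewrite mul0r; apply: pbw0.
- by rewrite -mulrA; apply: pbw_gen Xm (inWM Wv Ww).
- by rewrite mulrDl; apply: pbwD.
Qed.

Lemma pbw_monM (X X' : 'X_{1..n} -> Prop) j m u :
  (forall m', X m' -> X' (m + m')%MM) -> pbw_span X j u ->
  pbw_span X' j (mon m * u).
Proof.
move=> XX'; elim=> [|m' w Xm Ww|v w _ + _].
- by rewrite mulr0; apply: pbw0.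
- by rewrite mulrA -monD; apply: pbw_gen => //; apply: XX'.
- by rewrite mulrDr; apply: pbwD.
Qed.

Lemma pbwZ X j c u : pbw_span X j u -> pbw_span X j (kap c * u).
Proof.
elim=> [|m w Xm Ww|v w _ + _].
- by rewrite mulr0; apply: pbw0.
- by rewrite mulrA kapC -mulrA; apply: pbw_gen => //; apply: inWZ.
- by rewrite mulrDr; apply: pbwD.
Qed.

Lemma pbwN X j u : pbw_span X j u -> pbw_span X j (- u).
Proof. by move/(pbwZ (-1)); rewrite rmorphN1 mulN1r. Qed.

Definition full (_ : 'X_{1..n}) : Prop := True.

Lemma pbw_W j w : inW j w -> pbw_span full j w.
Proof. by move=> Ww; rewrite -[w]mul1r -mon0; apply: pbw_gen. Qed.

Lemma pbw_yM j i u : (i < n)%N -> pbw_span full j u -> pbw_span full j (y i * u).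
Proof. by move=> lt_i; rewrite -[y i]expr1 -monU //; apply: pbw_monM. Qed.

(** One common shape for the three rules by which [s i] passes a variable, so that inductions on
    monomials need no case distinction. *)
Lemma swap_y i k : (i.+1 < n)%N -> (k < n)%N -> exists k' c c',
  (k' < n)%N /\ s i * y k = y k' * s i + (kap c + kap c' * y i.+1).
Proof.
move=> lt_i lt_k; have [->|ne_ki] := eqVneq k i.
  exists i.+1, (- a), (- b); split=> //.
  by rewrite (ah_sy AH) // !rmorphN mulNr -opprD.
have [->|ne_ki'] := eqVneq k i.+1.
  by exists i, a, b; split; [apply: ltnW|rewrite (ah_sy' AH)].
exists k, 0, 0; split=> //.
by rewrite (ah_sy_far AH) // rmorph0 mul0r !addr0.
Qed.

Lemma pbw_sM j i u : (j <= n)%N -> (i.+1 < j)%N ->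
  pbw_span full j u -> pbw_span full j (s i * u).
Proof.
move=> le_jn lt_ij; have lt_i := leq_trans lt_ij le_jn.
elim=> [|m w _ Ww|v w _ + _]; first by rewrite mulr0; apply: pbw0.
  2: by rewrite mulrDr; apply: pbwD.
elim/mnm_ind_nat: m => [|k m lt_k IHm].
  by rewrite mon0 mul1r; apply/pbw_W/inW_sM.
have [k' [c [c' [lt_k' E]]]] := swap_y lt_i lt_k.
rewrite monS // !mulrA E -!mulrA mulrDl -mulrA.
apply: pbwD; first by apply: pbw_yM.
by rewrite mulrDl -mulrA; apply: pbwD; apply: pbwZ; [|apply: pbw_yM => //];
   apply: pbw_gen.
Qed.

Lemma pbw_M j u v : (j <= n)%N ->
  pbw_span full j u -> pbw_span full j v -> pbw_span full j (u * v).
Proof.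
move=> le_jn Xu Xv; elim: Xu => [|m w _ Ww|u1 u2 _ + _].
- by rewrite mul0r; apply: pbw0.
- rewrite -mulrA; apply: (pbw_monM (X := full)) => //.
  elim: Ww => [c|w1 w2 _ + _|i w' lt_i _].
  + exact: pbwZ.
  + by rewrite mulrDl; apply: pbwD.
  + by rewrite -mulrA; apply: (pbw_sM le_jn lt_i).
- by rewrite mulrDl; apply: pbwD.
Qed.

Lemma inW_t i j : (i < j)%N -> inW j (t s i).
Proof. elim: i => [_|i IHi lt_i] /=; [exact: inW1|apply: inW_sM => //; exact/IHi/ltnW]. Qed.

Lemma inW_ts i j : (i < j)%N -> inW j (ts s i).
Proof.
elim: i => [_|i IHi lt_i] /=; [exact: inW1|apply: inWM; last exact: inWs].
exact/IHi/ltnW.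
Qed.

(** The exponents of the correction terms in [s_ypow]: only y_i and y_{i+1} occur, and y_{i+1} never
    reaches the power [k] unless [k = 0], where only the trivial monomial is left. *)
Definition two_vars (k i : nat) (m : 'X_{1..n}) : Prop :=
  [/\ (mdeg m <= k)%N,
      forall j : 'I_n, j != i :> nat -> j != i.+1 :> nat -> m j = 0%N
    & forall j : 'I_n, j = i.+1 :> nat -> (m j <= k.-1)%N].

Lemma pbw_0_comm X u i : (i < n)%N -> pbw_span X 0 u -> u * y i = y i * u.
Proof.
move=> lt_i; elim=> [|m w _ Ww|v w _ IHv _ IHw].
- by rewrite mul0r mulr0.
- have wC : w * y i = y i * w.
    by elim: Ww => [c|v v' _ IHv _ IHw|k v]; rewrite ?kapC // mulrDl mulrDr IHv IHw.
  rewrite -mulrA wC -[y i]expr1 -monU // !mulrA; congr (_ * _); exact: monC.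
- by rewrite mulrDl mulrDr IHv IHw.
Qed.

(** The defining rule reads s_i y_i = y_{i+1} s_i^-1 - a, and iterating it gives the leading term
    y_{i+1}^k s_i^-1. The corrections contain no words (the index of the span is 0), so they commute
    with every variable. *)
Lemma s_ypow i k : (i.+1 < n)%N ->
  pbw_span (two_vars k i) 0 (s i * y i ^+ k - y i.+1 ^+ k * sV i).
Proof.
move=> lt_i; have lt_i' := ltnW lt_i; elim: k => [|k IHk].
  rewrite !expr0 mulr1 mul1r opprB addrC subrK -[kap b]mul1r -mon0.
  apply: pbw_gen; last exact: inW_kap.
  by split=> [|j _ _|j _]; rewrite ?mdeg0 ?mnm0E.
have sy : s i * y i = y i.+1 * s i - (kap a + kap b * y i.+1) by rewrite (ah_sy AH).
(* The recurrence comes from multiplying the previous case by [y i] on the right and then moving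
   that [y i] to the left of the previous corrections. *)
have -> : s i * y i ^+ k.+1 - y i.+1 ^+ k.+1 * sV i
  = y i * (s i * y i ^+ k - y i.+1 ^+ k * sV i) - kap a * y i.+1 ^+ k
    - kap b * (y i.+1 ^+ k * y i).
  rewrite -(pbw_0_comm _ IHk) // mulrBl -!mulrA -exprSr /sV !mulrBr mulrBl sy.
  rewrite !mulrBr mulrDr !mulrA -exprSr -!(kapC a) -!(kapC b).
  rewrite -(mulrA (kap b)) -exprSr.
  move: (s i * _) (_ * s i) (kap a * _) (_ * y i) (kap b * _) => u1 u2 u3 u4 u5.
  rewrite !opprB (addrC u4) [in RHS]addrA [RHS]addrAC addrK -addrA.
  by congr (_ + _); rewrite addrAC (addrC u3) addrK.
apply: pbwD; first apply: pbwD.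
- have yM u : y i * u = mon (Um n i 1) * u by rewrite monU.
  rewrite {}yM; apply: pbw_monM IHk => m [dm m0 mi].
  split=> [|j ne_ji ne_ji'|j ji].
  + by rewrite mdegD mdeg_Um.
  + by rewrite mnmDE UmE (negPf ne_ji) m0.
  + by have := mi _ ji; rewrite mnmDE UmE ji; case: eqP; lia.
- apply/pbwN/pbwZ; rewrite -monU // -[mon _]mulr1; apply: pbw_gen (inW1 _).
  split=> [|j ne_ji ne_ji'|j ji]; first by rewrite mdeg_Um.
  + by rewrite UmE (negPf ne_ji').
  + by rewrite UmE ji; lia.
- apply/pbwN/pbwZ; rewrite -monU // -[y i]expr1 -monU // -monD -[mon _]mulr1.
  apply: pbw_gen (inW1 _).
  split=> [|j ne_ji ne_ji'|j ji]; first by rewrite mdegD !mdeg_Um // addn1.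
  + by rewrite mnmDE !UmE (negPf ne_ji) (negPf ne_ji').
  + by rewrite mnmDE !UmE ji; lia.
Qed.

End Hecke.

(** * Conjugates of a monic polynomial in the first variable *)

Section Conjugates.
Variables (S : comNzRingType) (Q : pzRingType) (kap : {rmorphism S -> Q}).
Variables (n : nat) (a b : S) (s y : nat -> Q) (d : nat).
Hypotheses (AH : affine_hecke kap n a b s y) (d_gt0 : (0 < d)%N).

Local Notation mon := (@mon Q n y).
Local Notation inW := (inW kap s).
Local Notation pbw_span := (@pbw_span S Q kap n s y).
Local Notation sV := (sV kap b s).

Lemma sVKl i : (i.+1 < n)%N -> sV i * s i = 1.
Proof. by move=> lt_i; rewrite mulrBl (ah_ss AH) // addrAC subrr add0r. Qed.

Lemma pbw_0_monC (X : 'X_{1..n} -> Prop) m u :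
  pbw_span X 0 u -> u * mon m = mon m * u.
Proof.
by move=> Xu; apply/commr_prod => i _; apply/commrX/(pbw_0_comm AH _ Xu).
Qed.

(** The leading part is s_j y_j^d s_j = y_{j+1}^d s_j^-1 s_j + corrections, by [s_ypow]. A lower
    term has exponent e < d in y_j, so conjugation turns it into terms whose exponent in y_{j+1} is
    at most e, and the total degree does not grow. *)
Lemma conj_lower j h : (j.+1 < n)%N ->
  pbw_span (below d j) j.+1 (h - y j ^+ d) ->
  pbw_span (below d j.+1) j.+2 (s j * h * s j - y j.+1 ^+ d).
Proof.
move=> lt_j; set r := h - _ => Xr; have lt_j' := ltnW lt_j.
have Ws : inW j.+2 (s j) by apply: inWs.
have -> : s j * h * s j - y j.+1 ^+ d
    = s j * r * s j + (s j * y j ^+ d - y j.+1 ^+ d * sV j) * s j.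
  rewrite mulrBl -(mulrA _ (sV j)) sVKl // mulr1 addrA -mulrDl -mulrDr.
  by rewrite /r subrK.
have two_below e m m' : (mdeg m' + e <= d)%N ->
    (forall i : 'I_n, (j <= i)%N -> m' i = 0%N) ->
    two_vars e j m -> below d j.+1 (m' + m)%MM.
  move=> le_d m'0 [dm m0 mj]; split=> [|i lt_i|i ij].
  - by rewrite mdegD; lia.
  - by rewrite mnmDE m'0 1?m0; lia.
  - by rewrite mnmDE m'0; [have := mj _ ij; lia|lia].
apply: pbwD; last first.
  apply: (pbw_Mr AH _ Ws); apply: (pbw_mono _ _ (s_ypow AH d lt_j)) => // m m2.
  by rewrite -[m]add0m; apply: (two_below d) => // [|i _]; rewrite ?mdeg0 ?mnm0E.
elim: {h}r / Xr => [|m w [dm m0 mj] Ww|u v _ + _]; last 1 first.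
- by rewrite mulrDr mulrDl; apply: pbwD.
- by rewrite mulr0 mul0r; apply: pbw0.
(* Split off the power of y_j; the remaining monomial involves only variables before y_j, and these
   commute with [s j]. *)
pose e := m (Ordinal lt_j'); pose m' := (m - Um n j e)%MM.
have mE : m = (Um n j e + m')%MM.
  apply/mnmP=> i; rewrite mnmDE mnmBE UmE; case: eqP => [ij|_]; last lia.
  by rewrite /e (_ : Ordinal _ = i); [lia|apply: val_inj].
have m'0 (i : 'I_n) : (j <= i)%N -> m' i = 0%N.
  rewrite leq_eqVlt => /orP[/eqP ij|lt_i]; last by rewrite mnmBE m0.
  rewrite mnmBE UmE -ij eqxx mul1n /e (_ : Ordinal _ = i) ?subnn //.
  exact: val_inj.
have le_e : (mdeg m' + e <= d)%N.
  by move: dm; rewrite mE mdegD mdeg_Um // addnC.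
have lt_e : (e < d)%N by apply: mj.
have Ww2 : inW j.+2 (w * s j) by apply: (inWM AH _ Ws); apply: (inW_mono _ Ww).
have -> : s j * (mon m * w) * s j
    = mon m' * (s j * y j ^+ e - y j.+1 ^+ e * sV j) * (w * s j)
      + mon (m' + Um n j.+1 e)%MM * (sV j * (w * s j)).
  rewrite -(pbw_0_monC _ (s_ypow AH e lt_j)) mulrBl mulrBl.
  rewrite (monD AH m') (monC AH m') monU //.
  have sVm : mon m' * sV j = sV j * mon m'.
    rewrite /sV mulrBr mulrBl (s_monC AH) ?(ah_central AH) // => i.
    by case=> ij; rewrite m'0 // ij.
  rewrite -!mulrA (mulrA (mon m') (sV j)) sVm -!mulrA subrK.
  by rewrite {1}mE (monD AH) monU // -!mulrA.
apply: pbwD; last first.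
  apply: pbw_gen; last by apply: (inWM AH _ Ww2); apply: (inW_sV AH).
  split=> [|i lt_i|i ij].
  - by rewrite mdegD mdeg_Um.
  - by rewrite mnmDE UmE m'0; lia.
  - by rewrite mnmDE UmE m'0; lia.
apply: (pbw_Mr AH _ Ww2); apply: (pbw_monM AH (X := two_vars e j)) => [m2|].
  exact: two_below.
by apply: (pbw_mono _ _ (s_ypow AH e lt_j)).
Qed.

(** Each factor s_j of the coset word raises the leading variable by one, starting from p = y_0^d +
    lower terms. *)
Lemma conj_top p j : (j < n)%N -> pbw_span (below d 0) 1 (p - y 0 ^+ d) ->
  pbw_span (below d j) j.+1 (t s j * p * ts s j - y j ^+ d).
Proof.
elim: j => [|j IHj] lt_j Xp; first by rewrite mul1r mulr1.
rewrite /= (_ : _ * (_ * _) = s j * (t s j * p * ts s j) * s j); last by rewrite !mulrA.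
by apply: conj_lower => //; apply: IHj => //; apply: ltnW.
Qed.

End Conjugates.

(* [codes n] lists Lehmer codes, and [word] maps them to reduced words, one  *)
(* for each permutation in the parabolic subgroup [W_n].                     *)
Section NormalWords.

Fixpoint codes (m : nat) : seq (seq nat) :=
  if m is k.+1 then [seq i :: w | i <- iota 0 m, w <- codes k] else [:: [::]].

Lemma size_codes m w : w \in codes m -> size w = m.
Proof.
elim: m w => [|k IHk] w /=; first by rewrite inE => /eqP->.
rewrite -[_ ++ _]/[seq i :: w | i <- iota 0 k.+1, w <- codes k].
by case/allpairsP=> -[i w'] /= [_ /IHk <- ->].
Qed.

Lemma mem_codes i k w : (i <= k)%N -> w \in codes k -> i :: w \in codes k.+1.
Proof.
move=> le_i Cw; apply/allpairsP; exists (i, w); split=> //.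
by rewrite mem_iota.
Qed.

Lemma codesP k w : w \in codes k.+1 ->
  exists i w', [/\ (i <= k)%N, w' \in codes k & w = i :: w'].
Proof.
by case/allpairsP=> -[i w'] [/=]; rewrite -[0%N :: _]/(iota 0 k.+1) mem_iota;
   exists i, w'.
Qed.

Lemma codes_uniq m : uniq (codes m).
Proof.
elim: m => // k IHk; apply: allpairs_uniq (iota_uniq 0 k.+1) IHk _.
by move=> [i w] [i' w'] _ _ /= [-> ->].
Qed.

Variables (Q : pzRingType) (s : nat -> Q).

(** The ascending product s_i s_{i+1} ... s_{k-1}, empty for [k <= i]. As [i] varies these represent
    the cosets of the subgroup on [k] letters in the one on [k.+1] letters, and [word] iterates this
    decomposition. *)
Fixpoint run (i k : nat) : Q :=
  if k is l.+1 then if (i <= l)%N then run i l * s l else 1 else 1.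

Fixpoint word (w : seq nat) : Q :=
  if w is i :: w' then run i (size w') * word w' else 1.

Lemma run_id i k : (k <= i)%N -> run i k = 1.
Proof. by case: k => //= k lt_ki; rewrite leqNgt lt_ki. Qed.

Lemma runSr i k : (i <= k)%N -> run i k.+1 = run i k * s k.
Proof. by move=> /= ->. Qed.

Lemma runS i k : (i < k)%N -> run i k = s i * run i.+1 k.
Proof.
elim: k => // k IHk; rewrite ltnS leq_eqVlt => /orP[/eqP->|lt_i].
  by rewrite runSr // !run_id // mul1r mulr1.
by rewrite !runSr // ?(ltnW lt_i) // IHk // mulrA.
Qed.

Variables (S : comNzRingType) (kap : {rmorphism S -> Q}).
Variables (n : nat) (a b : S) (y : nat -> Q).
Hypothesis AH : affine_hecke kap n a b s y.

Lemma run_far i j k : (j.+1 < i)%N -> (k < n)%N -> s j * run i k = run i k * s j.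
Proof.
move=> lt_j; elim: k => [|k IHk] lt_k; first by rewrite mulr1 mul1r.
have [le_i|lt_i] := leqP i k; last by rewrite run_id // mulr1 mul1r.
have lt_jk := leq_trans lt_j le_i.
by rewrite runSr // mulrA IHk 1?ltnW // -!mulrA (ah_far AH lt_jk lt_k).
Qed.

Lemma run_far' i j k : (k < j)%N -> (j.+1 < n)%N -> s j * run i k = run i k * s j.
Proof.
move=> + lt_j; elim: k => [|k IHk] lt_k; first by rewrite mulr1 mul1r.
have [le_i|lt_i] := leqP i k; last by rewrite run_id // mulr1 mul1r.
by rewrite runSr // mulrA IHk 1?ltnW // -!mulrA (ah_far AH lt_k lt_j).
Qed.

Lemma run_shift i j k : (i <= j)%N -> (j.+1 < k)%N -> (k < n)%N ->
  s j.+1 * run i k = run i k * s j.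
Proof.
move=> le_ij; elim: k => // k IHk lt_j lt_k; have le_ik : (i <= k)%N by lia.
rewrite runSr //; move: lt_j; rewrite ltnS leq_eqVlt => /orP[/eqP jk|lt_j].
  rewrite -{}jk in lt_k *; rewrite runSr // !mulrA run_far' //.
  by rewrite -!mulrA !(mulrA (s _)) (ah_braid AH).
by rewrite mulrA IHk ?(ltnW lt_k) // -!mulrA (ah_far AH lt_j lt_k).
Qed.

Lemma inW_run i k : inW kap s k.+1 (run i k).
Proof.
elim: k => [|k IHk] /=; first exact: inW1.
case: ifP => _; last exact: inW1.
apply: (inWM AH); first exact: inW_mono IHk.
by rewrite -[s k]mulr1; apply: inW_sM (inW1 _ _ _).
Qed.

Lemma inW_word m w : w \in codes m -> inW kap s m (word w).
Proof.
elim: m w => [|k IHk] w; first by rewrite inE => /eqP->; apply: inW1.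
case/codesP=> i [w' [_ Cw' ->]] /=; rewrite (size_codes Cw').
by apply: (inWM AH) (inW_run _ _) (inW_mono _ (IHk _ Cw')).
Qed.

Inductive code_span (m : nat) : Q -> Prop :=
| code_span0 : code_span m 0
| code_span_gen c w : w \in codes m -> code_span m (kap c * word w)
| code_spanD u v : code_span m u -> code_span m v -> code_span m (u + v).

Lemma code_spanZ m c u : code_span m u -> code_span m (kap c * u).
Proof.
elim=> [|c' w Cw|v w _ + _].
- by rewrite mulr0; apply: code_span0.
- by rewrite mulrA -rmorphM; apply: code_span_gen.
- by rewrite mulrDr; apply: code_spanD.
Qed.

Lemma code_span_run i k u : (i <= k)%N ->
  code_span k u -> code_span k.+1 (run i k * u).
Proof.
move=> le_i; elim=> [|c w Cw|v w _ + _].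
- by rewrite mulr0; apply: code_span0.
- rewrite mulrA -(ah_central AH) -mulrA.
  have -> : run i k * word w = word (i :: w) by rewrite /= (size_codes Cw).
  by apply: (@code_span_gen k.+1 c (i :: w)); apply: mem_codes.
- by rewrite mulrDr; apply: code_spanD.
Qed.

(** On a word starting with [run i k], the generator [s j] commutes with the run if j + 1 < i,
    extends it if j + 1 = i, is absorbed by the quadratic relation if j = i, and crosses it as
    [s j.-1] if j > i. In the first and last cases it then acts on the shorter word, by
    induction. *)
Lemma code_span_sM m j u : (m <= n)%N -> (j.+1 < m)%N ->
  code_span m u -> code_span m (s j * u).
Proof.
elim: m j u => // k IHk j u lt_k; rewrite ltnS => lt_j.
elim=> [|c w /codesP[i [w' [le_i Cw' ->]]]|v w _ + _].
- by rewrite mulr0; apply: code_span0.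
- rewrite mulrA -(ah_central AH) -mulrA; apply: code_spanZ => /=.
  have Sw' : code_span k (word w').
    by rewrite -[word w']mul1r -(rmorph1 kap); apply: code_span_gen.
  rewrite (size_codes Cw') mulrA.
  have [lt_ji|le_ij] := ltnP j.+1 i.
    rewrite run_far // -mulrA; apply: code_span_run => //; apply: IHk => //.
      exact: ltnW.
    exact: leq_trans le_i.
  move: le_ij; rewrite leq_eqVlt => /orP[/eqP ij|].
    by rewrite ij -runS //; apply: code_span_run => //; apply: ltnW.
  rewrite ltnS leq_eqVlt => /orP[/eqP ij|lt_ij].
    rewrite runS ?ij // mulrA (ah_ss AH) ?(leq_trans _ lt_k) // mulrDl mul1r.
    rewrite -ij -mulrA -runS ?ij // mulrDl -mulrA.
    by apply: code_spanD; [apply: code_spanZ|]; apply: code_span_run; rewrite // -ij.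
  case: j => // j in lt_j lt_ij *.
  rewrite run_shift // -mulrA; apply: code_span_run => //.
  by apply: IHk => //; apply: ltnW.
- by rewrite mulrDr; apply: code_spanD.
Qed.

Lemma inW_codes w : inW kap s n w -> code_span n w.
Proof.
have C1 c : code_span n (kap c).
  rewrite -[kap c]mulr1; apply: code_spanZ; elim: (n) => [|k IHk].
    rewrite -[1]mul1r -{1}(rmorph1 kap).
    by apply: (@code_span_gen 0 1 [::]); rewrite inE.
  by rewrite -(run_id (leqnn k)) -[run k k]mulr1; apply: code_span_run.
by elim=> [//|v v' _ + _|i v lt_i _]; [apply: code_spanD|apply: code_span_sM].
Qed.

Lemma inW_sum w : inW kap s n w ->
  exists c : seq nat -> S, w = \sum_(v <- codes n) kap (c v) * word v.
Proof.
move/inW_codes; elim=> [|c v Cv|_ _ _ [c1 ->] _ [c2 ->]].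
- by exists (fun=> 0); rewrite big1 // => v _; rewrite rmorph0 mul0r.
- exists (fun v' => if v' == v then c else 0).
  rewrite (bigD1_seq v) ?codes_uniq //= eqxx big1 ?addr0 // => v' /negPf->.
  by rewrite rmorph0 mul0r.
- exists (fun v => c1 v + c2 v); rewrite -big_split; apply: eq_bigr => v _.
  by rewrite rmorphD mulrDl.
Qed.

End NormalWords.

(** * Linear combinations with polynomial coefficients *)

Section LinearCombinations.
Variables (S : nzRingType) (n : nat) (V : zmodType) (K : eqType) (ks : seq K).
Variable h : K -> 'X_{1..n} -> S -> V.
Hypotheses (h0 : forall k m, h k m 0 = 0)
  (hD : forall k m c c', h k m (c + c') = h k m c + h k m c').
Hypothesis ks_uniq : uniq ks.

(** For each index [k] the coefficients of the vectors [h k m] are stored in one polynomial, which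
    carries its own finite support. This serves both for PBW monomials ([pbw_monom]) and for
    brackets ([br_monom]). *)
Definition ev k (f : {mpoly S[n]}) : V := \sum_(m <- msupp f) h k m f@_m.

Lemma evE k f r : uniq r -> {subset msupp f <= r} ->
  ev k f = \sum_(m <- r) h k m f@_m.
Proof.
move=> Ur sfr; rewrite (bigID (mem (msupp f))) /= [X in _ + X]big1 => [|m].
  rewrite addr0 -big_filter; apply/perm_big/uniq_perm => //.
    exact: filter_uniq.
  by move=> m; rewrite mem_filter; case: (boolP (m \in msupp f)) => // /sfr.
by move=> /memN_msupp_eq0->.
Qed.

Lemma evD k f g : ev k (f + g) = ev k f + ev k g.
Proof.
pose r := undup (msupp f ++ msupp g ++ msupp (f + g)).
rewrite !(@evE k _ r) ?undup_uniq // => [|m|m|m]; last 3 first.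
- by rewrite mem_undup !mem_cat => ->; rewrite ?orbT.
- by rewrite mem_undup !mem_cat => ->; rewrite ?orbT.
- by rewrite mem_undup !mem_cat => ->; rewrite ?orbT.
by rewrite -big_split; apply: eq_bigr => m _; rewrite mcoeffD hD.
Qed.

Lemma ev0 k : ev k 0 = 0.
Proof. by rewrite /ev msupp0 big_nil. Qed.

Lemma evX k c m : ev k (c *: 'X_[m]) = h k m c.
Proof.
rewrite (@evE k _ [:: m]) // => [|m']; last by move/msuppZ_le; rewrite msuppX.
by rewrite big_seq1 mcoeffZ mcoeffX eqxx mulr1.
Qed.

Lemma ev_sum k I (r : seq I) (P : pred I) (F : I -> {mpoly S[n]}) :
  ev k (\sum_(i <- r | P i) F i) = \sum_(i <- r | P i) ev k (F i).
Proof. by apply: (big_morph (ev k) (evD k) (ev0 k)). Qed.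

Inductive lspan (P : K -> 'X_{1..n} -> Prop) : V -> Prop :=
| lspan0 : lspan P 0
| lspan_gen k m c : k \in ks -> P k m -> lspan P (h k m c)
| lspanD u v : lspan P u -> lspan P v -> lspan P (u + v).

Lemma lspan_repr P v : lspan P v -> exists G : K -> {mpoly S[n]},
  (forall k m, m \in msupp (G k) -> P k m) /\ v = \sum_(k <- ks) ev k (G k).
Proof.
elim=> [|k m c ks_k Pkm|_ _ _ [G1 [P1 ->]] _ [G2 [P2 ->]]].
- exists (fun=> 0); split=> [k m|]; first by rewrite msupp0.
  by rewrite big1 // => k _; rewrite ev0.
- exists (fun k' => if k' == k then c *: 'X_[m] else 0); split=> [k' m'|].
    case: eqP => [->|_]; last by rewrite msupp0.
    by move/msuppZ_le; rewrite msuppX inE => /eqP->.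
  rewrite (bigD1_seq k) //= eqxx evX big1 ?addr0 // => k' /negPf->.
  exact: ev0.
- exists (fun k => G1 k + G2 k); split=> [k m /msuppD_le|].
    by rewrite mem_cat => /orP[/P1|/P2].
  by rewrite -big_split; apply: eq_bigr => k _; rewrite evD.
Qed.

End LinearCombinations.

Section PBW.
Variables (S : comNzRingType) (Q : pzRingType) (kap : {rmorphism S -> Q}).
Variables (n : nat) (a b : S) (s y : nat -> Q).
Hypothesis AH : affine_hecke kap n a b s y.

Definition pbw_monom (w : seq nat) (m : 'X_{1..n}) (c : S) : Q :=
  kap c * mon y m * word s w.

Lemma pbw_monom0 w m : pbw_monom w m 0 = 0.
Proof. by rewrite /pbw_monom rmorph0 !mul0r. Qed.

Lemma pbw_monomD w m c c' :
  pbw_monom w m (c + c') = pbw_monom w m c + pbw_monom w m c'.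
Proof. by rewrite /pbw_monom rmorphD !mulrDl. Qed.

Local Notation ev := (ev pbw_monom).

Definition pbw_indep : Prop := forall G : seq nat -> {mpoly S[n]},
  \sum_(w <- codes n) ev w (G w) = 0 -> forall w, w \in codes n -> G w = 0.

Lemma pbw_repr (X : 'X_{1..n} -> Prop) u : pbw_span kap s y X n u ->
  exists G : seq nat -> {mpoly S[n]},
  (forall w m, m \in msupp (G w) -> X m) /\ u = \sum_(w <- codes n) ev w (G w).
Proof.
move=> Xu; apply: (lspan_repr pbw_monom0 pbw_monomD (codes_uniq n)).
elim: Xu => [|m w Xm /(inW_sum AH)[c ->]|v v' _ + _]; first exact: lspan0.
  rewrite mulr_sumr big_seq_cond (eq_bigr (fun v => pbw_monom v m (c v))).
    rewrite -big_seq_cond big_seq; elim/big_ind: _ => //; first exact: lspan0.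
      exact: lspanD.
    by move=> v Cv; apply: lspan_gen.
  by move=> v _; rewrite mulrA -(ah_central AH).
exact: lspanD.
Qed.

(** The element has a second expansion, supported in [X] by [pbw_repr], and independence identifies
    the two. *)
Lemma pbw_top (X : 'X_{1..n} -> Prop) (G : seq nat -> {mpoly S[n]}) :
  pbw_indep -> pbw_span kap s y X n (\sum_(w <- codes n) ev w (G w)) ->
  forall w, w \in codes n -> forall m, m \in msupp (G w) -> X m.
Proof.
move=> indep /pbw_repr[H [XH /eqP]]; rewrite -subr_eq0 -sumrB => /eqP GH w Cw m.
suff -> : G w = H w by apply: XH.
apply/subr0_eq/(indep (fun w => G w - H w)) => //; rewrite -[RHS]GH.
apply: eq_bigr => v _; apply/eqP; rewrite eq_sym subr_eq.
by rewrite -(evD pbw_monom0 pbw_monomD) subrK.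
Qed.

End PBW.

(** * The ideal generated by the cyclotomic polynomial *)

Section Core.
Variables (S : comNzRingType) (R Q : pzRingType) (phi : {rmorphism R -> Q}).
Variables (kapR : S -> R) (kap : {rmorphism S -> Q}) (n : nat) (a b : S).
Variables (sR yR : nat -> R) (s y : nat -> Q) (p : R) (d : nat).

Hypotheses (phi_surj : forall h, exists r, h = phi r)
  (phi_kap : forall c, phi (kapR c) = kap c)
  (phi_s : forall i, (i.+1 < n)%N -> phi (sR i) = s i)
  (phi_y : forall i, (i < n)%N -> phi (yR i) = y i)
  (ker_l : forall r, phi r = 0 -> p * r = 0)
  (ker_r : forall r, phi r = 0 -> r * p = 0)
  (kapRC : forall c, kapR c * p = p * kapR c)
  (p_y : forall i, (i < n)%N -> p * yR i = yR i * p)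
  (p_s : forall i, (0 < i)%N -> (i.+1 < n)%N -> p * sR i = sR i * p)
  (AH : affine_hecke kap n a b s y)
  (n_gt0 : (0 < n)%N) (d_gt0 : (0 < d)%N)
  (p_top : pbw_span kap s y (@below n d 0) 1 (phi p - y 0 ^+ d))
  (indep : pbw_indep kap n s y).

Local Notation mon := (@mon Q n y).
Local Notation inW := (inW kap s).
Local Notation pbw_span := (@pbw_span S Q kap n s y).
Local Notation sV := (sV kap b s).
Local Notation t := (t s).
Local Notation ts := (ts s).
Local Notation word := (word s).
Local Notation full := (@full n).

(* By [ker_l] and [ker_r], the ideal generated by [p] is a bimodule over [Q]. *)
Definition br (h h' : Q) : R :=
  sval (cid (phi_surj h)) * p * sval (cid (phi_surj h')).

Lemma brE r r' : br (phi r) (phi r') = r * p * r'.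
Proof.
rewrite /br; case: cid => /= r1 Er1; case: cid => /= r2 Er2.
have E1 : r * p = r1 * p.
  by apply/subr0_eq; rewrite -mulrBl; apply: ker_r; rewrite rmorphB /= Er1 subrr.
have E2 : p * r' = p * r2.
  by apply/subr0_eq; rewrite -mulrBr; apply: ker_l; rewrite rmorphB /= Er2 subrr.
by rewrite E1 -!mulrA E2.
Qed.

Lemma brDl h1 h2 h : br (h1 + h2) h = br h1 h + br h2 h.
Proof.
have [[r1 ->] [r2 ->]] := (phi_surj h1, phi_surj h2); have [r ->] := phi_surj h.
by rewrite -rmorphD !brE !mulrDl.
Qed.

Lemma brDr h h1 h2 : br h (h1 + h2) = br h h1 + br h h2.
Proof.
have [[r1 ->] [r2 ->]] := (phi_surj h1, phi_surj h2); have [r ->] := phi_surj h.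
by rewrite -rmorphD !brE !mulrDr.
Qed.

Lemma br0l h : br 0 h = 0.
Proof. by have [r ->] := phi_surj h; rewrite -(rmorph0 phi) brE !mul0r. Qed.

Lemma br0r h : br h 0 = 0.
Proof. by have [r ->] := phi_surj h; rewrite -(rmorph0 phi) brE !mulr0. Qed.

Lemma brMl r h h' : r * br h h' = br (phi r * h) h'.
Proof.
have [[r1 ->] [r2 ->]] := (phi_surj h, phi_surj h').
by rewrite -rmorphM !brE !mulrA.
Qed.

Lemma br_balanced r h h' : p * r = r * p -> br (h * phi r) h' = br h (phi r * h').
Proof.
have [[r1 ->] [r2 ->]] := (phi_surj h, phi_surj h') => pr.
by rewrite -!rmorphM !brE -!mulrA (mulrA p) pr !mulrA.
Qed.

Lemma br_y i h h' : (i < n)%N -> br (h * y i) h' = br h (y i * h').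
Proof. by move=> lt_i; rewrite -phi_y // br_balanced // p_y. Qed.

Lemma br_s i h h' : (0 < i)%N -> (i.+1 < n)%N -> br (h * s i) h' = br h (s i * h').
Proof. by move=> i_gt0 lt_i; rewrite -phi_s // br_balanced // p_s. Qed.

Lemma br_kap c h h' : br (h * kap c) h' = br h (kap c * h').
Proof. by rewrite -phi_kap br_balanced. Qed.

Lemma br_mon m h h' : br (h * mon m) h' = br h (mon m * h').
Proof.
elim/mnm_ind_nat: m h h' => [|i m lt_i IHm] h h'; first by rewrite mon0 mulr1 mul1r.
by rewrite (monS AH) // mulrA IHm br_y // !mulrA -(monS AH) // addmC (monD AH) monU.
Qed.

(** Both sides equal r1 p r p r2: either of the two factors p can play the role of the middle of the
    bracket. *)
Lemma br_p h1 h h2 : br (h1 * phi p * h) h2 = br h1 (h * phi p * h2).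
Proof.
have [[r1 ->] [r2 ->]] := (phi_surj h1, phi_surj h2); have [r ->] := phi_surj h.
by rewrite -!rmorphM !brE !mulrA.
Qed.

Lemma phi_br h h' : phi (br h h') = h * phi p * h'.
Proof.
by have [[r1 ->] [r2 ->]] := (phi_surj h, phi_surj h'); rewrite brE !rmorphM.
Qed.

(** The generators [s k] with k > 0 commute with p, so the left factor matters only modulo words in
    them, which leaves the coset words [t i]. The factor [ts i] on the right gives the bracket the
    leading term y^m y_i^d, by [conj_top]. *)
Inductive layer (j : nat) : R -> Prop :=
| layer0 : layer j 0
| layer_gen i m w : (i <= j)%N -> inW n w -> layer j (br (mon m * t i) (ts i * w))
| layerD u v : layer j u -> layer j v -> layer j (u + v).

Lemma layer_yM j i u : (i < n)%N -> layer j u -> layer j (yR i * u).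
Proof.
move=> lt_i; elim=> [|k m w le_k Ww|v v' _ + _].
- by rewrite mulr0; apply: layer0.
- rewrite brMl phi_y // mulrA -(monS AH) //; exact: layer_gen.
- by rewrite mulrDr; apply: layerD.
Qed.

Lemma layer_kapM j c u : layer j u -> layer j (kapR c * u).
Proof.
elim=> [|k m w le_k Ww|v v' _ + _].
- by rewrite mulr0; apply: layer0.
- rewrite brMl phi_kap (ah_central AH) br_kap mulrA (ah_central AH) -mulrA.
  by apply: layer_gen => //; apply: (inWZ AH).
- by rewrite mulrDr; apply: layerD.
Qed.

(** After moving [s k] past the monomial there are four cases. If i < k it commutes through the
    whole bracket; if k = i it extends [t i] to [t i.+1], and the right factor is rewritten with
    s_i^-1; if k + 1 = i the quadratic relation applies; if k + 1 < i it crosses by [t_shift] and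
    [ts_shift]. *)
Lemma layer_sM j k u : (k < j)%N -> (j < n)%N -> layer j u -> layer j (sR k * u).
Proof.
move=> lt_kj lt_j; have lt_k : (k.+1 < n)%N by apply: leq_trans lt_j.
elim=> [|i m w le_i Ww|v v' _ + _]; first by rewrite mulr0; apply: layer0.
  2: by rewrite mulrDr; apply: layerD.
rewrite brMl phi_s // mulrA; elim/mnm_ind_nat: m => [|l m lt_l IHm]; last first.
  have [k' [c [c' [lt_k' E]]]] := swap_y AH lt_k lt_l.
  rewrite (monS AH) // !mulrA E mulrDl mulrDl brDl -!mulrA -phi_y // -brMl.
  apply: layerD; first by apply: layer_yM => //; rewrite mulrA.
  rewrite mulrDl brDl -[kap c]phi_kap -[kap c']phi_kap -!mulrA -!brMl -phi_y //.
  apply: layerD; first exact/layer_kapM/layer_gen.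
  by rewrite -brMl; apply/layer_kapM/layer_yM/layer_gen.
rewrite mon0 mulr1; have lt_i := leq_ltn_trans le_i lt_j.
have gen i' w' : (i' <= j)%N -> inW n w' -> layer j (br (t i') (ts i' * w')).
  by move=> le_i' Ww'; rewrite -[t i']mul1r -(mon0 n y); apply: layer_gen.
have Wsw l : (l.+1 < n)%N -> inW n (s l * w) by move=> lt_l; apply: inW_sM.
have [lt_ik|] := ltnP i k.
  rewrite (t_far AH) // br_s ?(leq_ltn_trans _ lt_ik) // mulrA (ts_far AH) //.
  by rewrite -mulrA; apply: gen => //; apply: Wsw.
rewrite leq_eqVlt => /orP[/eqP ki|].
  rewrite {}ki in lt_kj lt_k *.
  have -> : ts i * w = ts i.+1 * (sV i * w).
    by rewrite /= -!mulrA (mulrA (s i)) (sVK AH) // mul1r.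
  by apply: (gen i.+1) => //; apply: (inWM AH) Ww; apply: (inW_sV AH).
rewrite leq_eqVlt => /orP[/eqP ki|lt_ki].
  rewrite -{}ki in lt_i le_i * => /=.
  rewrite mulrA (ah_ss AH) // mulrDl mul1r brDl; apply: layerD; last first.
    by rewrite -mulrA; apply: gen; [apply: ltnW|apply: Wsw].
  rewrite -phi_kap -mulrA -brMl; apply: layer_kapM.
  exact: (gen k.+1).
rewrite (t_shift AH) // br_s //; last exact: leq_trans lt_i.
rewrite mulrA (ts_shift AH) // -mulrA.
by apply: gen => //; apply: Wsw.
Qed.

Lemma layer_W j v w : (j < n)%N -> inW j.+1 v -> inW n w -> layer j (br v w).
Proof.
move=> lt_j Wv Ww; elim: Wv => [c|u v' _ + _|i v' lt_i _].
- rewrite -[kap c]mulr1 -phi_kap -brMl; apply: layer_kapM.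
  by rewrite -[w]mul1r -[X in br X]mulr1 -{1}(mon0 n y); apply: (@layer_gen j 0).
- by rewrite brDl; apply: layerD.
- have lt_i' : (i.+1 < n)%N by apply: leq_trans lt_j.
  by rewrite -phi_s // -brMl; apply: layer_sM.
Qed.

Lemma layer_pbw j u w : (j < n)%N -> pbw_span full j.+1 u -> inW n w ->
  layer j (br u w).
Proof.
move=> lt_j + Ww; elim=> [|m v _ Wv|v v' _ + _].
- by rewrite br0l; apply: layer0.
- elim/mnm_ind_nat: m => [|i m lt_i]; first by rewrite mon0 mul1r; apply: layer_W.
  by rewrite (monS AH) // -mulrA -phi_y // -brMl; apply: layer_yM.
- by rewrite brDl; apply: layerD.
Qed.

Lemma layer_pbw2 j u v : (j < n)%N -> pbw_span full j.+1 u ->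
  pbw_span full n v -> layer j (br u v).
Proof.
move=> lt_j Xu; elim=> [|m w _ Ww|v1 v2 _ + _].
- by rewrite br0r; apply: layer0.
- rewrite -br_mon; apply: layer_pbw => //; apply: (pbw_M AH) => //.
  by rewrite -[mon m]mulr1; apply: (pbw_gen _ _ (inW1 _ _ _)).
- by rewrite brDr; apply: layerD.
Qed.

(** Under this condition y_i is the first variable whose exponent in y^m y_i^d is at least d, so [i]
    and [m] can be read off the leading monomial. *)
Definition reduced (i : nat) (m : 'X_{1..n}) : Prop :=
  forall j : 'I_n, (j < i)%N -> (m j < d)%N.

Inductive red_span (j : nat) : R -> Prop :=
| red0 : red_span j 0
| red_gen i m w : (i <= j)%N -> reduced i m -> inW n w ->
    red_span j (br (mon m * t i) (ts i * w))
| redD u v : red_span j u -> red_span j v -> red_span j (u + v).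

Lemma red_mono j j' u : (j <= j')%N -> red_span j u -> red_span j' u.
Proof.
move=> le_j; elim=> [|i m w le_i red_m Ww|v v' _ + _]; [exact: red0| |exact: redD].
by apply: red_gen => //; apply: leq_trans le_j.
Qed.

(** Each generator of [v] crosses [t i] with its index raised by one, hence positive, so it crosses
    p, and it regains its index when crossing [ts i]. *)
Lemma br_slide x i j v w : (j < i)%N -> (i < n)%N -> inW j.+1 v -> inW n w ->
  br (x * (v * t i)) (ts i * w) = br (x * t i) (ts i * (v * w)).
Proof.
move=> lt_j lt_i Wv; elim: Wv x w => [c|u u' _ IHu _ IHu'|k u lt_k Wu IHu] x w Ww.
- by rewrite (ah_central AH) mulrA br_kap mulrA (ah_central AH) -!mulrA (ah_central AH).
- by rewrite mulrDl mulrDr brDl IHu // IHu' // mulrDl mulrDr brDr.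
- have lt_ki : (k.+1 < i)%N by lia.
  rewrite -(mulrA (s k)) (mulrA x) IHu // -mulrA (t_shift AH) // mulrA br_s //; last first.
    exact: leq_trans lt_i.
  by rewrite !mulrA (ts_shift AH).
Qed.

Lemma pbw_mon m : pbw_span full n (mon m).
Proof. by rewrite -[mon m]mulr1; apply: (pbw_gen _ _ (inW1 _ _ _)). Qed.

Lemma pbw_p : pbw_span full n (phi p).
Proof.
rewrite -[phi p](subrK (y 0 ^+ d)); apply: pbwD; first exact: (pbw_mono _ _ p_top).
by rewrite -(@monU Q n) //; apply: pbw_mon.
Qed.

(** If the exponent of some y_l with l < i is at least d, replace y_l^d by t_l p t_l' minus its
    lower terms. The first part contains p twice; centring the bracket at the left one puts it in
    layer l, which the outer induction covers. In the other terms the words slide to the right by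
    [br_slide] and the weight of the monomial drops by [wt_below], which the inner induction
    covers. *)
Lemma layer_red j u : (j < n)%N -> layer j u -> red_span j u.
Proof.
have [k] := ubnP j; elim: k j u => // k IHk j u lt_jk lt_j.
elim=> [|i m w le_i Ww|v v' _ + _]; [exact: red0| |exact: redD].
have lt_i := leq_ltn_trans le_i lt_j; apply: (red_mono le_i).
have {lt_jk le_i} lt_ik : (i < k.+1)%N by apply: leq_ltn_trans lt_jk.
have [K] := ubnP (wt d m); elim: K m w Ww => // K IHK m w Ww lt_mK.
have [red_m|] := pselect (reduced i m); first exact: red_gen.
case/existsNP=> l /not_implyP[lt_li /negP]; rewrite -leqNgt => le_dm.
have lt_l : (l < n)%N by [].
pose m' := (m - Um n l d)%MM.
have mE : m = (m' + Um n l d)%MM.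
  apply/mnmP=> l'; rewrite mnmDE mnmBE UmE; case: eqP => [/val_inj->|_]; lia.
have X := conj_top AH d_gt0 lt_l p_top; have XN := pbwN AH X.
pose P := t l * phi p * ts l.
have -> : br (mon m * t i) (ts i * w)
    = br (mon m' * (P * t i)) (ts i * w) + br (mon m' * (- (P - y l ^+ d) * t i)) (ts i * w).
  rewrite -brDl -mulrDr -mulrDl opprB addrC subrK mulrA {1}mE (monD AH).
  by rewrite (@monU Q n).
apply: redD.
  apply: (@red_mono l); first exact: ltnW.
  apply: IHk => //; first exact: leq_trans lt_li _.
  rewrite /P -!(mulrA _ (ts l)) !mulrA -(mulrA _ (ts l)) br_p; apply: layer_pbw2 => //.
    by apply: pbw_gen (inW_t _ _ _).
  have full_W v : inW n v -> pbw_span full n v by apply: pbw_W.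
  apply: (pbw_M AH) => //; last first.
    apply: (pbw_M AH) => //; apply: full_W => //; exact: (inW_ts AH).
  apply: (pbw_M AH) => //; last exact: pbw_p.
  by apply: full_W; apply: (inWM AH); [apply: (inW_ts AH)|apply: inW_t].
elim: XN => [|c v below_c Wv|v v' _ + _]; first by rewrite mul0r mulr0 br0l; apply: red0.
  2: by rewrite mulrDl mulrDr brDl; apply: redD.
rewrite -(mulrA (mon c)) mulrA -(monD AH) (br_slide _ lt_li) //.
apply: IHK; first by apply: (inWM AH) Ww; apply: inW_mono Wv.
by move: lt_mK (wt_below lt_l below_c); rewrite {1}mE !wtD wtU //; lia.
Qed.

Definition br_monom (k : nat * seq nat) (m : 'X_{1..n}) (c : S) : R :=
  br (kap c * mon m * t k.1) (ts k.1 * word k.2).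

Definition br_index : seq (nat * seq nat) :=
  [seq (i, w) | i <- iota 0 n, w <- codes n].

Lemma br_monom0 k m : br_monom k m 0 = 0.
Proof. by rewrite /br_monom rmorph0 !mul0r br0l. Qed.

Lemma br_monomD k m c c' : br_monom k m (c + c') = br_monom k m c + br_monom k m c'.
Proof. by rewrite /br_monom rmorphD !mulrDl brDl. Qed.

Lemma br_index_uniq : uniq br_index.
Proof.
apply: allpairs_uniq (iota_uniq 0 n) (codes_uniq n) _.
by move=> [i w] [i' w'] _ _ /= [-> ->].
Qed.

Lemma red_repr j u : (j < n)%N -> red_span j u ->
  exists G : nat * seq nat -> {mpoly S[n]},
    (forall k m, m \in msupp (G k) -> reduced k.1 m)
    /\ u = \sum_(k <- br_index) ev br_monom k (G k).
Proof.
move=> lt_j red_u.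
apply: (lspan_repr br_monom0 br_monomD br_index_uniq (P := fun k => reduced k.1)).
elim: red_u => [|i m w le_i red_m /(inW_sum AH)[c ->]|v v' _ + _].
- exact: lspan0.
- have br_sum r (F : seq nat -> Q) h : br h (\sum_(v <- r) F v) = \sum_(v <- r) br h (F v).
    exact: (big_morph _ (brDr h) (br0r h)).
  rewrite mulr_sumr br_sum big_seq; elim/big_ind: _ => //; first exact: lspan0.
    exact: lspanD.
  move=> v Cv; rewrite mulrA -(ah_central AH) -mulrA -br_kap -(ah_central AH) mulrA.
  apply: (@lspan_gen S n R _ br_index br_monom (fun k => reduced k.1) (i, v)) => //.
  by apply/allpairsP; exists (i, v); rewrite mem_iota (leq_ltn_trans le_i).
- exact: lspanD.
Qed.

Lemma pbw_evX w (f : {mpoly S[n]}) m0 :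
  ev (pbw_monom kap s y) w (f * 'X_[m0])
  = \sum_(m <- msupp f) kap f@_m * mon (m + m0)%MM * word w.
Proof.
rewrite [in LHS](mpolyE f) mulr_suml (ev_sum (@pbw_monom0 _ _ _ _ _ _) (@pbw_monomD _ _ _ _ _ _)).
by apply: eq_bigr => m _; rewrite -scalerAl -mpolyXD evX //; apply: pbw_monom0.
Qed.

Lemma phi_br_monom i w m c : (i < n)%N ->
  phi (br_monom (i, w) m c) = kap c * mon (m + Um n i d)%MM * word w
    + kap c * mon m * (t i * phi p * ts i - y i ^+ d) * word w.
Proof.
move=> lt_i; rewrite phi_br /= (monD AH) (@monU Q n) // mulrA -mulrDl -!mulrA -mulrDr.
by rewrite -mulrDr addrC subrK !mulrA.
Qed.

Definition weight_lt M (m : 'X_{1..n}) : Prop := (wt d m < M)%N.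

(** In Q the bracket indexed by (i, w) and y^m becomes y^m y_i^d w plus terms of smaller weight.
    Leading terms cannot cancel among brackets, so PBW independence shows that none of them reaches
    the bound [M]. *)
Lemma red_lead (G : nat * seq nat -> {mpoly S[n]}) M :
  (forall k m, m \in msupp (G k) -> reduced k.1 m) ->
  phi (\sum_(k <- br_index) ev br_monom k (G k)) = 0 ->
  (forall k m, k \in br_index -> m \in msupp (G k) -> (wt d m + d * d.+1 ^ k.1 <= M)%N) ->
  forall k m, k \in br_index -> m \in msupp (G k) -> (wt d m + d * d.+1 ^ k.1 < M)%N.
Proof.
move=> red_G phi0 leM k m /allpairsP[[i w] /= [+ Cw ->{k}]] /= Gm.
rewrite mem_iota /= add0n => lt_i.
(* [H v] collects the leading monomials attached to the word [v]; by the vanishing of the image, the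
   sum of the [H v] equals minus the sum of the lower terms. *)
pose H v := \sum_(l <- iota 0 n) G (l, v) * 'X_[Um n l d].
have le_M l v m' : (l < n)%N -> v \in codes n -> m' \in msupp (G (l, v)) ->
    (wt d m' + d * d.+1 ^ l <= M)%N.
  by move=> lt_l Cv; apply: leM; apply/allpairsP; exists (l, v); rewrite mem_iota.
have low : pbw_span (weight_lt M) n (\sum_(v <- codes n) ev (pbw_monom kap s y) v (H v)).
  have -> : \sum_(v <- codes n) ev (pbw_monom kap s y) v (H v)
    = - \sum_(l <- iota 0 n) \sum_(v <- codes n) \sum_(m <- msupp (G (l, v)))
        kap (G (l, v))@_m * mon m * (t l * phi p * ts l - y l ^+ d) * word v.
    have -> : \sum_(v <- codes n) ev (pbw_monom kap s y) v (H v)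
      = \sum_(l <- iota 0 n) \sum_(v <- codes n) \sum_(m <- msupp (G (l, v)))
          kap (G (l, v))@_m * mon (m + Um n l d)%MM * word v.
      rewrite exchange_big /=; apply: eq_bigr => v _.
      rewrite (ev_sum (@pbw_monom0 _ _ _ _ _ _) (@pbw_monomD _ _ _ _ _ _)).
      by apply: eq_bigr => l _; rewrite pbw_evX.
    apply/eqP; rewrite -addr_eq0; apply/eqP; rewrite -[RHS]phi0 rmorph_sum /=.
    rewrite [RHS]big_allpairs -big_split.
    rewrite big_seq [RHS]big_seq; apply: eq_bigr => l.
    rewrite mem_iota => lt_l; rewrite -big_split; apply: eq_bigr => v _.
    rewrite -big_split rmorph_sum /=; apply: eq_bigr => m' _.
    by rewrite phi_br_monom.
  apply: (pbwN AH); rewrite big_seq; elim/big_ind: _ => [||l]; [exact: pbw0|exact: pbwD|].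
  rewrite mem_iota /= => lt_l; rewrite big_seq.
  elim/big_ind: _ => [||v Cv]; [exact: pbw0|exact: pbwD|].
  rewrite big_seq; elim/big_ind: _ => [||m' Gm']; [exact: pbw0|exact: pbwD|].
  rewrite -(mulrA (kap _)) -(mulrA (kap _)); apply: (pbwZ AH).
  apply: (pbw_Mr AH _ (inW_word AH Cv)).
  apply: (pbw_monM AH (X := below d l)) => [m2|]; last first.
    by apply: (pbw_mono _ lt_l (conj_top AH d_gt0 lt_l p_top)).
  move/(wt_below lt_l) => lt_m2; rewrite /weight_lt wtD.
  by apply: leq_trans (le_M _ _ _ lt_l Cv Gm'); rewrite -addnS leq_add2l.
(* No other index l contributes this monomial: comparing exponents at the smaller of i and l
   contradicts reducedness for the larger one. *)
have Hm : (m + Um n i d)%MM \in msupp (H w).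
  rewrite mcoeff_msupp /H raddf_sum /= (bigD1_seq i) ?iota_uniq ?mem_iota //=.
  rewrite [in X in X + _]addmC mcoeffMX big1 ?addr0 -?mcoeff_msupp // => l ne_li.
  apply: memN_msupp_eq0; rewrite (perm_mem (msuppMX _ _)).
  apply/negP => /mapP[m' Gm' /mnmP E].
  have [lt_il|lt_li|eq_il] := ltngtP i l; last by rewrite eq_il eqxx in ne_li.
  - have := red_G _ _ Gm' (Ordinal lt_i) lt_il.
    by move: (E (Ordinal lt_i)); rewrite !mnmDE !UmE /=; lia.
  - have lt_l := ltn_trans lt_li lt_i.
    have := red_G _ _ Gm (Ordinal lt_l) lt_li.
    by move: (E (Ordinal lt_l)); rewrite !mnmDE !UmE /=; lia.
by have := pbw_top AH indep low Cw Hm; rewrite /weight_lt wtD wtU.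
Qed.

Lemma layer_inj u : layer n.-1 u -> phi u = 0 -> u = 0.
Proof.
have lt_n : (n.-1 < n)%N by rewrite prednK.
move/(layer_red lt_n)/(red_repr lt_n)=> [G [red_G ->]] phi0.
(* Descent on the weight bound: [red_lead] lowers it by one each time, and at 0 no monomial is
   left. *)
have bound M : (forall k m, k \in br_index -> m \in msupp (G k) ->
    (wt d m + d * d.+1 ^ k.1 < M)%N) -> forall k, k \in br_index -> G k = 0.
  elim: M => [|M IHM] ltM k k_br; last exact/IHM/k_br/red_lead.
  apply/eqP; rewrite -msupp_eq0 -size_eq0 -leqn0 leqNgt.
  by rewrite -has_predT; apply/hasPn => m /(ltM k m k_br).
pose M := \max_(k <- br_index) \max_(m <- msupp (G k)) (wt d m + d * d.+1 ^ k.1)%N.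
rewrite big_seq big1 // => k k_br; rewrite (bound M.+1) ?ev0 // => k' m' k'_br Gm'.
rewrite ltnS; apply: leq_trans (@leq_bigmax_seq _ _ xpredT
  (fun k => \max_(m <- msupp (G k)) (wt d m + d * d.+1 ^ k.1))%N _ k'_br isT).
exact: (@leq_bigmax_seq _ _ xpredT (fun m => wt d m + d * d.+1 ^ k'.1)%N _ Gm' isT).
Qed.

(* A power of [Y] clears y_1^-1, which is not in the span of the ordinary     *)
(* monomials: [Y] is y_1 ... y_n in the non-degenerate case, and 1 in the     *)
(* degenerate one.                                                           *)
Variable Y : R.
Hypotheses (pY : p * Y = Y * p) (Y_central : forall h, phi Y * h = h * phi Y)
  (Y_pbw : pbw_span full n (phi Y))
  (Y_clears : forall h, exists N, pbw_span full n (phi Y ^+ N * h))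
  (Y_reg : forall u, Y * u = 0 -> u = 0).

Let lt_n1 : (n.-1 < n)%N. Proof. by rewrite prednK. Qed.

Lemma layer_brP u v : pbw_span full n u -> pbw_span full n v ->
  layer n.-1 (br u v).
Proof. by move=> Xu; apply: layer_pbw2 => //; rewrite prednK. Qed.

Lemma layer_YM N u : layer n.-1 u -> layer n.-1 (Y ^+ N * u).
Proof.
elim: N => [|N IHN] Lu; first by rewrite mul1r.
rewrite exprS -mulrA; elim: {IHN Lu}(_ * u) / (IHN Lu) => [|i m w le_i Ww|v v' _ + _].
- by rewrite mulr0; apply: layer0.
- rewrite brMl; apply: layer_brP.
    apply: (pbw_M AH) => //; apply: pbw_gen => //; apply: inW_t.
    exact: leq_ltn_trans le_i lt_n1.
  by apply/pbw_W/(inWM AH) => //; apply: (inW_ts AH); apply: leq_ltn_trans le_i lt_n1.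
- by rewrite mulrDr; apply: layerD.
Qed.

(** An element of (p) is a finite sum of products x p x'. One power of [Y] clears x; another is
    moved through x and p and clears x'. *)
Lemma layer_clears u : ideal_gen [set p] u -> exists N, layer n.-1 (Y ^+ N * u).
Proof.
pose Z u := exists N, layer n.-1 (Y ^+ N * u).
have ZD u1 u2 : Z u1 -> Z u2 -> Z (u1 + u2).
  move=> [N1 L1] [N2 L2]; exists (N1 + N2)%N; rewrite mulrDr {1}addnC !exprD -!mulrA.
  by apply: layerD; apply: layer_YM.
have Zapb x x' : Z (x * p * x').
  have [N1 X1] := Y_clears (phi x); have [N2 X2] := Y_clears (phi x').
  exists (N1 + N2)%N.
  (* [Y] is assumed central only in the image of [phi], which suffices inside a bracket. *)
  have YN : phi (Y ^+ N2 * x) = phi (x * Y ^+ N2).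
    by rewrite !rmorphM !rmorphXn; apply/commr_sym/commrX/commr_sym/Y_central.
  have pYN : p * Y ^+ N2 = Y ^+ N2 * p by apply: commrX.
  rewrite (_ : _ * _ = Y ^+ N1 * (Y ^+ N2 * x) * p * x'); last by rewrite exprD !mulrA.
  rewrite -brE rmorphM YN -rmorphM brE mulrA -(mulrA _ _ p) -pYN.
  rewrite (_ : _ * _ = Y ^+ N1 * x * p * (Y ^+ N2 * x')); last by rewrite !mulrA.
  rewrite -brE.
  by apply: layer_brP; rewrite rmorphM rmorphXn.
pose T := [set u | exists r : seq (R * R), u = \sum_(e <- r) e.1 * p * e.2].
suff sub : ideal_gen [set p] `<=` T.
  move/sub=> [r ->]; elim/big_ind: _ => [|//|e _]; last exact: Zapb.
  by exists 0%N; rewrite mulr0; apply: layer0.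
apply: smallest_sub; last by move=> _ ->; exists [:: (1, 1)]; rewrite big_seq1 mul1r mulr1.
split=> [|_ _ [r ->] [r' ->]|x _ x' [r ->]].
- by exists [::]; rewrite big_nil.
- by exists (r ++ r'); rewrite big_cat.
- exists [seq (x * e.1, e.2 * x') | e <- r].
  by rewrite big_map mulr_sumr mulr_suml; apply: eq_bigr => e _; rewrite /= !mulrA.
Qed.

Theorem ideal_gen_inj u : ideal_gen [set p] u -> phi u = 0 -> u = 0.
Proof.
case/layer_clears=> N LN phi_u.
have {LN} : Y ^+ N * u = 0 by apply: layer_inj LN _; rewrite rmorphM phi_u mulr0.
elim: N => [|N IHN]; first by rewrite mul1r.
by rewrite exprS -mulrA => /Y_reg.
Qed.

End Core.

(** * The generic principal series *)

Section CalibratedIdentities.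
Variables (F : fieldType) (a b g : F).
Hypothesis gE : g * g = b * g + 1.

(** The diagonal coefficient of s_i on a weight vector, where y_i and y_{i+1} have eigenvalues x and
    x'; it is forced by the relation between s_i and y_i. The off-diagonal one, [cB], is normalised
    so that constant functions are eigenvectors with eigenvalue g, a root of the quadratic
    relation. *)
Definition cA (x x' : F) : F := (a + b * x') / (x' - x).
Definition cB (x x' : F) : F := g - cA x x'.

Let g_neq0 : g != 0.
Proof.
by apply/eqP => g0; move/eqP: gE; rewrite g0 !mulr0 add0r eq_sym oner_eq0.
Qed.

Let bE : b = (g * g - 1) / g.
Proof. by rewrite gE addrK mulfK. Qed.

(** The quadratic relation, with [f] and [f'] the values at two permutations exchanged by s_i. *)
Lemma cAB x x' f f' : x != x' ->
  cA x x' * (cA x x' * f + cB x x' * f') + cB x x' * (cA x' x * f' + cB x' x * f)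
  = b * (cA x x' * f + cB x x' * f') + f.
Proof.
move=> ne_x; rewrite /cB /cA bE; field.
by rewrite g_neq0 !subr_eq0 ne_x eq_sym ne_x.
Qed.

(** The braid relation evaluated at one permutation; the six values of f are those on its orbit
    under two adjacent transpositions. *)
Lemma cAB_braid x y z f f1 f2 f12 f21 f121 :
  x != y -> x != z -> y != z ->
  let s1 x y f f1 := cA x y * f + cB x y * f1 in
  s1 x y (s1 y z (s1 x y f f1) (s1 x z f2 f12))
         (s1 x z (s1 y x f1 f) (s1 y z f21 f121))
  = s1 y z (s1 x y (s1 y z f f2) (s1 x z f1 f21))
           (s1 x z (s1 z y f2 f) (s1 x y f12 f121)).
Proof.
move=> ne_xy ne_xz ne_yz /=; rewrite /cB /cA bE; field.
by rewrite g_neq0 !subr_eq0 ?ne_xy ?ne_xz ?ne_yz 1?eq_sym ?ne_xy 1?eq_sym ?ne_xz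
  1?eq_sym ?ne_yz.
Qed.

End CalibratedIdentities.

Section Calibrated.
Variables (S : comNzRingType) (n' : nat) (a b g : S).
Hypothesis gE : g * g = b * g + 1.
Local Notation n := n'.+1.
Variables (F : fieldType) (emb : {rmorphism S -> F}) (xi : 'I_n -> F).
Hypothesis xi_inj : injective xi.
Local Notation V := {ffun 'S_n -> F^o}.

Fact calV_proper : (0 < dim V)%N.
Proof.
rewrite lt0n; apply/eqP => V0.
have /ffunP/(_ 1%g) : [ffun=> 1] = 0 :> V.
  have vs0 (v : V) : v \in (0 : {vspace V})%VS.
    by rewrite -(_ : fullv = 0%VS) ?memvf //; apply/eqP; rewrite -dimv_eq0 dimvf V0.
  by apply/eqP; rewrite -memv0; apply: vs0.
by rewrite !ffunE => /eqP; rewrite oner_eq0.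
Qed.

Definition calE : nzRingType := lfun_comp_nzRingType calV_proper.

Definition xF (v : 'S_n) (i : nat) : F := xi (v (inord i)).

Definition tau (i : nat) : 'S_n := tperm (inord i) (inord i.+1).

Local Notation A v i := (cA (emb a) (emb b) (xF v i) (xF v i.+1)).
Local Notation B v i := (cB (emb a) (emb b) (emb g) (xF v i) (xF v i.+1)).

Definition kap_fun (c : S) (f : V) : V := emb c *: f.
Definition y_fun (i : nat) (f : V) : V := [ffun v => xF v i * f v].
Definition yV_fun (i : nat) (f : V) : V := [ffun v => (xF v i)^-1 * f v].
(** In the product of permutations the left factor acts first, so [tau i * v] has the weights of [v]
    at positions i and i + 1 exchanged ([xF_tau1], [xF_tau2]). *)
Definition s_fun (i : nat) (f : V) : V :=
  [ffun v => A v i * f v + B v i * f (tau i * v)%g].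

Lemma kap_fun_linear c : linear (kap_fun c).
Proof. by move=> k f f'; rewrite /kap_fun scalerDr !scalerA mulrC. Qed.

Lemma y_fun_linear i : linear (y_fun i).
Proof. by move=> k f f'; apply/ffunP => v; rewrite !ffunE mulrDr; congr (_ + _); apply: mulrCA. Qed.

Lemma yV_fun_linear i : linear (yV_fun i).
Proof. by move=> k f f'; apply/ffunP => v; rewrite !ffunE mulrDr; congr (_ + _); apply: mulrCA. Qed.

Lemma s_fun_linear i : linear (s_fun i).
Proof.
move=> k f f'; apply/ffunP => v; rewrite !ffunE scalerDr !mulrDr addrACA.
by congr (_ + _ + _); apply: mulrCA.
Qed.

HB.instance Definition _ c := GRing.isLinear.Build F V V *:%R (kap_fun c) (kap_fun_linear c).
HB.instance Definition _ i := GRing.isLinear.Build F V V *:%R (y_fun i) (y_fun_linear i).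
HB.instance Definition _ i := GRing.isLinear.Build F V V *:%R (yV_fun i) (yV_fun_linear i).
HB.instance Definition _ i := GRing.isLinear.Build F V V *:%R (s_fun i) (s_fun_linear i).

Definition act (h : calE) (f : V) : V := fun_of_lfun (h : 'End(V)) f.

Definition kapE (c : S) : calE := linfun (kap_fun c).
Definition yE (i : nat) : calE := linfun (y_fun i).
Definition yVE (i : nat) : calE := linfun (yV_fun i).
Definition sE (i : nat) : calE := linfun (s_fun i).

Lemma actP (h h' : calE) : (forall f v, act h f v = act h' f v) -> h = h'.
Proof. by move=> hh; apply/lfunP => f; apply/ffunP => v; apply: hh. Qed.

Lemma actD h h' f v : act (h + h') f v = act h f v + act h' f v.
Proof. by rewrite /act add_lfunE ffunE. Qed.

Lemma actN h f v : act (- h) f v = - act h f v.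
Proof. by rewrite /act opp_lfunE ffunE. Qed.

Lemma actM h h' f : act (h * h') f = act h (act h' f).
Proof. by rewrite /act comp_lfunE. Qed.

Lemma act1 f : act 1 f = f.
Proof. by rewrite /act id_lfunE. Qed.

Lemma act0 f v : act 0 f v = 0.
Proof. by rewrite /act zero_lfunE ffunE. Qed.

Lemma act_kap c f v : act (kapE c) f v = emb c * f v.
Proof. by rewrite /act lfunE /= ffunE. Qed.

Lemma act_y i f v : act (yE i) f v = xF v i * f v.
Proof. by rewrite /act lfunE /= ffunE. Qed.

Lemma act_yV i f v : act (yVE i) f v = (xF v i)^-1 * f v.
Proof. by rewrite /act lfunE /= ffunE. Qed.

Lemma act_s i f v : act (sE i) f v = A v i * f v + B v i * f (tau i * v)%g.
Proof. by rewrite /act lfunE /= ffunE. Qed.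

Lemma kapE_nmod : nmod_morphism kapE.
Proof.
split=> [|c c']; apply: actP => f v; first by rewrite act0 act_kap rmorph0 mul0r.
by rewrite actD !act_kap rmorphD mulrDl.
Qed.

Lemma kapE_monoid : monoid_morphism kapE.
Proof.
split=> [|c c']; apply: actP => f v; first by rewrite act1 act_kap rmorph1 mul1r.
by rewrite actM !act_kap rmorphM mulrA.
Qed.

HB.instance Definition _ := GRing.isNmodMorphism.Build S calE kapE kapE_nmod.
HB.instance Definition _ := GRing.isMonoidMorphism.Build S calE kapE kapE_monoid.

Lemma xF_neq v i j : (i < n)%N -> (j < n)%N -> i != j -> xF v i != xF v j.
Proof.
move=> lt_i lt_j; apply: contraNneq => /xi_inj/perm_inj/(congr1 (@nat_of_ord _)).
by rewrite !inordK // => ->.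
Qed.

Lemma xF_tau1 v i : xF (tau i * v)%g i = xF v i.+1.
Proof. by rewrite /xF permM tpermL. Qed.

Lemma xF_tau2 v i : xF (tau i * v)%g i.+1 = xF v i.
Proof. by rewrite /xF permM tpermR. Qed.

Lemma tau_far i j : (i.+1 < n)%N -> (j < n)%N -> j != i -> j != i.+1 ->
  tau i (inord j) = inord j.
Proof.
move=> lt_i lt_j ne_ji ne_ji'; rewrite tpermD // -val_eqE /= !inordK // 1?eq_sym //.
exact: ltnW.
Qed.

Lemma xF_tau_far v i j : (i.+1 < n)%N -> (j < n)%N -> j != i -> j != i.+1 ->
  xF (tau i * v)%g j = xF v j.
Proof. by move=> *; rewrite /xF permM tau_far. Qed.

Lemma tauK i v : (tau i * (tau i * v))%g = v.
Proof. by rewrite mulgA tperm2 mul1g. Qed.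

Lemma tau_comm i j : (i.+1 < j)%N -> (j.+1 < n)%N -> (tau i * tau j = tau j * tau i)%g.
Proof.
move=> lt_ij lt_j; have lt_i : (i.+1 < n)%N by lia.
apply/esym/commgP/conjg_fixP; rewrite {1}/tau tpermJ !tau_far //; lia.
Qed.

Lemma tau_braid i : (i.+2 < n)%N ->
  (tau i * (tau i.+1 * tau i) = tau i.+1 * (tau i * tau i.+1))%g.
Proof.
move=> lt_i.
have -> : (tau i * (tau i.+1 * tau i) = tau i.+1 ^ tau i)%g by rewrite conjgE tpermV.
have -> : (tau i.+1 * (tau i * tau i.+1) = tau i ^ tau i.+1)%g by rewrite conjgE tpermV.
rewrite {1}/tau tpermJ tpermR tau_far; try lia.
by rewrite {1}/tau tpermJ tpermL tau_far; try lia.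
Qed.

Lemma emb_gE : emb g * emb g = emb b * emb g + 1.
Proof. by rewrite -!rmorphM gE rmorphD rmorph1. Qed.

Lemma cal_affine_hecke : affine_hecke kapE n a b sE yE.
Proof.
split=> [c h|i lt_i| |i lt_i|i lt_i|i j lt_i lt_j ne_ji ne_ji'|i j _ _];
  first [split=> [i j lt_ij lt_j|i lt_i]|idtac]; apply: actP => f v.
- rewrite !actM act_kap.
  have -> : act (kapE c) f = emb c *: f by rewrite /act lfunE.
  by rewrite /act linearZ ffunE.
- have ne := xF_neq v (ltnW lt_i) lt_i (negbT (ltn_eqF (ltnSn i))).
  rewrite actM actD actM act1 act_kap !act_s xF_tau1 xF_tau2 tauK.
  exact: (cAB _ emb_gE).
- have lt_i : (i.+1 < n)%N by lia.
  have lt_j' := ltnW lt_j; have lt_i' := ltnW lt_i.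
  have E u k : (k == i) || (k == i.+1) -> xF (tau j * u)%g k = xF u k.
    by move=> ki; apply: xF_tau_far => //; lia.
  have E' u k : (k == j) || (k == j.+1) -> xF (tau i * u)%g k = xF u k.
    by move=> kj; apply: xF_tau_far => //; lia.
  rewrite !actM !act_s !E ?E' ?eqxx ?orbT // !mulgA -tau_comm //.
  by move: (cA _ _ _ _) (cA _ _ _ _) (cB _ _ _ _ _) (cB _ _ _ _ _) => *; ring.
- have lt_i' : (i.+1 < n)%N := ltnW lt_i.
  have E u : xF (tau i * u)%g i.+2 = xF u i.+2 by apply: xF_tau_far => //; lia.
  have E' u : xF (tau i.+1 * u)%g i = xF u i by apply: xF_tau_far => //; lia.
  rewrite !actM !act_s !(xF_tau1, xF_tau2, E, E') !tauK.
  have -> : (tau i.+1 * (tau i * (tau i.+1 * v)) = tau i * (tau i.+1 * (tau i * v)))%g.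
    by rewrite !mulgA -!(mulgA _ (tau _) (tau _)) tau_braid.
  by apply: (cAB_braid _ emb_gE); apply: xF_neq => //; lia.
- have ne := xF_neq v (ltnW lt_i) lt_i (negbT (ltn_eqF (ltnSn i))).
  rewrite actD actN actD !actM !(act_s, act_y, act_kap) xF_tau1.
  by rewrite /cB /cA; field; rewrite subr_eq0 eq_sym.
- have ne := xF_neq v (ltnW lt_i) lt_i (negbT (ltn_eqF (ltnSn i))).
  rewrite !actD !actM !(act_s, act_y, act_kap) xF_tau2.
  by rewrite /cB /cA; field; rewrite subr_eq0 eq_sym.
- by rewrite !actM !(act_s, act_y) xF_tau_far //; ring.
- by rewrite !actM !act_y mulrCA.
Qed.

Lemma actB0 h : act h 0 = 0.
Proof. by rewrite /act linear0. Qed.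

(** The generators involved multiply [u] only by transpositions fixing position [k], so values at
    permutations differing there are never mixed. *)
Lemma inW_local k h : inW kapE sE k h -> (k < n)%N -> forall (f f' : V) (u : 'S_n),
  (forall u' : 'S_n, u' (inord k) = u (inord k) -> f u' = f' u') ->
  act h f u = act h f' u.
Proof.
move=> + lt_k; elim=> [c|h1 h2 _ IH1 _ IH2|i h' lt_i _ IH] f f' u ff'.
- by rewrite !act_kap ff'.
- by rewrite !actD (IH1 f f') // (IH2 f f').
- rewrite !actM !act_s (IH f f') // (IH f f' (tau i * u)%g) // => u' Eu'.
  by apply: ff'; rewrite Eu' permM tau_far //; lia.
Qed.

Lemma run_supp i k (f : V) (v : 'S_n) : (i <= k)%N -> (k < n)%N ->
  (forall u : 'S_n, (exists l, [/\ (i <= l)%N, (l <= k)%N & u (inord k) = v (inord l)]) ->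
     f u = 0) ->
  act (run sE i k) f v = 0.
Proof.
move=> le_i lt_k; have [e] := ubnP (k - i); elim: e i v le_i => // e IHe i v le_i lt_e f0.
have [le_ki|lt_ik] := leqP k i.
  by rewrite run_id // act1 f0 //; exists k; split=> //; rewrite (_ : k = i) //; lia.
rewrite runS // actM act_s !IHe ?mulr0 ?addr0 //; try lia.
  move=> u [l [le_l le_lk Eu]]; apply: f0; have [lt_l|] := ltnP i.+1 l.
    by exists l; split=> //; [lia|rewrite Eu permM tau_far //; lia].
  move=> le_li; exists i; split=> //; rewrite Eu permM (_ : l = i.+1) ?tpermR //; lia.
by move=> u [l [le_l le_lk Eu]]; apply: f0; exists l; split=> //; lia.
Qed.

Lemma cB_neq0 x x' : x != x' -> emb g * (x' - x) != emb a + emb b * x' ->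
  cB (emb a) (emb b) (emb g) x x' != 0.
Proof.
move=> ne_x; apply: contraNneq => B0.
have {}B0 : emb g = cA (emb a) (emb b) x x' by apply/eqP; rewrite -subr_eq0 -B0.
by rewrite B0 /cA divfK // subr_eq0 eq_sym.
Qed.

Hypothesis xi_generic : forall i j, i != j ->
  emb g * (xi j - xi i) != emb a + emb b * xi j.

(** In s_i ... s_{k-1} only the path taking the off-diagonal term at every step carries the entry
    v(i) to position k. Its coefficient is a product of values of [cB], nonzero by genericity;
    [run_supp] kills the diagonal branches. *)
Lemma run_lead i k (v : 'S_n) : (i <= k)%N -> (k < n)%N ->
  exists beta (u : 'S_n), [/\ beta != 0, u (inord k) = v (inord i) &
    forall f : V, (forall u' : 'S_n,
        (exists l, [/\ (i < l)%N, (l <= k)%N & u' (inord k) = v (inord l)]) -> f u' = 0) ->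
      act (run sE i k) f v = beta * f u].
Proof.
move=> le_i lt_k; have [e] := ubnP (k - i); elim: e i v le_i => // e IHe i v le_i lt_e.
have [le_ki|lt_ik] := leqP k i.
  exists 1, v; rewrite oner_neq0 (_ : k = i) //; last by lia.
  by split=> // f _; rewrite run_id // act1 mul1r.
have [||beta [u [beta0 Eu fE]]] := IHe i.+1 (tau i * v)%g; try lia.
have ne_i : (inord i : 'I_n) != inord i.+1 by rewrite -val_eqE /= !inordK; lia.
exists (cB (emb a) (emb b) (emb g) (xF v i) (xF v i.+1) * beta), u.
split=> [||f f0].
- rewrite mulf_neq0 // cB_neq0 //; first by apply: xF_neq; lia.
  by apply: xi_generic; rewrite (inj_eq perm_inj).
- by rewrite Eu permM tpermR.
- rewrite runS // actM act_s run_supp // mulr0 add0r.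
  rewrite fE ?mulrA // => u' [l [lt_l le_lk Eu']]; apply: f0; exists l; split=> //; first lia.
  by rewrite Eu' permM tau_far //; lia.
Qed.

(** Triangularity: the first entry i of a code is detected by the entry v(i) at position k. With the
    coefficients for smaller first entries already zero, test functions supported on that coset
    isolate the codes starting with i, and the induction on [m] treats their tails. *)
Lemma word_indep m (v : 'S_n) (c : seq nat -> F) : (m <= n)%N ->
  (forall f : V, \sum_(w <- codes m) c w * act (word sE w) f v = 0) ->
  forall w, w \in codes m -> c w = 0.
Proof.
elim: m v c => [|k IHk] v c le_m c0 w.
  rewrite inE => /eqP->; move: (c0 [ffun=> 1]).
  by rewrite big_seq1 act1 ffunE mulr1.
suff zero i : (i <= k)%N -> forall w, w \in codes k -> c (i :: w) = 0.
  by case/codesP=> i [w' [le_i Cw' ->]]; apply: zero.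
have [e] := ubnP i; elim: e i => // e IHe i lt_e le_i.
have [beta [u [beta0 Eu fE]]] := run_lead v le_i le_m.
apply: (IHk u (fun w => c (i :: w)) (ltnW le_m)) => f.
(* The restriction of [f] to permutations with v(i) at position k: words in the smaller group
   preserve this support, and runs starting at l > i do not see it. *)
pose f' : V := [ffun u' : 'S_n => if u' (inord k) == v (inord i) then f u' else 0].
have loc w' (u' : 'S_n) : w' \in codes k -> u' (inord k) != v (inord i) ->
    act (word sE w') f' u' = 0.
  move=> Cw' ne_u'.
  rewrite (inW_local (inW_word cal_affine_hecke Cw') le_m (f' := 0)) ?actB0 ?ffunE //.
  by move=> u'' E; rewrite !ffunE E (negPf ne_u').
have same w' : w' \in codes k -> act (word sE w') f' u = act (word sE w') f u.
  move=> Cw'; apply: (inW_local (inW_word cal_affine_hecke Cw') le_m) => u' Eu'.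
  by rewrite ffunE Eu' Eu eqxx.
apply: (mulfI beta0); rewrite mulr0 -[RHS](c0 f') mulr_sumr.
rewrite -[codes k.+1]/[seq j :: w' | j <- iota 0 k.+1, w' <- codes k] [RHS]big_allpairs_dep.
have i_in : i \in iota 0 k.+1 by rewrite mem_iota.
rewrite [RHS](bigD1_seq i i_in (iota_uniq _ _)) /= [X in _ = _ + X]big1_seq ?addr0.
  rewrite big_seq [RHS]big_seq; apply: eq_bigr => w' Cw'.
  rewrite (size_codes Cw') actM fE ?same //; first by rewrite mulrCA.
  move=> u' [l [lt_il le_lk Eu']]; apply: loc => //.
  rewrite Eu' (inj_eq perm_inj) -val_eqE /= !inordK; lia.
move=> l /andP[ne_l]; rewrite -[_ :: _]/(iota 0 k.+1) mem_iota => lt_l;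
  rewrite big1_seq // => w' /= Cw'.
have [lt_li|lt_il|eq_li] := ltngtP l i; last by rewrite eq_li eqxx in ne_l.
  by rewrite IHe ?mul0r //; lia.
have le_lk : (l <= k)%N by rewrite -ltnS.
rewrite (size_codes Cw') actM run_supp ?mulr0 // => u' [l' [le_l le_l'k Eu']].
apply: loc => //; rewrite Eu' (inj_eq perm_inj) -val_eqE /= !inordK; lia.
Qed.

Hypothesis xi_free : forall f : {mpoly S[n]},
  \sum_(m <- msupp f) emb f@_m * \prod_(i < n) xi i ^+ m i = 0 -> f = 0.

Lemma act_sum I (r : seq I) (h : I -> calE) f v :
  act (\sum_(i <- r) h i) f v = \sum_(i <- r) act (h i) f v.
Proof.
exact: (big_morph (fun h => act h f v) (fun h h' => actD h h' f v) (act0 f v)).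
Qed.

Lemma act_mon (m : 'X_{1..n}) f v :
  act (mon yE m) f v = (\prod_(i < n) xF v i ^+ m i) * f v.
Proof.
have actX i k f' : act (yE i ^+ k) f' v = xF v i ^+ k * f' v.
  elim: k => [|k IHk]; first by rewrite !expr0 act1 mul1r.
  by rewrite !exprS actM act_y IHk mulrA.
rewrite /mon; elim/big_rec2: _ => [|i h x _ IH]; first by rewrite act1 mul1r.
by rewrite actM actX IH mulrA.
Qed.

(** At the identity permutation y^m acts by the monomial in [xi]. A relation thus becomes one
    between words with coefficients in F, to which [word_indep] applies; [xi_free] then kills the
    polynomial coefficients. *)
Lemma cal_pbw_indep (Q : pzRingType) (kap : {rmorphism S -> Q}) (s y : nat -> Q)
    (rho : {rmorphism Q -> calE}) :
  (forall c, rho (kap c) = kapE c) ->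
  (forall i, (i.+1 < n)%N -> rho (s i) = sE i) ->
  (forall i, (i < n)%N -> rho (y i) = yE i) ->
  pbw_indep kap n s y.
Proof.
move=> rho_kap rho_s rho_y G G0 w Cw.
have rho_run i k : (k < n)%N -> rho (run s i k) = run sE i k.
  elim: k => [_|k IHk lt_k] /=; first by rewrite rmorph1.
  by case: ifP => _; rewrite ?rmorph1 // rmorphM IHk 1?ltnW // rho_s.
have rho_word m v : (m <= n)%N -> v \in codes m -> rho (word s v) = word sE v.
  elim: m v => [|m IHm] v le_m; first by rewrite inE => /eqP->; rewrite rmorph1.
  case/codesP=> i [v' [_ Cv' ->]] /=; rewrite rmorphM (size_codes Cv') rho_run //.
  by rewrite IHm // ltnW.
have rho_mon (m : 'X_{1..n}) : rho (mon y m) = mon yE m.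
  by rewrite rmorph_prod; apply: eq_bigr => i _; rewrite rmorphXn /= rho_y.
apply: xi_free; pose c v := \sum_(m <- msupp (G v)) emb (G v)@_m * \prod_(i < n) xi i ^+ m i.
apply: (@word_indep n 1%g c) => // f.
have E0 := congr1 (fun h => act (rho h) f 1%g) G0; rewrite rmorph0 act0 in E0; rewrite -[RHS]E0.
rewrite rmorph_sum act_sum big_seq [RHS]big_seq; apply: eq_bigr => v Cv.
rewrite rmorph_sum act_sum mulr_suml; apply: eq_bigr => m _.
rewrite !rmorphM /= rho_kap rho_mon (rho_word n) // !actM act_kap act_mon mulrA.
congr (_ * _ * _); apply: eq_bigr => i _.
by rewrite /xF perm1 inord_val.
Qed.

End Calibrated.

(* The principal series with generic weights: the affine Hecke algebra acts  *)
(* on functions on the symmetric group with values in the field of rational  *)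
(* functions.                                                                *)
Theorem calibrated_rep (S : idomainType) (n' : nat) (a b g : S) :
  g * g = b * g + 1 ->
  exists (E : nzRingType) (kapE : {rmorphism S -> E}) (sE yE yVE : nat -> E),
  [/\ affine_hecke kapE n'.+1 a b sE yE,
      forall i, yE i * yVE i = 1 /\ yVE i * yE i = 1
    & forall (Q : pzRingType) (kap : {rmorphism S -> Q}) (s y : nat -> Q)
        (rho : {rmorphism Q -> E}),
      (forall c, rho (kap c) = kapE c) ->
      (forall i, (i.+1 < n'.+1)%N -> rho (s i) = sE i) ->
      (forall i, (i < n'.+1)%N -> rho (y i) = yE i) ->
      pbw_indep kap n'.+1 s y].
Proof.
move=> gE; pose F : fieldType := {fraction {mpoly S[n'.+1]}}.
pose emb : {rmorphism S -> F} := (@tofrac _) \o (@mpolyC n'.+1 S).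
pose xi i : F := tofrac 'X_i.
have g0 : g != 0.
  apply/eqP => g0; move/eqP: gE; rewrite g0 !mulr0 add0r eq_sym.
  by rewrite oner_eq0.
have xi_inj : injective xi.
  move=> i j /eqP; rewrite tofrac_eq => /eqP/(congr1 (mcoeff U_(i)%MM)).
  by rewrite !mcoeffXU eqxx; case: eqP => // _ /eqP; rewrite oner_eq0.
have xi_generic i j : i != j -> emb g * (xi j - xi i) != emb a + emb b * xi j.
  move=> ne_ij; rewrite -tofracB -!tofracM -tofracD tofrac_eq.
  apply/eqP => /(congr1 (mcoeff U_(i)%MM)).
  rewrite mcoeffD !mcoeffCM mcoeffB !mcoeffXU eqxx eq_sym (negPf ne_ij) mcoeffC.
  rewrite mulr0 addr0 (_ : (_ == _) = false) ?mulr0 ?sub0r ?mulrN1.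
    by move/eqP; rewrite oppr_eq0 (negPf g0).
  by apply/eqP => /mnmP/(_ i); rewrite mnm0E mnm1E eqxx.
have xi_free (f : {mpoly S[n'.+1]}) :
    \sum_(m <- msupp f) emb f@_m * \prod_(i < n'.+1) xi i ^+ m i = 0 -> f = 0.
  move=> f0; apply/eqP; rewrite -tofrac_eq0 [f]mpolyE rmorph_sum -[X in _ == X]f0 /=.
  apply/eqP/eq_bigr => m _; rewrite -mul_mpolyC rmorphM; congr (_ * _).
  by rewrite mpolyXE_id rmorph_prod; apply: eq_bigr => i _; rewrite rmorphXn.
have xi0 v i : xF xi v i != 0.
  rewrite tofrac_eq0; apply/eqP => /(congr1 (mcoeff U_(v (inord i))%MM)).
  by rewrite mcoeffXU eqxx mcoeff0 => /eqP; rewrite oner_eq0.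
exists (calE n' F), (@kapE S n' F emb), (sE a b g emb xi), (yE xi), (yVE xi).
split=> [|i|Q kap s y rho]; first exact: cal_affine_hecke.
  by split; apply: actP => f v; rewrite actM !(act_y, act_yV) act1 mulrA
     ?mulVf ?mulfV ?mul1r.
exact: cal_pbw_indep.
Qed.

(** * Presented algebras *)

Section Lifting.

Lemma ideal_gen_sub (R : pzRingType) (X J : set R) :
  two_sided_ideal J -> X `<=` J -> ideal_gen X `<=` J.
Proof. by move=> IJ XJ; apply: smallest_sub. Qed.

Lemma ideal_gen_incl (R : pzRingType) (X : set R) : X `<=` ideal_gen X.
Proof. exact: sub_gen_smallest. Qed.

Lemma preimage_ideal (R T : pzRingType) (f : {rmorphism R -> T}) (J : set T) :
  two_sided_ideal J -> two_sided_ideal (f @^-1` J).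
Proof.
move=> [J0 JD JM]; split=> [|x y Jx Jy|a x b Jx] /=.
- by rewrite rmorph0.
- by rewrite rmorphD; apply: JD.
- by rewrite !rmorphM; apply: JM.
Qed.

Lemma kernel_ideal (R T : pzRingType) (f : {rmorphism R -> T}) :
  two_sided_ideal [set x | f x = 0].
Proof.
split=> [|x y /= fx fy|a x b /= fx] /=; first exact: rmorph0.
  by rewrite rmorphD fx fy addr0.
by rewrite !rmorphM fx mulr0 mul0r.
Qed.

Lemma ideal_gen_image (R T : pzRingType) (f : {rmorphism R -> T}) (X : set R) (x : R) :
  ideal_gen X x -> ideal_gen (f @` X) (f x).
Proof.
move: x; apply: ideal_gen_sub; first exact: preimage_ideal (ideal_gen_ideal _).
by move=> x Xx; apply: ideal_gen_incl; exists x.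
Qed.

Lemma ideal_gen_lift (R T : pzRingType) (f : {rmorphism R -> T}) (X : set R) (z : T) :
  (forall z, exists x, z = f x) -> ideal_gen (f @` X) z ->
  exists2 x, ideal_gen X x & z = f x.
Proof.
move=> f_surj; move: z; apply: ideal_gen_sub; last first.
  by move=> _ [x Xx <-]; exists x => //; apply: ideal_gen_incl.
split=> [|_ _ [x Xx ->] [x' Xx' ->]|a _ b [x Xx ->]].
- by exists 0; rewrite ?rmorph0 //; apply: ideal_gen0.
- by exists (x + x'); rewrite ?rmorphD //; apply: ideal_genD.
- have [[a' ->] [b' ->]] := (f_surj a, f_surj b).
  by exists (a' * x * b'); rewrite ?rmorphM //; apply: ideal_genMr; apply: ideal_genMl.
Qed.

Lemma rq_lift (R T : pzRingType) (X : set R) (f : {rmorphism R -> T}) :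
  (forall x, X x -> f x = 0) ->
  exists g : {rmorphism ring_quot X -> T}, forall a, g (rq_pi X a) = f a.
Proof.
move=> fX; pose g (x : ring_quot X) := f (generic_quotient.repr x).
have gE a : g (rq_pi X a) = f a.
  apply/subr0_eq; rewrite -rmorphB.
  exact: (ideal_gen_sub (kernel_ideal f) fX (@repr_rq_pi R X a)).
have gN : nmod_morphism g.
  split=> [|x x']; first by rewrite -(rmorph0 (rq_pi X)) gE rmorph0.
  have [[a ->] [b ->]] := (rq_pi_surj x, rq_pi_surj x').
  by rewrite -rmorphD !gE rmorphD.
have gM : monoid_morphism g.
  split=> [|x x']; first by rewrite -(rmorph1 (rq_pi X)) gE rmorph1.
  have [[a ->] [b ->]] := (rq_pi_surj x, rq_pi_surj x').
  by rewrite -rmorphM !gE rmorphM.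
pose gR : {rmorphism ring_quot X -> T} := HB.pack g
  (GRing.isNmodMorphism.Build _ _ g gN) (GRing.isMonoidMorphism.Build _ _ g gM).
by exists gR.
Qed.

Lemma palg_lift (S : comNzRingType) (I : choiceType)
    (E : free_alg S I -> free_alg S I -> Prop) (T : pzRingType)
    (f : {rmorphism free_alg S I -> T}) :
  (forall x y, E x y -> f x = f y) ->
  exists g : {rmorphism palg E -> T}, forall a, g (palg_pi E a) = f a.
Proof.
move=> fE; apply: (rq_lift (X := relators E)) => _ [x [y [/fE fxy ->]]].
by rewrite rmorphB fxy subrr.
Qed.

End Lifting.

Section FreeAlgebra.
Import monalg.

Lemma gen_prodE (S : comNzRingType) (I : choiceType) (k : fmonom I) :
  mkmalgU k 1 = \prod_(i <- fmonom_val k) gen S i.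
Proof.
rewrite -(fmK k) /=; elim: (fmonom_val k) => [|i s IHs].
  by rewrite big_nil -fmoneE.
rewrite big_cons -IHs /gen.
have -> : FMonom (i :: s) = mmul (fmu i) (FMonom s).
  by rewrite /mmul /= fmmulE fmuE.
by rewrite malgM_def fgmulUU mulr1.
Qed.

Lemma free_alg_ind (S : comNzRingType) (I : choiceType) (P : free_alg S I -> Prop) :
  (forall c, P (c *: 1)) -> (forall i, P (gen S i)) ->
  (forall x y, P x -> P y -> P (x + y)) -> (forall x y, P x -> P y -> P (x * y)) ->
  forall x, P x.
Proof.
move=> Pc Pg PD PM x.
have P1 : P 1 by rewrite -[1]scale1r.
have P0 : P 0 by rewrite -(scale0r (1 : free_alg S I)).
rewrite [x]monalgE; elim/big_ind: _ => // k _.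
have -> : mkmalgU k (mcoeff k x) = mcoeff k x *: (1 : free_alg S I) * mkmalgU k 1.
  by rewrite -scalerAl mul1r -mul_malgC malgM_def fgmulUU
    mulr1 mul1m.
apply: (PM) => //; rewrite gen_prodE; elim/big_ind: _ => //.
Qed.

Lemma free_lift_nz (S : comNzRingType) (I : choiceType) (T : nzRingType)
    (kap : {rmorphism S -> T}) (v : I -> T) :
  (forall c x, kap c * x = x * kap c) ->
  exists f : {rmorphism free_alg S I -> T},
    (forall c, f (c *: 1) = kap c) /\ (forall i, f (gen S i) = v i).
Proof.
move=> kapC; pose h (m : fmonom I) := \prod_(i <- fmonom_val m) v i.
have hM : mmorphism h.
  split=> [m m'|]; rewrite /h; first by rewrite fmM big_cat.
  by rewrite fm1 big_nil.
pose hR : MMorphism.type _ T := HB.pack h (isMultiplicative.Build _ T h hM).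
pose f := mmap kap hR.
have fM : monoid_morphism f.
  have [] : multiplicative f.
    by apply: commr_mmap_is_multiplicative => x m m'; apply: kapC.
  by split.
have fN : nmod_morphism f by split; [apply: raddf0|apply: raddfD].
pose fR : {rmorphism free_alg S I -> T} := HB.pack f
  (GRing.isNmodMorphism.Build _ _ f fN) (GRing.isMonoidMorphism.Build _ _ f fM).
exists fR; split=> [c|i] /=.
  rewrite /f -[RHS]mulr1 -(mmap1 (f := kap) (h := hR)); exact: mmapZ.
transitivity (kap 1 * h (fmu i)); first exact: mmapU.
by rewrite rmorph1 mul1r /h fmU big_seq1.
Qed.

(** The quotients may be the zero ring, so this case is separated from [free_lift_nz]; there every
    map is zero. *)
Lemma free_lift (S : comNzRingType) (I : choiceType) (T : pzRingType)
    (kap : {rmorphism S -> T}) (v : I -> T) :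
  (forall c x, kap c * x = x * kap c) ->
  exists f : {rmorphism free_alg S I -> T},
    (forall c, f (c *: 1) = kap c) /\ (forall i, f (gen S i) = v i).
Proof.
move=> kapC; have [T0|T1] := eqVneq (1 : T) 0; last first.
  pose T' : nzRingType := HB.pack T (GRing.PzSemiRing_isNonZero.Build T T1).
  exact: (@free_lift_nz S I T' kap v kapC).
have x0 (x : T) : x = 0 by rewrite -[x]mul1r T0 mul0r.
pose f (_ : free_alg S I) : T := 0.
have fN : nmod_morphism f by split=> [//|x y]; rewrite [RHS]x0.
have fM : monoid_morphism f by split=> [|x y]; rewrite [RHS]x0.
pose fR : {rmorphism free_alg S I -> T} := HB.pack f
  (GRing.isNmodMorphism.Build _ _ f fN) (GRing.isMonoidMorphism.Build _ _ f fM).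
by exists fR; split=> *; rewrite [LHS]x0 [RHS]x0.
Qed.

End FreeAlgebra.

(** * Disjointness of the two ideals *)

(* [p] annihilates the ideal generated by the [e i] because the right ideal  *)
(* [p * T] lies in the sum of the left ideals [T * p * ts i]. In the uses,   *)
(* [rr i] is the inverse of [s i.+1].                                        *)
Section Annihilation.
Variables (T : pzRingType) (n : nat) (s e rr : nat -> T) (p : T).

Definition central (c : T) : Prop := forall x, c * x = x * c.

Hypotheses (BR : braid_rel n s)
  (se_far : forall i j, (i.+1 < n)%N -> (j.+1 < n)%N -> far i j -> s i * e j = e j * s i)
  (eee : forall i, (i.+2 < n)%N -> e i.+1 * e i * e i.+1 = e i.+1)
  (see : forall i, (i.+2 < n)%N -> s i * e i.+1 = rr i * (e i * e i.+1))
  (rr_s : forall i k, (i.+2 < n)%N -> (k < i)%N -> rr i * s k = s k * rr i)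
  (rr_p : forall i, (i.+2 < n)%N -> p * rr i = rr i * p)
  (se : forall i, (i.+1 < n)%N -> exists2 c, central c & s i * e i = c * e i)
  (sse : forall i, (i.+2 < n)%N -> s i * s i.+1 * e i = e i.+1 * e i)
  (ss : forall i, (i.+1 < n)%N -> exists c c',
    [/\ central c, central c' & s i * s i = c * s i + 1 + c' * e i])
  (p_s : forall i, (0 < i)%N -> (i.+1 < n)%N -> p * s i = s i * p)
  (p_e : forall i, (0 < i)%N -> (i.+1 < n)%N -> p * e i = e i * p)
  (p_e0 : p * e 0 = 0).

Local Notation ts := (ts s).

Lemma p_ei j : (j.+1 < n)%N -> p * e j = 0.
Proof.
elim: j => [//|j IHj] lt_j.
by rewrite -eee // !mulrA p_e // -(mulrA (e j.+1)) IHj ?mulr0 ?mul0r // ltnW.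
Qed.

Lemma p_ts_rr i k : (k <= i)%N -> (i.+2 < n)%N -> p * ts k * rr i = rr i * p * ts k.
Proof.
move=> le_k lt_i; have -> : p * ts k * rr i = p * (rr i * ts k).
  rewrite -mulrA; congr (_ * _); elim: k le_k => [|k IHk] lt_k /=.
    by rewrite mulr1 mul1r.
  by rewrite -mulrA -rr_s // mulrA IHk 1?ltnW // mulrA.
by rewrite mulrA rr_p.
Qed.

(** Induction on the length of the coset word, according to its last letter s_i. For j = i, s_i e_i
    is a central multiple of e_i; for j = i - 1, s_{i-1} s_i e_{i-1} = e_i e_{i-1}; for j = i + 1,
    [see] produces a factor [rr i] which moves to the left of p; otherwise s_i and e_j commute. Each
    time a shorter word meets some e. *)
Lemma p_ts_e i j : (i < n)%N -> (j.+1 < n)%N -> p * ts i * e j = 0.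
Proof.
have [k] := ubnP i; elim: k i j => // k IHk [|i] j lt_ik lt_i lt_j.
  by rewrite mulr1 p_ei.
have IH j' i' : (i' <= i)%N -> (j'.+1 < n)%N -> p * ts i' * e j' = 0.
  by move=> le_i' lt_j'; apply: IHk => //; lia.
have far0 : far i j -> p * ts i.+1 * e j = 0.
  by move=> fij; rewrite /= -!mulrA se_far // !mulrA IH ?mul0r.
have [lt_ji|lt_ij|->] := ltngtP j i; last 1 first.
- by have [c cC E] := se lt_i; rewrite /= -!mulrA E cC !mulrA IH // mul0r.
- move: lt_ji; case: i => // i in lt_ik lt_i IH far0 *.
  rewrite ltnS leq_eqVlt => /orP[/eqP->|lt_ji]; last by apply: far0; rewrite /far ltnS lt_ji orbT.
  by rewrite /= -!mulrA (mulrA (s i)) sse // !mulrA IH ?mul0r.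
- move: lt_ij; rewrite leq_eqVlt => /orP[/eqP ij|lt_ij]; last by apply: far0; rewrite /far lt_ij.
  rewrite -{}ij in lt_j far0 *.
  rewrite /= -!mulrA see // 2!mulrA p_ts_rr // -!mulrA (mulrA p) (mulrA _ (e i)).
  by rewrite IH ?mul0r ?mulr0.
Qed.

Inductive right_hull : T -> Prop :=
| hull0 : right_hull 0
| hull_gen a i : (i < n)%N -> right_hull (a * p * ts i)
| hullD u v : right_hull u -> right_hull v -> right_hull (u + v).

Lemma hullM a u : right_hull u -> right_hull (a * u).
Proof.
elim=> [|b i lt_i|v w _ + _].
- by rewrite mulr0; apply: hull0.
- by rewrite !mulrA; apply: hull_gen.
- by rewrite mulrDr; apply: hullD.
Qed.

Lemma hullN u : right_hull u -> right_hull (- u).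
Proof. by move/(hullM (-1)); rewrite mulN1r. Qed.

Lemma hull_p_ts i : (i < n)%N -> right_hull (p * ts i).
Proof. by move=> lt_i; rewrite -[p]mul1r; apply: hull_gen. Qed.

Lemma hull_mulr x : (forall i, (i < n)%N -> right_hull (p * ts i * x)) ->
  forall u, right_hull u -> right_hull (u * x).
Proof.
move=> Ux u; elim=> [|b i lt_i|v w _ + _].
- by rewrite mul0r; apply: hull0.
- by rewrite -!mulrA mulrA -mulrA (mulrA p); apply/hullM/Ux.
- by rewrite mulrDl; apply: hullD.
Qed.

Lemma hull_e u j : (j.+1 < n)%N -> right_hull u -> u * e j = 0.
Proof.
move=> lt_j; elim=> [|b i lt_i|v w _ uv _ uw]; first by rewrite mul0r.
  by rewrite -(mulrA b) -mulrA p_ts_e // mulr0.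
by rewrite mulrDl uv uw addr0.
Qed.

(** The same four positions of k relative to i as in [layer_sM]; the e-term of the quadratic
    relation is killed by [p_ts_e]. *)
Lemma hull_s u k : (k.+1 < n)%N -> right_hull u -> right_hull (u * s k).
Proof.
move=> lt_k; apply: hull_mulr => i lt_i.
have [lt_ik|] := ltnP i k.
  rewrite -mulrA -(ts_far BR lt_ik lt_k) mulrA p_s ?(leq_ltn_trans _ lt_ik) //.
  exact: hull_gen.
rewrite leq_eqVlt => /orP[/eqP ki|].
  by rewrite ki in lt_k *; rewrite -mulrA; apply: (@hull_p_ts i.+1).
rewrite leq_eqVlt => /orP[/eqP ki|lt_ki].
  rewrite -{}ki in lt_i *; have [c [c' [cC c'C E]]] := ss lt_i.
  rewrite /= -!mulrA E !mulrDr mulr1 !mulrA.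
  apply: hullD; first apply: hullD.
  - rewrite -(mulrA p) -cC !mulrA -cC -!mulrA; apply: hullM.
    exact: (@hull_p_ts k.+1).
  - exact/hull_p_ts/ltnW.
  - rewrite -(mulrA _ c') c'C mulrA p_ts_e ?mul0r //; first exact: hull0.
    exact: ltnW.
rewrite -mulrA -(ts_shift BR lt_ki lt_i) mulrA p_s //; last exact: leq_trans lt_i.
exact: hull_gen.
Qed.

Lemma annihilates : (forall x u, right_hull u -> right_hull (u * x)) ->
  forall x j, (j.+1 < n)%N -> p * x * e j = 0.
Proof.
move=> Ux x j lt_j; apply: hull_e => //; apply: Ux.
by rewrite -[p]mulr1; apply: (@hull_p_ts 0); apply: leq_trans lt_j.
Qed.

End Annihilation.

Lemma annihilates_ideal (T : pzRingType) (p x r : T) :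
  (forall z, p * z * x = 0) -> ideal_gen [set x] r -> p * r = 0.
Proof.
move=> px Ir; suff : [set r | forall z, p * z * r = 0] r by move/(_ 1); rewrite mulr1.
apply: ideal_gen_sub Ir => [|_ -> //].
split=> [z|u v /= pu pv z|a u b /= pu z]; first by rewrite mulr0.
  by rewrite mulrDr pu pv addr0.
by rewrite !mulrA -(mulrA p) pu mul0r.
Qed.

Lemma annihilates_ideal_r (T : pzRingType) (p x r : T) :
  (forall z, x * z * p = 0) -> ideal_gen [set x] r -> r * p = 0.
Proof.
move=> px Ir; suff : [set r | forall z, r * z * p = 0] r by move/(_ 1); rewrite mulr1.
apply: ideal_gen_sub Ir => [|_ -> //].
split=> [z|u v /= pu pv z|a u b /= pu z]; first by rewrite !mul0r.
  by rewrite !mulrDl pu pv addr0.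
by rewrite -!mulrA (mulrA b) (mulrA u) pu mulr0.
Qed.

Lemma prod_top (S : comNzRingType) (Q : pzRingType) (kap : {rmorphism S -> Q})
    (n : nat) (a b : S) (s y : nat -> Q) (us : seq S) :
  affine_hecke kap n a b s y -> (0 < n)%N ->
  pbw_span kap s y (@below n (size us) 0) 1 (\prod_(c <- us) (y 0 - kap c) - y 0 ^+ size us).
Proof.
move=> AH n_gt0; elim: us => [|c us IHus].
  by rewrite big_nil expr0 subrr; apply: pbw0.
rewrite big_cons /= exprS; set P := \prod_(_ <- _) _ in IHus *; set k := size us in IHus *.
have -> : (y 0 - kap c) * P - y 0 * y 0 ^+ k
    = mon y (Um n 0 1) * (P - y 0 ^+ k) + kap (- c) * (P - y 0 ^+ k + y 0 ^+ k).
  rewrite monU // expr1 subrK rmorphN mulNr mulrBl mulrBr.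
  by rewrite addrAC.
have below_le m : @below n k 0 m -> @below n k.+1 0 m.
  by move=> [dm m0 mk]; split=> [|//|i /mk]; [apply: leqW|apply: ltnW].
apply: pbwD.
  apply: (pbw_monM AH (X := below k 0)) => // m [dm m0 mk].
  split=> [|i lt_i|i i0]; first by rewrite mdegD mdeg_Um.
    by rewrite mnmDE UmE m0 // -(prednK lt_i).
  by rewrite mnmDE UmE i0 mul1n ltnS mk.
apply: (pbwZ AH); apply: pbwD; first exact: (pbw_mono below_le (leqnn _)).
rewrite -(@monU Q n) // -[mon _ _]mulr1; apply: (pbw_gen _ _ (inW1 _ _ _)).
split=> [|i lt_i|i i0]; first by rewrite mdeg_Um.
  by rewrite UmE -(prednK lt_i).
by rewrite UmE i0 mul1n.
Qed.

(** This isolates what both families share: the relations of T become Hecke relations once the e_i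
    vanish, and every representation of the affine Hecke algebra with invertible y_i extends to T
    with e_i acting by 0. The principal series therefore factors through T / (e_{n-1}), which gives
    the PBW independence needed by [ideal_gen_inj]. *)
Theorem ideals_disjoint (S : idomainType) (T : pzRingType) (kap : {rmorphism S -> T})
    (n' : nat) (a b g : S) (s e y : nat -> T) (us : seq S) (Y : T) :
  let n := n'.+2 in
  let p := \prod_(c <- us) (y 0 - kap c) in
  g * g = b * g + 1 -> (0 < size us)%N ->
  (forall c x, kap c * x = x * kap c) ->
  (forall i, (i.+1 < n)%N -> ideal_gen [set e n'] (e i)) ->
  (forall (Q : pzRingType) (phi : {rmorphism T -> Q}),
     (forall z, exists x, z = phi x) ->
     (forall i, (i.+1 < n)%N -> phi (e i) = 0) ->
     affine_hecke (phi \o kap) n a b (phi \o s) (phi \o y)) ->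
  (forall x i, (i.+1 < n)%N -> p * x * e i = 0) ->
  (forall x i, (i.+1 < n)%N -> e i * x * p = 0) ->
  (forall i, (i < n)%N -> p * y i = y i * p) ->
  (forall i, (0 < i)%N -> (i.+1 < n)%N -> p * s i = s i * p) ->
  (forall (E : nzRingType) (kapE : {rmorphism S -> E}) (sE yE yVE : nat -> E),
     affine_hecke kapE n a b sE yE ->
     (forall i, yE i * yVE i = 1 /\ yVE i * yE i = 1) ->
     exists rho : {rmorphism T -> E},
     [/\ forall c, rho (kap c) = kapE c,
         forall i, (i.+1 < n)%N -> rho (s i) = sE i,
         forall i, (i.+1 < n)%N -> rho (e i) = 0
       & forall i, (i < n)%N -> rho (y i) = yE i]) ->
  p * Y = Y * p -> (forall x, Y * x = 0 -> x = 0) ->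
  (forall (Q : pzRingType) (phi : {rmorphism T -> Q}),
     (forall z, exists x, z = phi x) ->
     (forall i, (i.+1 < n)%N -> phi (e i) = 0) ->
     [/\ forall z, phi Y * z = z * phi Y,
         pbw_span (phi \o kap) (phi \o s) (phi \o y) (@full n) n (phi Y)
       & forall z, exists N,
         pbw_span (phi \o kap) (phi \o s) (phi \o y) (@full n) n (phi Y ^+ N * z)]) ->
  forall z, ideal_gen [set p] z -> ideal_gen [set e n'] z -> z = 0.
Proof.
move=> n p gE us_gt0 kapC e_last hecke pe ep p_y p_s lift pY Y_reg Y_phi z Pz Ez.
pose X := [set e n']; pose phi : {rmorphism T -> ring_quot X} := rq_pi X.
have phi_surj h : exists r, h = phi r by apply: rq_pi_surj.
have phi_e i : (i.+1 < n)%N -> phi (e i) = 0.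
  by move=> lt_i; apply/rq_pi_eq0; apply: e_last.
have AH := hecke _ phi phi_surj phi_e.
have [Y_central Y_pbw Y_clears] := Y_phi _ phi phi_surj phi_e.
have [E [kapE [sE [yE [yVE [AHE yVP indepE]]]]]] := calibrated_rep n'.+1 a gE.
have [rho [rho_kap rho_s rho_e rho_y]] := lift _ _ _ _ _ AHE yVP.
have [rhoQ rhoQE] : exists r : {rmorphism ring_quot X -> E}, forall x, r (rq_pi X x) = rho x.
  by apply: rq_lift => _ ->; apply: rho_e.
have indep : pbw_indep (phi \o kap) n (phi \o s) (phi \o y).
  apply: (indepE _ (phi \o kap) _ _ rhoQ) => [c|i lt_i|i lt_i] /=.
  - by rewrite /phi rhoQE.
  - by rewrite /phi rhoQE rho_s.
  - by rewrite /phi rhoQE rho_y.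
have top : pbw_span (phi \o kap) (phi \o s) (phi \o y) (@below n (size us) 0) 1
    (phi p - (phi \o y) 0 ^+ size us).
  rewrite /p rmorph_prod (eq_bigr (fun c => (phi \o y) 0 - (phi \o kap) c)).
    exact: (prod_top us AH).
  by move=> c _; rewrite rmorphB.
apply: (@ideal_gen_inj S T _ phi kap (phi \o kap) n a b s y (phi \o s) (phi \o y) p (size us)
   phi_surj _ _ _ _ _ _ p_y p_s AH _ us_gt0 top indep Y) => //.
- move=> r /rq_pi_eq0; apply: annihilates_ideal => x; exact: pe.
- move=> r /rq_pi_eq0; apply: annihilates_ideal_r => x; exact: ep.
- by apply/rq_pi_eq0.
Qed.

(** A difference x - x' killed by theta lifts to some f in (e) upstairs, and f lies in (p) as well.
    By disjointness f vanishes modulo [X], and [X] already maps to 0 in the larger cyclotomic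
    quotient, so x = x'. *)
Theorem theta_bij (S : comNzRingType) (I : choiceType)
    (E : free_alg S I -> free_alg S I -> Prop) (y1 e1 e : palg E) (u : seq S) (d : nat) :
  let p := cyc_poly y1 (take d u) in
  let X := [set z | z = p * e1 \/ z = e1 * p] in
  cyc_pi y1 u (p * e1) = 0 -> cyc_pi y1 u (e1 * p) = 0 ->
  (forall z, ideal_gen [set rq_pi X p] z -> ideal_gen [set rq_pi X e] z -> z = 0) ->
  set_bij (ideal_gen [set cyc_pi y1 u e]) (ideal_gen [set cyc_pi y1 (take d u) e])
    (theta y1 u d).
Proof.
move=> p X pe1 e1p disj.
have img : [set cyc_pi y1 (take d u) e] = theta y1 u d @` [set cyc_pi y1 u e].
  by rewrite image_set1 theta_pi.
split=> [x Ix|x x' |z].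
- by rewrite img; apply: ideal_gen_image.
- rewrite !inE => Ix Ix' /eqP; rewrite -subr_eq0 -rmorphB => /eqP.
  have : ideal_gen [set cyc_pi y1 u e] (x - x').
    by apply: ideal_genD => //; apply: ideal_genN.
  rewrite -(image_set1 (cyc_pi y1 u)) => /(ideal_gen_lift (@cyc_pi_surj _ _ _ y1 u)).
  move=> [f If xf]; rewrite xf /= theta_pi => /rq_pi_eq0 Pf.
  have f0 : rq_pi X f = 0.
    apply: disj; rewrite -(image_set1 (rq_pi X)); exact: ideal_gen_image.
  apply/eqP; rewrite -subr_eq0 xf; apply/eqP.
  apply: (ideal_gen_sub (kernel_ideal (cyc_pi y1 u)) _ ((rq_pi_eq0 X f).1 f0)).
  by move=> _ [] ->.
- by rewrite img => /(ideal_gen_lift (@theta_surj _ _ _ y1 u d)) [x Ix ->]; exists x.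
Qed.

Lemma convE (T : pzRingType) (x y : T^c) : x * y = (y : T) * (x : T).
Proof. by []. Qed.

(** * The degenerate case *)

(* The relations [dBMW_rel], with indices shifted to start at 0.             *)
Record dbmw (S : comNzRingType) (T : pzRingType) (kap : S -> T) (n : nat)
    (Omega : nat -> S) (s e y : nat -> T) : Prop := Dbmw {
  db_central : forall c x, kap c * x = x * kap c;
  db_ss : forall i, (i.+1 < n)%N -> s i * s i = 1;
  db_ss_far : forall i j, (i.+1 < n)%N -> (j.+1 < n)%N -> far i j ->
    s i * s j = s j * s i;
  db_braid : forall i, (i.+2 < n)%N -> s i * s i.+1 * s i = s i.+1 * s i * s i.+1;
  db_sy : forall i j, (i.+1 < n)%N -> (j < n)%N -> j != i -> j != i.+1 ->
    s i * y j = y j * s i;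
  db_ee : forall i, (i.+1 < n)%N -> e i * e i = kap (Omega 0%N) * e i;
  db_eye : forall k, (0 < k)%N -> (1 < n)%N ->
    e 0 * y 0 ^+ k * e 0 = kap (Omega k) * e 0;
  db_se_far : forall i j, (i.+1 < n)%N -> (j.+1 < n)%N -> far i j ->
    s i * e j = e j * s i;
  db_ee_far : forall i j, (i.+1 < n)%N -> (j.+1 < n)%N -> far i j ->
    e i * e j = e j * e i;
  db_ey : forall i j, (i.+1 < n)%N -> (j < n)%N -> j != i -> j != i.+1 ->
    e i * y j = y j * e i;
  db_yy : forall i j, (i < n)%N -> (j < n)%N -> y i * y j = y j * y i;
  db_es : forall i, (i.+1 < n)%N -> e i * s i = e i;
  db_se : forall i, (i.+1 < n)%N -> s i * e i = e i;
  db_see : forall i, (i.+2 < n)%N -> s i * e i.+1 * e i = s i.+1 * e i;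
  db_ees : forall i, (i.+2 < n)%N -> e i * e i.+1 * s i = e i * s i.+1;
  db_ees' : forall i, (i.+2 < n)%N -> e i.+1 * e i * s i.+1 = e i.+1 * s i;
  db_see' : forall i, (i.+2 < n)%N -> s i.+1 * e i * e i.+1 = s i * e i.+1;
  db_eee : forall i, (i.+2 < n)%N -> e i.+1 * e i * e i.+1 = e i.+1;
  db_eee' : forall i, (i.+2 < n)%N -> e i * e i.+1 * e i = e i;
  db_skein : forall i, (i.+1 < n)%N -> s i * y i - y i.+1 * s i = e i - 1;
  db_skein' : forall i, (i.+1 < n)%N -> y i * s i - s i * y i.+1 = e i - 1;
  db_eyy : forall i, (i.+1 < n)%N -> e i * (y i + y i.+1) = 0;
  db_yye : forall i, (i.+1 < n)%N -> (y i + y i.+1) * e i = 0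
}.

(** The set of relations is stable under reversal of words. The anti-involution is thus replaced by
    a passage to the opposite ring, where left-hand statements become the right-hand ones. *)
Lemma dbmw_conv (S : comNzRingType) (T : pzRingType) (kap : S -> T) n Omega s e y :
  dbmw kap n Omega s e y -> @dbmw S T^c kap n Omega s e y.
Proof.
move=> D; split=> [c x|i lt_i|i j lt_i lt_j fij|i lt_i|i j lt_i lt_j ne ne'|i lt_i
  |k k_gt0 lt_n|i j lt_i lt_j fij|i j lt_i lt_j fij|i j lt_i lt_j ne ne'|i j lt_i lt_j
  |i lt_i|i lt_i|i lt_i|i lt_i|i lt_i|i lt_i|i lt_i|i lt_i|i lt_i|i lt_i|i lt_i|i lt_i];
  rewrite ?revrX ?convE ?mulrA.
- by rewrite (db_central D).
- exact: (db_ss D).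
- by apply/esym/(db_ss_far D).
- exact: (db_braid D).
- by apply/esym/(db_sy D).
- by rewrite (db_ee D) // (db_central D).
- by rewrite (db_eye D) // (db_central D).
- by apply/esym/(db_se_far D).
- by apply/esym/(db_ee_far D).
- by apply/esym/(db_ey D).
- by apply/esym/(db_yy D).
- exact: (db_se D).
- exact: (db_es D).
- exact: (db_ees D).
- exact: (db_see D).
- exact: (db_see' D).
- exact: (db_ees' D).
- exact: (db_eee D).
- exact: (db_eee' D).
- exact: (db_skein' D).
- exact: (db_skein D).
- exact: (db_yye D).
- exact: (db_eyy D).
Qed.

Lemma dbmw_ext (S : comNzRingType) (T : pzRingType) (kap kap' : S -> T) n m Omega
    s e y s' e' y' :
  (m <= n)%N -> dbmw kap n Omega s e y -> (forall c, kap' c = kap c) ->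
  (forall i, (i.+1 < m)%N -> s' i = s i) -> (forall i, (i.+1 < m)%N -> e' i = e i) ->
  (forall i, (i < m)%N -> y' i = y i) -> dbmw kap' m Omega s' e' y'.
Proof.
move=> le_mn D kE sE eE yE; have W i : (i < m)%N -> (i < n)%N by move/leq_trans; apply.
split=> [c x|i lt_i|i j lt_i lt_j fij|i lt_i|i j lt_i lt_j ne ne'|i lt_i
  |k k_gt0 lt_n|i j lt_i lt_j fij|i j lt_i lt_j fij|i j lt_i lt_j ne ne'|i j lt_i lt_j
  |i lt_i|i lt_i|i lt_i|i lt_i|i lt_i|i lt_i|i lt_i|i lt_i|i lt_i|i lt_i|i lt_i|i lt_i];
  rewrite ?kE ?sE ?eE ?yE //; try exact: ltnW.
- exact: (db_central D).
- by rewrite (db_ss D) // W.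
- by rewrite (db_ss_far D) // W.
- by rewrite (db_braid D) // W.
- by rewrite (db_sy D) // W.
- by rewrite (db_ee D) // W.
- by rewrite (db_eye D) // W.
- by rewrite (db_se_far D) // W.
- by rewrite (db_ee_far D) // W.
- by rewrite (db_ey D) // W.
- by rewrite (db_yy D) // W.
- by rewrite (db_es D) // W.
- by rewrite (db_se D) // W.
- by rewrite (db_see D) // W.
- by rewrite (db_ees D) // W.
- by rewrite (db_ees' D) // W.
- by rewrite (db_see' D) // W.
- by rewrite (db_eee D) // W.
- by rewrite (db_eee' D) // W.
- by rewrite (db_skein D) // W.
- by rewrite (db_skein' D) // W.
- by rewrite (db_eyy D) // W.
- by rewrite (db_yye D) // W.
Qed.

(* Stated for an abstract domain, since unification is slow on [free_alg].   *)
Section MorphismShapes.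
Variables (A T : pzRingType) (f : {rmorphism A -> T}).

Lemma mor_sq x : f (x ^+ 2) = f x * f x. Proof. exact: rmorphM. Qed.
Lemma mor_xyx x y k : f (x * y ^+ k * x) = f x * f y ^+ k * f x.
Proof. by rewrite !rmorphM rmorphXn. Qed.
Lemma mor_M3 x y z : f (x * y * z) = f x * f y * f z.
Proof. by rewrite !rmorphM. Qed.
Lemma mor_M4 x y z w : f (x * y * z * w) = f x * f y * f z * f w.
Proof. by rewrite !rmorphM. Qed.
Lemma mor_M5 x y z w v : f (x * y * z * w * v) = f x * f y * f z * f w * f v.
Proof. by rewrite !rmorphM. Qed.
Lemma mor_comm x y z w : f (x * y - z * w) = f x * f y - f z * f w.
Proof. by rewrite rmorphB !rmorphM. Qed.
Lemma mor_B1 x : f (x - 1) = f x - 1.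
Proof. by rewrite rmorphB rmorph1. Qed.
Lemma mor_MD x y z : f (x * (y + z)) = f x * (f y + f z).
Proof. by rewrite rmorphM rmorphD. Qed.
Lemma mor_DM x y z : f ((y + z) * x) = (f y + f z) * f x.
Proof. by rewrite rmorphM rmorphD. Qed.

Lemma mor_tr a b a' b' : f a = a' -> f b = b' -> f a = f b -> a' = b'.
Proof. by move=> <- <-. Qed.

Lemma mor_tr' a b a' b' : f a = a' -> f b = b' -> a' = b' -> f a = f b.
Proof. by move=> -> ->. Qed.

End MorphismShapes.

Lemma dbmw_of_rel (S : comNzRingType) (T : pzRingType) n (Omega : nat -> S)
    (f : {rmorphism free_alg S (dgen n) -> T}) :
  (forall c x, f (c *: 1) * x = x * f (c *: 1)) ->
  (forall x y, dBMW_rel Omega x y -> f x = f y) ->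
  dbmw (fun c => f (c *: 1)) n Omega (fun i => f (ds S n i.+1))
    (fun i => f (de S n i.+1)) (fun i => f (dy S n i.+1)).
Proof.
move=> fC fE; have fZ c x : f (c *: x) = f (c *: 1) * f x.
  by rewrite -rmorphM -scalerAl mul1r.
split=> // [i lt_i|i j lt_i lt_j fij|i lt_i|i j lt_i lt_j ne ne'|i lt_i
  |k k_gt0 lt_n|i j lt_i lt_j fij|i j lt_i lt_j fij|i j lt_i lt_j ne ne'|i j lt_i lt_j
  |i lt_i|i lt_i|i lt_i|i lt_i|i lt_i|i lt_i|i lt_i|i lt_i|i lt_i|i lt_i|i lt_i|i lt_i].
- exact: (mor_tr (mor_sq f _) (rmorph1 f) (fE _ _ (@d_ss S n Omega i.+1 lt_i))).
- exact: (mor_tr (rmorphM f _ _) (rmorphM f _ _)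
    (fE _ _ (@d_ss_far S n Omega i.+1 j.+1 lt_i lt_j fij))).
- exact: (mor_tr (mor_M3 f _ _ _) (mor_M3 f _ _ _) (fE _ _ (@d_braid S n Omega i.+1 isT lt_i))).
- exact: (mor_tr (rmorphM f _ _) (rmorphM f _ _)
    (fE _ _ (@d_sy S n Omega i.+1 j.+1 lt_i lt_j ne ne'))).
- exact: (mor_tr (mor_sq f _) (fZ _ _) (fE _ _ (@d_ee S n Omega i.+1 lt_i))).
- exact: (mor_tr (mor_xyx f _ _ _) (fZ _ _) (fE _ _ (@d_eye S n Omega k k_gt0 lt_n))).
- exact: (mor_tr (rmorphM f _ _) (rmorphM f _ _)
    (fE _ _ (@d_se_far S n Omega i.+1 j.+1 lt_i lt_j fij))).
- exact: (mor_tr (rmorphM f _ _) (rmorphM f _ _)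
    (fE _ _ (@d_ee_far S n Omega i.+1 j.+1 lt_i lt_j fij))).
- exact: (mor_tr (rmorphM f _ _) (rmorphM f _ _)
    (fE _ _ (@d_ey S n Omega i.+1 j.+1 lt_i lt_j ne ne'))).
- exact: (mor_tr (rmorphM f _ _) (rmorphM f _ _) (fE _ _ (@d_yy S n Omega i.+1 j.+1 lt_i lt_j))).
- exact: (mor_tr (rmorphM f _ _) (erefl) (fE _ _ (@d_es S n Omega i.+1 lt_i))).
- exact: (mor_tr (rmorphM f _ _) (erefl) (fE _ _ (@d_se S n Omega i.+1 lt_i))).
- exact: (mor_tr (mor_M3 f _ _ _) (rmorphM f _ _) (fE _ _ (@d_see S n Omega i.+1 isT lt_i))).
- exact: (mor_tr (mor_M3 f _ _ _) (rmorphM f _ _) (fE _ _ (@d_ees S n Omega i.+1 isT lt_i))).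
- exact: (mor_tr (mor_M3 f _ _ _) (rmorphM f _ _) (fE _ _ (@d_ees' S n Omega i.+1 isT lt_i))).
- exact: (mor_tr (mor_M3 f _ _ _) (rmorphM f _ _) (fE _ _ (@d_see' S n Omega i.+1 isT lt_i))).
- exact: (mor_tr (mor_M3 f _ _ _) (erefl) (fE _ _ (@d_eee S n Omega i.+1 isT lt_i))).
- exact: (mor_tr (mor_M3 f _ _ _) (erefl) (fE _ _ (@d_eee' S n Omega i.+1 isT lt_i))).
- exact: (mor_tr (mor_comm f _ _ _ _) (mor_B1 f _) (fE _ _ (@d_skein S n Omega i.+1 lt_i))).
- exact: (mor_tr (mor_comm f _ _ _ _) (mor_B1 f _) (fE _ _ (@d_skein' S n Omega i.+1 lt_i))).
- exact: (mor_tr (mor_MD f _ _ _) (rmorph0 f) (fE _ _ (@d_eyy S n Omega i.+1 lt_i))).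
- exact: (mor_tr (mor_DM f _ _ _) (rmorph0 f) (fE _ _ (@d_yye S n Omega i.+1 lt_i))).
Qed.

Lemma rel_of_dbmw (S : comNzRingType) (T : pzRingType) n (Omega : nat -> S)
    (f : {rmorphism free_alg S (dgen n) -> T}) :
  dbmw (fun c => f (c *: 1)) n Omega (fun i => f (ds S n i.+1))
    (fun i => f (de S n i.+1)) (fun i => f (dy S n i.+1)) ->
  forall x y, dBMW_rel Omega x y -> f x = f y.
Proof.
move=> D; have fZ c x : f (c *: x) = f (c *: 1) * f x.
  by rewrite -rmorphM -scalerAl mul1r.
move=> x y [] {x y}
 => [i lt_i
  |i j lt_i lt_j fij|i i_gt0 lt_i
  |i j lt_i lt_j ne ne'|i lt_i|k k_gt0 lt_n
  |i j lt_i lt_j fij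
  |i j lt_i lt_j fij
  |i j lt_i lt_j ne ne'
  |i j lt_i lt_j|i lt_i|i lt_i|i i_gt0 lt_i|i i_gt0 lt_i|i i_gt0 lt_i
  |i i_gt0 lt_i|i i_gt0 lt_i|i i_gt0 lt_i|i lt_i|i lt_i|i lt_i|i lt_i].
- case: i lt_i => [|i] lt_i; first discriminate lt_i.
  exact: (mor_tr' (mor_sq f _) (rmorph1 f) (db_ss D lt_i)).
- case: i lt_i fij => [|i] lt_i fij; first discriminate lt_i.
  case: j lt_j fij => [|j] lt_j fij; first discriminate lt_j.
  exact: (mor_tr' (rmorphM f _ _) (rmorphM f _ _) (db_ss_far D lt_i lt_j fij)).
- case: i i_gt0 lt_i => [|i] i_gt0 lt_i; first discriminate i_gt0.
  exact: (mor_tr' (mor_M3 f _ _ _) (mor_M3 f _ _ _) (db_braid D lt_i)).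
- case: i lt_i ne ne' => [|i] lt_i ne ne'; first discriminate lt_i.
  case: j lt_j ne ne' => [|j] lt_j ne ne'; first discriminate lt_j.
  exact: (mor_tr' (rmorphM f _ _) (rmorphM f _ _) (db_sy D lt_i lt_j ne ne')).
- case: i lt_i => [|i] lt_i; first discriminate lt_i.
  exact: (mor_tr' (mor_sq f _) (fZ _ _) (db_ee D lt_i)).
- exact: (mor_tr' (mor_xyx f _ _ _) (fZ _ _) (db_eye D k_gt0 lt_n)).
- case: i lt_i fij => [|i] lt_i fij; first discriminate lt_i.
  case: j lt_j fij => [|j] lt_j fij; first discriminate lt_j.
  exact: (mor_tr' (rmorphM f _ _) (rmorphM f _ _) (db_se_far D lt_i lt_j fij)).
- case: i lt_i fij => [|i] lt_i fij; first discriminate lt_i.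
  case: j lt_j fij => [|j] lt_j fij; first discriminate lt_j.
  exact: (mor_tr' (rmorphM f _ _) (rmorphM f _ _) (db_ee_far D lt_i lt_j fij)).
- case: i lt_i ne ne' => [|i] lt_i ne ne'; first discriminate lt_i.
  case: j lt_j ne ne' => [|j] lt_j ne ne'; first discriminate lt_j.
  exact: (mor_tr' (rmorphM f _ _) (rmorphM f _ _) (db_ey D lt_i lt_j ne ne')).
- case: i lt_i => [|i] lt_i; first discriminate lt_i.
  case: j lt_j => [|j] lt_j; first discriminate lt_j.
  exact: (mor_tr' (rmorphM f _ _) (rmorphM f _ _) (db_yy D lt_i lt_j)).
- case: i lt_i => [|i] lt_i; first discriminate lt_i.
  exact: (mor_tr' (rmorphM f _ _) (erefl) (db_es D lt_i)).
- case: i lt_i => [|i] lt_i; first discriminate lt_i.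
  exact: (mor_tr' (rmorphM f _ _) (erefl) (db_se D lt_i)).
- case: i i_gt0 lt_i => [|i] i_gt0 lt_i; first discriminate i_gt0.
  exact: (mor_tr' (mor_M3 f _ _ _) (rmorphM f _ _) (db_see D lt_i)).
- case: i i_gt0 lt_i => [|i] i_gt0 lt_i; first discriminate i_gt0.
  exact: (mor_tr' (mor_M3 f _ _ _) (rmorphM f _ _) (db_ees D lt_i)).
- case: i i_gt0 lt_i => [|i] i_gt0 lt_i; first discriminate i_gt0.
  exact: (mor_tr' (mor_M3 f _ _ _) (rmorphM f _ _) (db_ees' D lt_i)).
- case: i i_gt0 lt_i => [|i] i_gt0 lt_i; first discriminate i_gt0.
  exact: (mor_tr' (mor_M3 f _ _ _) (rmorphM f _ _) (db_see' D lt_i)).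
- case: i i_gt0 lt_i => [|i] i_gt0 lt_i; first discriminate i_gt0.
  exact: (mor_tr' (mor_M3 f _ _ _) (erefl) (db_eee D lt_i)).
- case: i i_gt0 lt_i => [|i] i_gt0 lt_i; first discriminate i_gt0.
  exact: (mor_tr' (mor_M3 f _ _ _) (erefl) (db_eee' D lt_i)).
- case: i lt_i => [|i] lt_i; first discriminate lt_i.
  exact: (mor_tr' (mor_comm f _ _ _ _) (mor_B1 f _) (db_skein D lt_i)).
- case: i lt_i => [|i] lt_i; first discriminate lt_i.
  exact: (mor_tr' (mor_comm f _ _ _ _) (mor_B1 f _) (db_skein' D lt_i)).
- case: i lt_i => [|i] lt_i; first discriminate lt_i.
  exact: (mor_tr' (mor_MD f _ _ _) (rmorph0 f) (db_eyy D lt_i)).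
- case: i lt_i => [|i] lt_i; first discriminate lt_i.
  exact: (mor_tr' (mor_DM f _ _ _) (rmorph0 f) (db_yye D lt_i)).
Qed.

Section CommutingProducts.
Variables (S : comNzRingType) (T : pzRingType) (kap : S -> T) (y : T).
Hypothesis kapC : forall c x, kap c * x = x * kap c.

Lemma factor_comm us x : x * y = y * x ->
  (\prod_(c <- us) (y - kap c)) * x = x * \prod_(c <- us) (y - kap c).
Proof.
move=> xy; apply/esym/commr_prod => c _.
by rewrite /GRing.comm mulrBl mulrBr xy kapC.
Qed.

Lemma conv_factor us :
  \prod_(c <- us) ((y : T^c) - (kap c : T^c)) = (\prod_(c <- us) (y - kap c) : T).
Proof.
elim: us => [|c us IHus]; first by rewrite !big_nil.
rewrite !big_cons convE IHus factor_comm //.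
by rewrite mulrBl mulrBr kapC.
Qed.

End CommutingProducts.

Lemma dfree_lift (S : comNzRingType) (T : pzRingType) (kap : {rmorphism S -> T}) n
    (s e y : nat -> T) :
  (forall c x, kap c * x = x * kap c) ->
  exists f : {rmorphism free_alg S (dgen n) -> T},
  [/\ forall c, f (c *: 1) = kap c,
      forall i, (i.+1 < n)%N -> f (ds S n i.+1) = s i,
      forall i, (i.+1 < n)%N -> f (de S n i.+1) = e i
    & forall i, (i < n)%N -> f (dy S n i.+1) = y i].
Proof.
move=> kapC; pose v (x : dgen n) : T := match x with
  | inl (inl k) => s (val k).-1 | inl (inr k) => e (val k).-1 | inr k => y (val k).-1
  end.
have [f [fc fg]] := free_lift v kapC; exists f; split=> // i lt_i.
- by rewrite /ds insubT /= fg.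
- by rewrite /de insubT /= fg.
- by rewrite /dy insubT /= fg.
Qed.

Lemma dbmw_ind (S : comNzRingType) n (P : free_alg S (dgen n) -> Prop) :
  (forall c, P (c *: 1)) -> (forall i, (i.+1 < n)%N -> P (ds S n i.+1)) ->
  (forall i, (i.+1 < n)%N -> P (de S n i.+1)) ->
  (forall i, (i < n)%N -> P (dy S n i.+1)) ->
  (forall x y, P x -> P y -> P (x + y)) -> (forall x y, P x -> P y -> P (x * y)) ->
  forall x, P x.
Proof.
move=> Pc Ps Pe Py PD PM; apply: free_alg_ind => // -[[]|] [[|i] lt_i].
- by [].
- by have := Ps i lt_i; rewrite /ds insubT.
- by [].
- by have := Pe i lt_i; rewrite /de insubT.
- by [].
- by have := Py i lt_i; rewrite /dy insubT.
Qed.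

(** With e = 0 the relations involving [Omega] read 0 = 0, so any [Omega] is allowed. *)
Lemma hecke_dbmw (S : comNzRingType) (T : pzRingType) (kap : {rmorphism S -> T}) n Omega
    (s y : nat -> T) :
  affine_hecke kap n 1 0 s y -> dbmw kap n Omega s (fun=> 0) y.
Proof.
move=> AH; have k1 : kap 1 = 1 by apply: rmorph1.
have k0 : kap 0 = 0 by apply: rmorph0.
split=> [c x|i lt_i|i j lt_i lt_j fij|i lt_i|i j lt_i lt_j ne ne'|i lt_i
  |k k_gt0 lt_n|i j lt_i lt_j fij|i j lt_i lt_j fij|i j lt_i lt_j ne ne'|i j lt_i lt_j
  |i lt_i|i lt_i|i lt_i|i lt_i|i lt_i|i lt_i|i lt_i|i lt_i|i lt_i|i lt_i|i lt_i|i lt_i];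
  rewrite ?(mulr0, mul0r, sub0r) //.
- exact: (ah_central AH).
- by rewrite (ah_ss AH) // k0 mul0r add0r.
- by case/orP: fij => lt_ij; [apply: (ah_far AH)|apply/esym/(ah_far AH)].
- exact: (ah_braid AH).
- exact: (ah_sy_far AH).
- exact: (ah_yy AH).
- by rewrite (ah_sy AH) // k1 k0 mul0r addr0 addrAC subrr add0r.
- by rewrite (ah_sy' AH) // k1 k0 mul0r addr0 opprD addrA subrr add0r.
Qed.

Section Degenerate.
Variables (S : comNzRingType) (T : pzRingType) (kap : {rmorphism S -> T}).
Variables (n : nat) (Omega : nat -> S) (s e y : nat -> T).
Hypothesis D : dbmw kap n Omega s e y.

Lemma dbmw_braid : braid_rel n s.
Proof.
split=> [i j lt_ij lt_j|]; last exact: (db_braid D).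
by apply: (db_ss_far D) => //; rewrite /far ?lt_ij //; lia.
Qed.

Lemma dbmw_hecke (Q : pzRingType) (phi : {rmorphism T -> Q}) :
  (forall z, exists x, z = phi x) ->
  (forall i, (i.+1 < n)%N -> phi (e i) = 0) ->
  affine_hecke (phi \o kap) n 1 0 (phi \o s) (phi \o y).
Proof.
move=> phi_surj phi_e.
split=> [c z|i lt_i| |i lt_i|i lt_i|i j lt_i lt_j ne ne'|i j lt_i lt_j] /=.
- by have [x ->] := phi_surj z; rewrite -!rmorphM (db_central D).
- by rewrite -rmorphM (db_ss D) // !rmorph0 mul0r add0r rmorph1.
- split=> [i j lt_ij lt_j|i lt_i] /=; rewrite -!rmorphM.
    by rewrite (ah_far dbmw_braid lt_ij).
  by rewrite (ah_braid dbmw_braid).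
- have := congr1 phi (db_skein D lt_i); rewrite !rmorphB !rmorphM phi_e // rmorph1 => /eqP.
  by rewrite sub0r subr_eq !rmorph0 mul0r addr0 !rmorph1 addrC => /eqP.
- have := congr1 phi (db_skein' D lt_i); rewrite !rmorphB !rmorphM phi_e // rmorph1 => /eqP.
  rewrite sub0r subr_eq => /eqP ->.
  by rewrite !rmorph0 mul0r addr0 !rmorph1 addrAC addNr add0r.
- by rewrite -!rmorphM (db_sy D).
- by rewrite -!rmorphM (db_yy D).
Qed.

Hypothesis lt_n : (1 < n)%N.
Hypothesis gen : forall P : T -> Prop,
  (forall c, P (kap c)) -> (forall i, (i.+1 < n)%N -> P (s i)) ->
  (forall i, (i.+1 < n)%N -> P (e i)) -> (forall i, (i < n)%N -> P (y i)) ->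
  (forall x z, P x -> P z -> P (x + z)) -> (forall x z, P x -> P z -> P (x * z)) ->
  forall x, P x.

Variable us : seq S.
Local Notation p := (\prod_(c <- us) (y 0 - kap c)).

Lemma dbmw_p_y i : (i < n)%N -> p * y i = y i * p.
Proof. by move=> lt_i; apply: (factor_comm (db_central D)); apply: (db_yy D) => //; lia. Qed.

Lemma dbmw_p_s i : (0 < i)%N -> (i.+1 < n)%N -> p * s i = s i * p.
Proof.
by move=> i_gt0 lt_i; apply: (factor_comm (db_central D)); apply: (db_sy D) => //; lia.
Qed.

Lemma dbmw_p_e i : (0 < i)%N -> (i.+1 < n)%N -> p * e i = e i * p.
Proof.
by move=> i_gt0 lt_i; apply: (factor_comm (db_central D)); apply: (db_ey D) => //; lia.
Qed.

Lemma dbmw_annihilates : p * e 0 = 0 ->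
  forall x j, (j.+1 < n)%N -> p * x * e j = 0.
Proof.
move=> pe0; have BR := dbmw_braid.
have se i : (i.+1 < n)%N -> exists2 c, central c & s i * e i = c * e i.
  by move=> lt_i; exists 1; [move=> x; rewrite mul1r mulr1|rewrite (db_se D) // mul1r].
have see i : (i.+2 < n)%N -> s i * e i.+1 = s i.+1 * (e i * e i.+1).
  by move=> lt_i; rewrite mulrA (db_see' D).
have rr_s i k : (i.+2 < n)%N -> (k < i)%N -> s i.+1 * s k = s k * s i.+1.
  by move=> lt_i lt_k; apply: (db_ss_far D); rewrite /far; lia.
have rr_p i : (i.+2 < n)%N -> p * s i.+1 = s i.+1 * p by move=> lt_i; apply: dbmw_p_s.
have sse i : (i.+2 < n)%N -> s i * s i.+1 * e i = e i.+1 * e i.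
  move=> lt_i; rewrite -mulrA -(db_see D) // !mulrA (db_ss D) ?mul1r //; lia.
have ss i : (i.+1 < n)%N -> exists c c',
    [/\ central c, central c' & s i * s i = c * s i + 1 + c' * e i].
  move=> lt_i; exists 0, 0; rewrite (db_ss D) // !mul0r add0r addr0.
  by split=> // x; rewrite mul0r mulr0.
have hull_s := hull_s (rr := fun i => s i.+1) BR (db_se_far D) (db_eee D) see rr_s rr_p
  se sse ss dbmw_p_s dbmw_p_e pe0.
have hull_e := hull_e (rr := fun i => s i.+1) (db_se_far D) (db_eee D) see rr_s rr_p
  se sse dbmw_p_e pe0.
have p_ts_e := p_ts_e (rr := fun i => s i.+1) (db_se_far D) (db_eee D) see rr_s rr_p
  se sse dbmw_p_e pe0.
(* The skein relations move a variable past the last letter of the coset word; the resulting e-terms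
   vanish by [p_ts_e], and the others are shorter. *)
have hull_y i k : (i < n)%N -> (k < n)%N -> right_hull n s p (p * ts s i * y k).
  elim: i k => [|i IHi] k lt_i lt_k.
    rewrite mulr1 dbmw_p_y //; apply: hullM.
    by have := hull_p_ts s p lt_i; rewrite mulr1.
  have lt_i' := ltnW lt_i; have hpt : right_hull n s p (p * ts s i) by apply: hull_p_ts.
  rewrite /= mulrA -(mulrA _ (s i)).
  have [->|ne_ki] := eqVneq k i.
    have -> : s i * y i = y i.+1 * s i + e i - 1.
      by rewrite -addrA -(db_skein D lt_i) addrC subrK.
    rewrite mulrBr mulr1 mulrDr mulrA p_ts_e // addr0.
    by apply: hullD; [apply: hull_s => //; apply: IHi|apply: hullN].
  have [->|ne_ki'] := eqVneq k i.+1.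
    have -> : s i * y i.+1 = y i * s i - e i + 1.
      by rewrite -addrA [- _ + 1]addrC -opprB -(db_skein' D lt_i) opprB addrC subrK.
    rewrite mulrDr mulr1 mulrBr mulrA p_ts_e // subr0.
    by apply: hullD => //; apply: hull_s => //; apply: IHi.
  by rewrite (db_sy D) // mulrA; apply: hull_s => //; apply: IHi.
apply: (annihilates (rr := fun i => s i.+1) (db_se_far D) (db_eee D) see rr_s rr_p
  se sse dbmw_p_e pe0).
apply: gen => [c|k lt_k|k lt_k|k lt_k|x z IHx IHz|x z IHx IHz] u Uu.
- by rewrite -(db_central D); apply: hullM.
- exact: hull_s.
- by rewrite hull_e //; apply: hull0.
- by move: u Uu; apply: hull_mulr => i lt_i; apply: hull_y.
- by rewrite mulrDr; apply: hullD; [apply: IHx|apply: IHz].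
- by rewrite mulrA; apply/IHz/IHx.
Qed.
End Degenerate.

Lemma conv_scalars (S : comNzRingType) (T : pzRingType) (kap : {rmorphism S -> T}) :
  exists kapc : {rmorphism S -> T^c}, forall c, kapc c = kap c.
Proof.
pose g : S -> T^c := kap.
have gN : nmod_morphism g by split; [exact: (rmorph0 kap)|exact: (rmorphD kap)].
have gM : monoid_morphism g.
  by split=> [|c c']; [exact: (rmorph1 kap)|rewrite mulrC; exact: (rmorphM kap c' c)].
pose gR : {rmorphism S -> T^c} := HB.pack g
  (GRing.isNmodMorphism.Build _ _ g gN) (GRing.isMonoidMorphism.Build _ _ g gM).
by exists gR.
Qed.

Lemma dbmw_disjoint (S : idomainType) (T : pzRingType) (kap : {rmorphism S -> T})
    (n' : nat) (Omega : nat -> S) (s e y : nat -> T) (us : seq S) :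
  let n := n'.+2 in
  let p := \prod_(c <- us) (y 0 - kap c) in
  dbmw kap n Omega s e y -> (0 < size us)%N ->
  (forall P : T -> Prop,
    (forall c, P (kap c)) -> (forall i, (i.+1 < n)%N -> P (s i)) ->
    (forall i, (i.+1 < n)%N -> P (e i)) -> (forall i, (i < n)%N -> P (y i)) ->
    (forall x z, P x -> P z -> P (x + z)) -> (forall x z, P x -> P z -> P (x * z)) ->
    forall x, P x) ->
  p * e 0 = 0 -> e 0 * p = 0 ->
  (forall (E : nzRingType) (kapE : {rmorphism S -> E}) (sE yE : nat -> E),
     dbmw kapE n Omega sE (fun=> 0) yE ->
     exists rho : {rmorphism T -> E},
     [/\ forall c, rho (kap c) = kapE c,
         forall i, (i.+1 < n)%N -> rho (s i) = sE i,
         forall i, (i.+1 < n)%N -> rho (e i) = 0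
       & forall i, (i < n)%N -> rho (y i) = yE i]) ->
  forall z, ideal_gen [set p] z -> ideal_gen [set e n'] z -> z = 0.
Proof.
move=> n p D us_gt0 gen pe0 ep0 lift.
(* By e_i = e_i e_{i+1} e_i, all the e_i lie in the ideal of the last one. *)
have e_last i : (i.+1 < n)%N -> ideal_gen [set e n'] (e i).
  move=> lt_i; have [k ik] : exists k, (i + k)%N = n' by exists (n' - i)%N; lia.
  elim: k i lt_i ik => [|k IHk] i lt_i ik.
    by apply: ideal_gen_incl; rewrite -ik addn0.
  have lt_i' : (i.+2 < n)%N by rewrite /n; lia.
  rewrite -(db_eee' D lt_i').
  by apply: ideal_genMr; apply: ideal_genMl; apply: IHk => //; lia.
(* The annihilation statement for p on the left, applied in the opposite ring. *)
have ep x i : (i.+1 < n)%N -> e i * x * p = 0.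
  have [kapc kapcE] := conv_scalars kap; move=> lt_i.
  have Dc : dbmw kapc n Omega (s : nat -> T^c) e y.
    by apply: (dbmw_ext (leqnn n) (dbmw_conv D)).
  have pE : \prod_(c <- us) ((y 0 : T^c) - kapc c) = p.
    rewrite /p -(conv_factor _ (db_central D)).
    by apply: eq_bigr => c _; rewrite kapcE.
  have := @dbmw_annihilates S T^c kapc n Omega s e y Dc _ _ us _ x i lt_i.
  rewrite pE !convE mulrA; apply=> //.
  move=> P Pk Ps Pe Py PD PM x'; apply: (gen P) => //; first by move=> c; rewrite -kapcE.
  by move=> u v Pu Pv; apply: (PM v u).
(* Here (a, b) = (1, 0), the root g of the quadratic relation is 1, and [Y] = 1 since no inverses
   occur. *)
apply: (@ideals_disjoint S T kap n' 1 0 1 s e y us 1) => //.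
- by rewrite mul0r add0r mulr1.
- exact: (db_central D).
- by move=> Q phi; apply: (dbmw_hecke D).
- by move=> x i; apply: (dbmw_annihilates D).
- by move=> i; apply: (dbmw_p_y D).
- by move=> i; apply: (dbmw_p_s D).
- by move=> E kapE sE yE _ /(hecke_dbmw Omega) DE _; apply: lift.
- by rewrite mulr1 mul1r.
- by move=> x; rewrite mul1r.
move=> Q phi phi_surj phi_e; have AH := dbmw_hecke D phi_surj phi_e.
have pbw1 : pbw_span (phi \o kap) (phi \o s) (phi \o y) (@full n) n 1.
  by apply/pbw_W/inW1.
split=> [z||z]; rewrite ?rmorph1 ?mulr1 ?mul1r //; exists 0%N; rewrite expr0 mul1r.
have [x ->] := phi_surj z; move: x {z}.
apply: gen => [c|i lt_i|i lt_i|i lt_i|x z Xx Xz|x z Xx Xz].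
- by apply/pbw_W/inW_kap.
- by apply/pbw_W/inWs.
- by rewrite phi_e //; apply: pbw0.
- by rewrite -[phi _]mulr1; apply: (pbw_yM AH).
- by rewrite rmorphD; apply: pbwD.
- by rewrite rmorphM; apply: (pbw_M AH).
Qed.

Section Presented.
Variables (S : comNzRingType) (I : choiceType).
Variable E : free_alg S I -> free_alg S I -> Prop.

Definition scal (T : pzRingType) (f : {rmorphism free_alg S I -> T}) : {rmorphism S -> T} :=
  f \o in_alg (free_alg S I).

Lemma scal_central (T : pzRingType) (f : {rmorphism free_alg S I -> T}) :
  (forall z, exists x, z = f x) -> forall c x, scal f c * x = x * scal f c.
Proof.
move=> f_surj c x; have [a ->] := f_surj x; rewrite /= -!rmorphM; congr (f _).
have := free_scalerAr c a 1; rewrite mulr1 => <-.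
by rewrite -scalerAl mul1r.
Qed.

Lemma cyc_poly_map (T : pzRingType) (f : {rmorphism palg E -> T})
    (g : {rmorphism free_alg S I -> T}) (w : free_alg S I) us :
  (forall a, f (palg_pi E a) = g a) ->
  f (cyc_poly (palg_pi E w) us) = \prod_(c <- us) (g w - scal g c).
Proof.
move=> fg; rewrite rmorph_prod; apply: eq_bigr => c _.
by rewrite rmorphB fg /= -(fg c%:A) [palg_pi E _]linearZ rmorph1.
Qed.

End Presented.

Lemma cyc_polyE (S : comNzRingType) (I : choiceType)
    (E : free_alg S I -> free_alg S I -> Prop) (w : palg E) u v :
  \prod_(c <- v) (cyc_pi w u w - c *: (1 : cyc_alg w u)) = cyc_pi w u (cyc_poly w v).
Proof.
rewrite rmorph_prod; apply: eq_bigr => c _.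
rewrite rmorphB; congr (_ - _).
by rewrite [RHS]linearZ rmorph1.
Qed.

(** The first generators of [T] satisfy the relations on two strands, so the cyclotomic algebra with
    [n = 2] maps to [T] and the vanishing assumed there holds in [T]. *)
Lemma dbmw_transfer (S : comNzRingType) (T : pzRingType) (kap : {rmorphism S -> T}) n Omega
    (s e y : nat -> T) (u v : seq S) :
  (1 < n)%N -> dbmw kap n Omega s e y -> \prod_(c <- u) (y 0 - kap c) = 0 ->
  (\prod_(c <- v) (dY 2 Omega u 1 - c *: (1 : cyc_dBMW 2 Omega u))) * dE 2 Omega u 1 = 0 ->
  \prod_(c <- v) (y 0 - kap c) * e 0 = 0.
Proof.
move=> n_gt1 D u0; have [f [fk fs fe fy]] := dfree_lift 2 s e y (db_central D).
have frel := rel_of_dbmw (dbmw_ext n_gt1 D fk fs fe fy).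
have [g gE] := palg_lift frel.
have g_poly us : g (cyc_poly (affine_dy1 2 Omega) us) = \prod_(c <- us) (y 0 - kap c).
  rewrite (cyc_poly_map (g := f)) //; apply: eq_bigr => c _.
  by rewrite fy //= fk.
have [h hE] : exists h : {rmorphism cyc_dBMW 2 Omega u -> T},
    forall a, h (cyc_pi (affine_dy1 2 Omega) u a) = g a.
  by apply: rq_lift => _ ->; rewrite g_poly.
rewrite cyc_polyE => /(congr1 h); rewrite rmorphM rmorph0 !hE g_poly gE.
by rewrite fe.
Qed.

Lemma dBMW_bij (S : idomainType) n' (Omega : nat -> S) (u : seq S) (d : nat) :
  let n := n'.+2 in (0 < size (take d u))%N ->
  (\prod_(c <- take d u) (dY 2 Omega u 1 - c *: (1 : cyc_dBMW 2 Omega u))) * dE 2 Omega u 1 = 0 ->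
  set_bij (ideal_gen [set dE n Omega u n'.+1]) (ideal_gen [set dE n Omega (take d u) n'.+1])
    (theta (affine_dy1 n Omega) u d).
Proof.
move=> n us_gt0 pe0; set us := take d u in us_gt0 pe0 *.
pose R := palg (@dBMW_rel S n Omega); pose y1 : R := affine_dy1 n Omega.
pose e1 : R := palg_pi _ (de S n 1).
have D (T : pzRingType) (h : {rmorphism R -> T}) : (forall z, exists x, z = h x) ->
    let f : {rmorphism free_alg S (dgen n) -> T} := h \o palg_pi (@dBMW_rel S n Omega) in
    (forall z, exists x, z = f x) /\
    dbmw (scal f) n Omega (fun i => f (ds S n i.+1)) (fun i => f (de S n i.+1))
      (fun i => f (dy S n i.+1)).
  move=> h_surj f; have f_surj z : exists x, z = f x.
    by have [a ->] := h_surj z; have [b ->] := palg_pi_surj a; exists b.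
  split=> //; apply: dbmw_of_rel => [|x z /palg_pi_rel xz]; first exact: scal_central.
  by rewrite /f /= xz.
have h_poly (T : pzRingType) (h : {rmorphism R -> T}) (f := h \o palg_pi (@dBMW_rel S n Omega)) vs :
    h (cyc_poly y1 vs) = \prod_(c <- vs) (f (dy S n 1) - scal f c).
  exact: cyc_poly_map.
apply: (@theta_bij _ _ _ _ e1).
- have [_ Dc] := D _ (cyc_pi y1 u) (@cyc_pi_surj _ _ _ y1 u).
  rewrite rmorphM h_poly; apply: (dbmw_transfer _ Dc _ pe0) => //.
  by rewrite -h_poly; apply: cyc_pi_poly.
(* For e_1 p = 0, map the two-strand algebra to the opposite of the cyclotomic algebra on n
   strands. *)
- have [f_surj Dc] := D _ (cyc_pi y1 u) (@cyc_pi_surj _ _ _ y1 u).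
  set f := (f in scal f) in Dc f_surj; have [kapc kapcE] := conv_scalars (scal f).
  have Dcc := dbmw_ext (leqnn n) (dbmw_conv Dc) kapcE (fun _ _ => erefl)
    (fun _ _ => erefl) (fun _ _ => erefl).
  have prodE vs : \prod_(c <- vs) ((f (dy S n 1) : (cyc_dBMW n Omega u)^c) - kapc c)
      = cyc_pi y1 u (cyc_poly y1 vs).
    rewrite h_poly -(conv_factor _ (db_central Dc)).
    by apply: eq_bigr => c _; rewrite kapcE.
  rewrite rmorphM; have := dbmw_transfer _ Dcc _ pe0; rewrite !prodE convE; apply=> //.
  exact: cyc_pi_poly.
set p := cyc_poly y1 us; set X := [set z | _].
have [f_surj DT] := D _ (rq_pi X) (@rq_pi_surj _ X).
rewrite h_poly; set f := (f in scal f) in DT f_surj *.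
apply: (dbmw_disjoint DT) => //.
- move=> P Pk Ps Pe Py PD PM x; have [a ->] := f_surj x; move: a {x}.
  by apply: dbmw_ind => // [a b|a b]; rewrite ?rmorphD ?rmorphM; [apply: PD|apply: PM].
- rewrite -h_poly -[f (de S n 1)]/(rq_pi X e1) -rmorphM; apply/rq_pi_eq0.
  by apply: ideal_gen_incl; left.
- rewrite -h_poly -[f (de S n 1)]/(rq_pi X e1) -rmorphM; apply/rq_pi_eq0.
  by apply: ideal_gen_incl; right.
(* A representation with e = 0 kills p e_1 and e_1 p, so it descends to the quotient by [X]. *)
move=> T kapT sT yT DE; have [g [gk gs ge gy]] := dfree_lift n sT (fun=> 0) yT (db_central DE).
have grel := rel_of_dbmw (dbmw_ext (leqnn n) DE gk gs ge gy).
have [h hE] := palg_lift grel.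
have he1 : h e1 = 0 by rewrite hE ge.
have [rho rhoE] : exists r : {rmorphism ring_quot X -> T}, forall a, r (rq_pi X a) = h a.
  by apply: rq_lift => _ [] ->; rewrite rmorphM he1 ?mulr0 ?mul0r.
by exists rho; split=> [c|i lt_i|i lt_i|i lt_i]; rewrite /f /= rhoE hE ?gk ?gs ?ge ?gy.
Qed.

(** * The non-degenerate case *)

(* The relations [cBMW_rel], with indices shifted to start at 0, except that *)
(* [y] stands for y_1.                                                       *)
Record cbmw (S : comUnitRingType) (T : pzRingType) (kap : S -> T) (n : nat) (rho q : S)
    (Omega : nat -> S) (g gV e : nat -> T) (y yV : T) : Prop := Cbmw {
  cb_central : forall c x, kap c * x = x * kap c;
  cb_ggV : forall i, (i.+1 < n)%N -> g i * gV i = 1;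
  cb_gVg : forall i, (i.+1 < n)%N -> gV i * g i = 1;
  cb_yyV : y * yV = 1;
  cb_yVy : yV * y = 1;
  cb_braid : forall i, (i.+2 < n)%N -> g i * g i.+1 * g i = g i.+1 * g i * g i.+1;
  cb_gg_far : forall i j, (i.+1 < n)%N -> (j.+1 < n)%N -> far i j ->
    g i * g j = g j * g i;
  cb_ygyg : (1 < n)%N -> y * g 0 * y * g 0 = g 0 * y * g 0 * y;
  cb_yg : forall j, (0 < j)%N -> (j.+1 < n)%N -> y * g j = g j * y;
  cb_ee : forall i, (i.+1 < n)%N -> e i * e i = kap (Omega 0%N) * e i;
  cb_eye : forall k, (0 < k)%N -> (1 < n)%N -> e 0 * y ^+ k * e 0 = kap (Omega k) * e 0;
  cb_ge_far : forall i j, (i.+1 < n)%N -> (j.+1 < n)%N -> far i j ->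
    g i * e j = e j * g i;
  cb_ee_far : forall i j, (i.+1 < n)%N -> (j.+1 < n)%N -> far i j ->
    e i * e j = e j * e i;
  cb_ye : forall j, (0 < j)%N -> (j.+1 < n)%N -> y * e j = e j * y;
  cb_ge : forall i, (i.+1 < n)%N -> g i * e i = kap rho^-1 * e i;
  cb_eg : forall i, (i.+1 < n)%N -> e i * g i = kap rho^-1 * e i;
  cb_ege : forall i j, (i.+1 < n)%N -> (j.+1 < n)%N -> adj i j ->
    e i * g j * e i = kap rho * e i;
  cb_eee : forall i j, (i.+1 < n)%N -> (j.+1 < n)%N -> adj i j ->
    e i * e j * e i = e i;
  cb_gge : forall i j, (i.+1 < n)%N -> (j.+1 < n)%N -> adj i j ->
    g i * g j * e i = e j * e i;
  cb_egg : forall i j, (i.+1 < n)%N -> (j.+1 < n)%N -> adj i j ->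
    e i * g j * g i = e i * e j;
  cb_skein : forall i, (i.+1 < n)%N -> g i - gV i = kap (q - q^-1) * (1 - e i);
  cb_eygyg : (1 < n)%N -> e 0 * y * g 0 * y * g 0 = e 0;
  cb_gygye : (1 < n)%N -> g 0 * y * g 0 * y * e 0 = e 0
}.

Lemma cbmw_conv (S : comUnitRingType) (T : pzRingType) (kap : S -> T) n rho q Omega
    g gV e y yV :
  cbmw kap n rho q Omega g gV e y yV -> @cbmw S T^c kap n rho q Omega g gV e y yV.
Proof.
move=> D; split=> [c x|i lt_i|i lt_i|||i lt_i|i j lt_i lt_j fij|lt_n|j j_gt0 lt_j|i lt_i
  |k k_gt0 lt_n|i j lt_i lt_j fij|i j lt_i lt_j fij|j j_gt0 lt_j|i lt_i|i lt_i
  |i j lt_i lt_j aij|i j lt_i lt_j aij|i j lt_i lt_j aij|i j lt_i lt_j aij|i lt_i|lt_n|lt_n];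
  rewrite ?revrX ?convE ?mulrA.
- by rewrite (cb_central D).
- exact: (cb_gVg D).
- exact: (cb_ggV D).
- exact: (cb_yVy D).
- exact: (cb_yyV D).
- exact: (cb_braid D).
- by apply/esym/(cb_gg_far D).
- by apply/esym/(cb_ygyg D).
- by apply/esym/(cb_yg D).
- by rewrite (cb_ee D) // (cb_central D).
- by rewrite (cb_eye D) // (cb_central D).
- by apply/esym/(cb_ge_far D).
- by apply/esym/(cb_ee_far D).
- by apply/esym/(cb_ye D).
- by rewrite (cb_eg D) // (cb_central D).
- by rewrite (cb_ge D) // (cb_central D).
- by rewrite (cb_ege D) // (cb_central D).
- exact: (cb_eee D).
- exact: (cb_egg D).
- exact: (cb_gge D).
- by rewrite -(cb_central D); apply: (cb_skein D).
- exact: (cb_gygye D).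
- exact: (cb_eygyg D).
Qed.

Lemma cbmw_ext (S : comUnitRingType) (T : pzRingType) (kap kap' : S -> T) n m rho q Omega
    g gV e y yV g' gV' e' y' yV' :
  (m <= n)%N -> cbmw kap n rho q Omega g gV e y yV -> (forall c, kap' c = kap c) ->
  (forall i, (i.+1 < m)%N -> g' i = g i) -> (forall i, (i.+1 < m)%N -> gV' i = gV i) ->
  (forall i, (i.+1 < m)%N -> e' i = e i) -> y' = y -> yV' = yV ->
  cbmw kap' m rho q Omega g' gV' e' y' yV'.
Proof.
move=> le_mn D kE gE gVE eE -> ->; have W i : (i < m)%N -> (i < n)%N by move/leq_trans; apply.
split=> [c x|i lt_i|i lt_i|||i lt_i|i j lt_i lt_j fij|lt_n|j j_gt0 lt_j|i lt_i
  |k k_gt0 lt_n|i j lt_i lt_j fij|i j lt_i lt_j fij|j j_gt0 lt_j|i lt_i|i lt_i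
  |i j lt_i lt_j aij|i j lt_i lt_j aij|i j lt_i lt_j aij|i j lt_i lt_j aij|i lt_i|lt_n|lt_n];
  rewrite ?kE ?gE ?gVE ?eE //; try exact: ltnW.
- exact: (cb_central D).
- by rewrite (cb_ggV D) // W.
- by rewrite (cb_gVg D) // W.
- exact: (cb_yyV D).
- exact: (cb_yVy D).
- by rewrite (cb_braid D) // W.
- by rewrite (cb_gg_far D) // W.
- by rewrite (cb_ygyg D) // W.
- by rewrite (cb_yg D) // W.
- by rewrite (cb_ee D) // W.
- by rewrite (cb_eye D) // W.
- by rewrite (cb_ge_far D) // W.
- by rewrite (cb_ee_far D) // W.
- by rewrite (cb_ye D) // W.
- by rewrite (cb_ge D) // W.
- by rewrite (cb_eg D) // W.
- by rewrite (cb_ege D) // W.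
- by rewrite (cb_eee D) // W.
- by rewrite (cb_gge D) // W.
- by rewrite (cb_egg D) // W.
- by rewrite (cb_skein D) // W.
- by rewrite (cb_eygyg D) // W.
- by rewrite (cb_gygye D) // W.
Qed.

Lemma cbmw_of_rel (S : comUnitRingType) (T : pzRingType) n (rho q : S) (Omega : nat -> S)
    (f : {rmorphism free_alg S (cgen n) -> T}) :
  (forall c x, f (c *: 1) * x = x * f (c *: 1)) ->
  (forall x y, cBMW_rel rho q Omega x y -> f x = f y) ->
  cbmw (fun c => f (c *: 1)) n rho q Omega (fun i => f (cg S n i.+1))
    (fun i => f (cgV S n i.+1)) (fun i => f (ce S n i.+1)) (f (cy S n)) (f (cyV S n)).
Proof.
move=> fC fE; have fZ c x : f (c *: x) = f (c *: 1) * f x.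
  by rewrite -rmorphM -scalerAl mul1r.
have fZB c x : f (c *: (1 - x)) = f (c *: 1) * (1 - f x).
  by rewrite fZ rmorphB rmorph1.
split=> // [i lt_i|i lt_i|||i lt_i|i j lt_i lt_j fij|lt_n|j j_gt0 lt_j|i lt_i
  |k k_gt0 lt_n|i j lt_i lt_j fij|i j lt_i lt_j fij|j j_gt0 lt_j|i lt_i|i lt_i
  |i j lt_i lt_j aij|i j lt_i lt_j aij|i j lt_i lt_j aij|i j lt_i lt_j aij|i lt_i|lt_n|lt_n].
- exact: (mor_tr (rmorphM f _ _) (rmorph1 f) (fE _ _ (@c_ggV S n rho q Omega i.+1 lt_i))).
- exact: (mor_tr (rmorphM f _ _) (rmorph1 f) (fE _ _ (@c_gVg S n rho q Omega i.+1 lt_i))).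
- exact: (mor_tr (rmorphM f _ _) (rmorph1 f) (fE _ _ (@c_yyV S n rho q Omega))).
- exact: (mor_tr (rmorphM f _ _) (rmorph1 f) (fE _ _ (@c_yVy S n rho q Omega))).
- exact: (mor_tr (mor_M3 f _ _ _) (mor_M3 f _ _ _)
    (fE _ _ (@c_braid S n rho q Omega i.+1 isT lt_i))).
- exact: (mor_tr (rmorphM f _ _) (rmorphM f _ _)
    (fE _ _ (@c_gg_far S n rho q Omega i.+1 j.+1 lt_i lt_j fij))).
- exact: (mor_tr (mor_M4 f _ _ _ _) (mor_M4 f _ _ _ _) (fE _ _ (@c_ygyg S n rho q Omega lt_n))).
- have lt_j' : (1 < j.+1 < n)%N by rewrite ltnS j_gt0.
  exact: (mor_tr (rmorphM f _ _) (rmorphM f _ _) (fE _ _ (@c_yg S n rho q Omega j.+1 lt_j'))).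
- exact: (mor_tr (mor_sq f _) (fZ _ _) (fE _ _ (@c_ee S n rho q Omega i.+1 lt_i))).
- exact: (mor_tr (mor_xyx f _ _ _) (fZ _ _) (fE _ _ (@c_eye S n rho q Omega k k_gt0 lt_n))).
- exact: (mor_tr (rmorphM f _ _) (rmorphM f _ _)
    (fE _ _ (@c_ge_far S n rho q Omega i.+1 j.+1 lt_i lt_j fij))).
- exact: (mor_tr (rmorphM f _ _) (rmorphM f _ _)
    (fE _ _ (@c_ee_far S n rho q Omega i.+1 j.+1 lt_i lt_j fij))).
- have lt_j' : (1 < j.+1 < n)%N by rewrite ltnS j_gt0.
  exact: (mor_tr (rmorphM f _ _) (rmorphM f _ _) (fE _ _ (@c_ye S n rho q Omega j.+1 lt_j'))).
- exact: (mor_tr (rmorphM f _ _) (fZ _ _) (fE _ _ (@c_ge S n rho q Omega i.+1 lt_i))).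
- exact: (mor_tr (rmorphM f _ _) (fZ _ _) (fE _ _ (@c_eg S n rho q Omega i.+1 lt_i))).
- exact: (mor_tr (mor_M3 f _ _ _) (fZ _ _)
    (fE _ _ (@c_ege S n rho q Omega i.+1 j.+1 lt_i lt_j aij))).
- exact: (mor_tr (mor_M3 f _ _ _) (erefl)
    (fE _ _ (@c_eee S n rho q Omega i.+1 j.+1 lt_i lt_j aij))).
- exact: (mor_tr (mor_M3 f _ _ _) (rmorphM f _ _)
    (fE _ _ (@c_gge S n rho q Omega i.+1 j.+1 lt_i lt_j aij))).
- exact: (mor_tr (mor_M3 f _ _ _) (rmorphM f _ _)
    (fE _ _ (@c_egg S n rho q Omega i.+1 j.+1 lt_i lt_j aij))).
- exact: (mor_tr (rmorphB f _ _) (fZB _ _) (fE _ _ (@c_skein S n rho q Omega i.+1 lt_i))).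
- exact: (mor_tr (mor_M5 f _ _ _ _ _) (erefl) (fE _ _ (@c_eygyg S n rho q Omega lt_n))).
- exact: (mor_tr (mor_M5 f _ _ _ _ _) (erefl) (fE _ _ (@c_gygye S n rho q Omega lt_n))).
Qed.

Lemma rel_of_cbmw (S : comUnitRingType) (T : pzRingType) n (rho q : S) (Omega : nat -> S)
    (f : {rmorphism free_alg S (cgen n) -> T}) :
  cbmw (fun c => f (c *: 1)) n rho q Omega (fun i => f (cg S n i.+1))
    (fun i => f (cgV S n i.+1)) (fun i => f (ce S n i.+1)) (f (cy S n)) (f (cyV S n)) ->
  forall x y, cBMW_rel rho q Omega x y -> f x = f y.
Proof.
move=> D; have fZ c x : f (c *: x) = f (c *: 1) * f x.
  by rewrite -rmorphM -scalerAl mul1r.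
have fZB c x : f (c *: (1 - x)) = f (c *: 1) * (1 - f x).
  by rewrite fZ rmorphB rmorph1.
move=> x y [] {x y}
 => [i lt_i|i lt_i|||i i_gt0 lt_i|i j lt_i lt_j fij|lt_n|j lt_j|i lt_i
  |k k_gt0 lt_n|i j lt_i lt_j fij|i j lt_i lt_j fij|j lt_j|i lt_i|i lt_i
  |i j lt_i lt_j aij|i j lt_i lt_j aij|i j lt_i lt_j aij|i j lt_i lt_j aij|i lt_i|lt_n|lt_n].
- case: i lt_i => [|i] lt_i; first discriminate lt_i.
  exact: (mor_tr' (rmorphM f _ _) (rmorph1 f) (cb_ggV D lt_i)).
- case: i lt_i => [|i] lt_i; first discriminate lt_i.
  exact: (mor_tr' (rmorphM f _ _) (rmorph1 f) (cb_gVg D lt_i)).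
- exact: (mor_tr' (rmorphM f _ _) (rmorph1 f) (cb_yyV D)).
- exact: (mor_tr' (rmorphM f _ _) (rmorph1 f) (cb_yVy D)).
- case: i i_gt0 lt_i => [|i] i_gt0 lt_i; first discriminate i_gt0.
  exact: (mor_tr' (mor_M3 f _ _ _) (mor_M3 f _ _ _) (cb_braid D lt_i)).
- case: i lt_i fij => [|i] lt_i fij; first discriminate lt_i.
  case: j lt_j fij => [|j] lt_j fij; first discriminate lt_j.
  exact: (mor_tr' (rmorphM f _ _) (rmorphM f _ _) (cb_gg_far D lt_i lt_j fij)).
- exact: (mor_tr' (mor_M4 f _ _ _ _) (mor_M4 f _ _ _ _) (cb_ygyg D lt_n)).
- case: j lt_j => [|j] lt_j; first discriminate lt_j.
  have /andP[j_gt0 lt_j'] := lt_j.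
  exact: (mor_tr' (rmorphM f _ _) (rmorphM f _ _) (cb_yg D j_gt0 lt_j')).
- case: i lt_i => [|i] lt_i; first discriminate lt_i.
  exact: (mor_tr' (mor_sq f _) (fZ _ _) (cb_ee D lt_i)).
- exact: (mor_tr' (mor_xyx f _ _ _) (fZ _ _) (cb_eye D k_gt0 lt_n)).
- case: i lt_i fij => [|i] lt_i fij; first discriminate lt_i.
  case: j lt_j fij => [|j] lt_j fij; first discriminate lt_j.
  exact: (mor_tr' (rmorphM f _ _) (rmorphM f _ _) (cb_ge_far D lt_i lt_j fij)).
- case: i lt_i fij => [|i] lt_i fij; first discriminate lt_i.
  case: j lt_j fij => [|j] lt_j fij; first discriminate lt_j.
  exact: (mor_tr' (rmorphM f _ _) (rmorphM f _ _) (cb_ee_far D lt_i lt_j fij)).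
- case: j lt_j => [|j] lt_j; first discriminate lt_j.
  have /andP[j_gt0 lt_j'] := lt_j.
  exact: (mor_tr' (rmorphM f _ _) (rmorphM f _ _) (cb_ye D j_gt0 lt_j')).
- case: i lt_i => [|i] lt_i; first discriminate lt_i.
  exact: (mor_tr' (rmorphM f _ _) (fZ _ _) (cb_ge D lt_i)).
- case: i lt_i => [|i] lt_i; first discriminate lt_i.
  exact: (mor_tr' (rmorphM f _ _) (fZ _ _) (cb_eg D lt_i)).
- case: i lt_i aij => [|i] lt_i aij; first discriminate lt_i.
  case: j lt_j aij => [|j] lt_j aij; first discriminate lt_j.
  exact: (mor_tr' (mor_M3 f _ _ _) (fZ _ _) (cb_ege D lt_i lt_j aij)).
- case: i lt_i aij => [|i] lt_i aij; first discriminate lt_i.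
  case: j lt_j aij => [|j] lt_j aij; first discriminate lt_j.
  exact: (mor_tr' (mor_M3 f _ _ _) (erefl) (cb_eee D lt_i lt_j aij)).
- case: i lt_i aij => [|i] lt_i aij; first discriminate lt_i.
  case: j lt_j aij => [|j] lt_j aij; first discriminate lt_j.
  exact: (mor_tr' (mor_M3 f _ _ _) (rmorphM f _ _) (cb_gge D lt_i lt_j aij)).
- case: i lt_i aij => [|i] lt_i aij; first discriminate lt_i.
  case: j lt_j aij => [|j] lt_j aij; first discriminate lt_j.
  exact: (mor_tr' (mor_M3 f _ _ _) (rmorphM f _ _) (cb_egg D lt_i lt_j aij)).
- case: i lt_i => [|i] lt_i; first discriminate lt_i.
  exact: (mor_tr' (rmorphB f _ _) (fZB _ _) (cb_skein D lt_i)).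
- exact: (mor_tr' (mor_M5 f _ _ _ _ _) (erefl) (cb_eygyg D lt_n)).
- exact: (mor_tr' (mor_M5 f _ _ _ _ _) (erefl) (cb_gygye D lt_n)).
Qed.

Lemma cfree_lift (S : comUnitRingType) (T : pzRingType) (kap : {rmorphism S -> T}) n
    (g gV e : nat -> T) (y yV : T) :
  (forall c x, kap c * x = x * kap c) ->
  exists f : {rmorphism free_alg S (cgen n) -> T},
  [/\ forall c, f (c *: 1) = kap c,
      (forall i, (i.+1 < n)%N -> f (cg S n i.+1) = g i) /\
      (forall i, (i.+1 < n)%N -> f (cgV S n i.+1) = gV i),
      forall i, (i.+1 < n)%N -> f (ce S n i.+1) = e i,
      f (cy S n) = y & f (cyV S n) = yV].
Proof.
move=> kapC; pose v (x : cgen n) : T := match x with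
  | inl (inl b) => if b then y else yV
  | inl (inr (k, b)) => (if b then g else gV) (val k).-1
  | inr k => e (val k).-1
  end.
have [f [fc fg]] := free_lift v kapC; exists f; split=> //.
- split=> i lt_i; first by rewrite /cg insubT /= fg.
  by rewrite /cgV insubT /= fg.
- by move=> i lt_i; rewrite /ce insubT /= fg.
- exact: fg.
- exact: fg.
Qed.

Lemma cbmw_ind (S : comUnitRingType) n (P : free_alg S (cgen n) -> Prop) :
  (forall c, P (c *: 1)) -> (forall i, (i.+1 < n)%N -> P (cg S n i.+1)) ->
  (forall i, (i.+1 < n)%N -> P (cgV S n i.+1)) ->
  (forall i, (i.+1 < n)%N -> P (ce S n i.+1)) ->
  P (cy S n) -> P (cyV S n) ->
  (forall x y, P x -> P y -> P (x + y)) -> (forall x y, P x -> P y -> P (x * y)) ->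
  forall x, P x.
Proof.
move=> Pc Pg PgV Pe Py PyV PD PM.
apply: free_alg_ind => // -[[[] //|[[[|i] lt_i] []]]|[[|i] lt_i]].
- by [].
- by [].
- by have := Pg i lt_i; rewrite /cg insubT.
- by have := PgV i lt_i; rewrite /cgV insubT.
- by [].
- by have := Pe i lt_i; rewrite /ce insubT.
Qed.

(** * Jucys-Murphy elements of the affine BMW algebra *)

Section JucysMurphy.
Variables (T : pzRingType) (n : nat) (g : nat -> T) (y : T).
Hypotheses (BR : braid_rel n g)
  (yg : forall j, (0 < j)%N -> (j.+1 < n)%N -> y * g j = g j * y).

(** The elements y_1, y_2, ...: the presentation contains only the first, and the others are its
    successive conjugates y_{i+1} = g_i y_i g_i. *)
Fixpoint jm (i : nat) : T := if i is j.+1 then g j * jm j * g j else y.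

Lemma jm_lt i j : (j < i)%N -> (i.+1 < n)%N -> g i * jm j = jm j * g i.
Proof.
move=> + lt_i; elim: j => [|j IHj] lt_j /=; first by rewrite yg.
have E : g i * g j = g j * g i by rewrite (ah_far BR lt_j lt_i).
by rewrite !mulrA E -(mulrA (g j)) IHj 1?ltnW // -!mulrA E.
Qed.

Lemma jm_far i j : (i.+1 < n)%N -> (j < n)%N -> j != i -> j != i.+1 ->
  g i * jm j = jm j * g i.
Proof.
move=> lt_i + ne_ji ne_ji'; have [lt_ji|le_ij] := ltnP j i; first by rewrite jm_lt.
have {ne_ji ne_ji' le_ij} : (i.+1 < j)%N by lia.
elim: j => // j IHj le_ij lt_j /=; have [ji|ne_ji] := eqVneq j i.+1.
  rewrite {}ji in lt_j * => /= {IHj le_ij}; have C := ah_braid BR lt_j.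
  rewrite !mulrA C -(mulrA _ (g i.+1) (jm i)) jm_lt // -!mulrA.
  by congr (_ * (_ * (_ * _))); rewrite !mulrA C.
have lt_ij : (i.+1 < j)%N by lia.
have E : g i * g j = g j * g i by rewrite (ah_far BR lt_ij lt_j).
by rewrite !mulrA E -(mulrA (g j)) (IHj lt_ij (ltnW lt_j)) -!mulrA E.
Qed.

Hypothesis ygyg : (1 < n)%N -> y * g 0 * y * g 0 = g 0 * y * g 0 * y.

Lemma jm_y j : (j < n)%N -> y * jm j = jm j * y.
Proof.
elim: j => [//|[|j] IHj] lt_j; first by rewrite /= !mulrA ygyg.
have C : y * g j.+1 = g j.+1 * y by apply: yg.
rewrite [jm j.+2]/(g j.+1 * jm j.+1 * g j.+1).
move: (jm j.+1) (IHj (ltnW lt_j)) => J E.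
by rewrite !mulrA C -!mulrA (mulrA y) E -!mulrA C.
Qed.

Lemma jm_comm i j : (i < n)%N -> (j < n)%N -> jm i * jm j = jm j * jm i.
Proof.
wlog lt_ij : i j / (i < j)%N => [IH|].
  by have [lt_ij|lt_ji|->] := ltngtP i j => // lt_i lt_j; [|apply/esym]; apply: IH.
move=> _ lt_j; elim: i lt_ij => [|i IHi] lt_i /=; first exact: jm_y.
have E : g i * jm j = jm j * g i by apply: jm_far; lia.
by rewrite -mulrA E mulrA -(mulrA (g i)) IHi 1?ltnW // mulrA E -!mulrA.
Qed.

Lemma jm_pair i : g i * (jm i * jm i.+1) = jm i.+1 * jm i * g i.
Proof. by rewrite /= !mulrA. Qed.

Definition jm_prod (k : nat) : T := \prod_(j < k) jm j.

Lemma jm_prodS k : jm_prod k.+1 = jm_prod k * jm k.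
Proof. exact: big_ord_recr. Qed.

Lemma jm_prod_comm k z : (forall j, (j < k)%N -> z * jm j = jm j * z) ->
  z * jm_prod k = jm_prod k * z.
Proof. by move=> zj; apply: commr_prod => j _; apply: zj. Qed.

Lemma jm_prod_y : y * jm_prod n = jm_prod n * y.
Proof. by apply: jm_prod_comm => j; apply: jm_y. Qed.

(** [g i] commutes with the product of the two adjacent elements [jm i] and [jm i.+1] ([jm_pair]),
    and with each of the others separately. *)
Lemma jm_prod_g i : (i.+1 < n)%N -> g i * jm_prod n = jm_prod n * g i.
Proof.
move=> lt_i; have comm k : (i.+2 + k <= n)%N -> g i * jm_prod (i.+2 + k) = jm_prod (i.+2 + k) * g i.
  elim: k => [|k IHk] le_k; last first.
    have le_k' : (i.+2 + k < n)%N by rewrite -addnS.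
    have E : g i * jm (i.+2 + k) = jm (i.+2 + k) * g i by apply: jm_far => //; lia.
    by rewrite addnS jm_prodS mulrA (IHk (ltnW le_k')) -[LHS]mulrA E mulrA.
  have E : g i * jm_prod i = jm_prod i * g i by apply: jm_prod_comm => j lt_j; apply: jm_lt.
  have E' : g i * (jm i * jm i.+1) = jm i * jm i.+1 * g i.
    by rewrite jm_pair jm_comm // ltnW.
  rewrite addn0 2!jm_prodS; move: (jm i) (jm i.+1) (jm_prod i) E E' => J J' P E E'.
  by rewrite -(mulrA P) mulrA E -mulrA E' mulrA.
by have := comm (n - i.+2)%N; rewrite subnKC //; apply.
Qed.

End JucysMurphy.

Lemma comm_inverse (T : pzRingType) (x v z : T) :
  x * v = 1 -> v * x = 1 -> x * z = z * x -> z * v = v * z.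
Proof.
move=> xv vx xz; rewrite -[z * v]mul1r -vx -!mulrA.
by rewrite (mulrA x) xz -!mulrA xv mulr1.
Qed.

Section NonDegenerate.
Variables (S : comUnitRingType) (T : pzRingType) (kap : {rmorphism S -> T}).
Variables (n : nat) (rho q : S) (Omega : nat -> S) (g gV e : nat -> T) (y yV : T).
Hypothesis D : cbmw kap n rho q Omega g gV e y yV.

Local Notation b := (q - q^-1).
Local Notation jm := (jm g y).

Lemma cbmw_braid : braid_rel n g.
Proof.
split=> [i j lt_ij lt_j|]; last exact: (cb_braid D).
by apply: (cb_gg_far D) => //; rewrite /far ?lt_ij //; lia.
Qed.

Lemma cbmw_gV i : (i.+1 < n)%N -> gV i = g i - kap b + kap b * e i.
Proof.
move=> lt_i; have := cb_skein D lt_i; rewrite mulrBr mulr1 => /eqP.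
by rewrite subr_eq addrC -subr_eq => /eqP <-; rewrite opprB addrA addrAC.
Qed.

Lemma cbmw_gg i : (i.+1 < n)%N ->
  g i * g i = kap b * g i + 1 + - kap (b * rho^-1) * e i.
Proof.
move=> lt_i; have := cb_ggV D lt_i; rewrite cbmw_gV // mulrDr mulrBr.
rewrite mulrA -!(cb_central D) -mulrA (cb_ge D) // mulrA -rmorphM => /eqP.
by rewrite -addrA -subr_eq0 addrAC => /eqP E; apply/eqP; rewrite -subr_eq0 -[X in _ == X]E mulNr
  !opprD !opprK !addrA; apply/eqP; congr (_ + _); rewrite addrAC.
Qed.

Lemma cbmw_hecke (Q : pzRingType) (phi : {rmorphism T -> Q}) : (1 < n)%N ->
  (forall z, exists x, z = phi x) ->
  (forall i, (i.+1 < n)%N -> phi (e i) = 0) ->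
  affine_hecke (phi \o kap) n 0 b (phi \o g) (phi \o jm).
Proof.
move=> lt_n phi_surj phi_e.
have phi_gV i : (i.+1 < n)%N -> phi (gV i) = phi (g i) - phi (kap b).
  by move=> lt_i; rewrite cbmw_gV // rmorphD rmorphB rmorphM phi_e // mulr0 addr0.
split=> [c z|i lt_i||i lt_i|i lt_i|i j lt_i lt_j ne ne'|i j lt_i lt_j].
- by have [x ->] := phi_surj z; rewrite /= -!rmorphM (cb_central D).
- rewrite /= -rmorphM cbmw_gg // rmorphD [phi (_ * e i)]rmorphM phi_e // mulr0 addr0.
  by rewrite rmorphD rmorph1 rmorphM.
- split=> [i j lt_ij lt_j|i lt_i] /=; rewrite -!rmorphM.
    by rewrite (ah_far cbmw_braid lt_ij).
  by rewrite (ah_braid cbmw_braid).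
(* This identity holds before passing to Q; there g_i^-1 becomes g_i - b because the e_i vanish. *)
- have E : g i * jm i = jm i.+1 * gV i by rewrite /= -mulrA (cb_ggV D) // mulr1.
  rewrite -[LHS](rmorphM phi) E rmorphM phi_gV // mulrBr !rmorph0 add0r.
  by congr (_ - _); rewrite -[RHS](rmorphM phi) (cb_central D) rmorphM.
- have E : gV i * jm i.+1 = jm i * g i by rewrite /= !mulrA (cb_gVg D) // mul1r.
  rewrite -[X in _ = X + _](rmorphM phi) -E rmorphM phi_gV // mulrBl !rmorph0 add0r.
  by rewrite subrK.
- by rewrite -[LHS](rmorphM phi) (jm_far cbmw_braid (cb_yg D) lt_i lt_j ne ne') [LHS]rmorphM.
- by rewrite -[LHS](rmorphM phi) (jm_comm cbmw_braid (cb_yg D) (cb_ygyg D) lt_i lt_j) [LHS]rmorphM.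
Qed.

Hypothesis lt_n : (1 < n)%N.
Hypothesis gen : forall P : T -> Prop,
  (forall c, P (kap c)) -> (forall i, (i.+1 < n)%N -> P (g i)) ->
  (forall i, (i.+1 < n)%N -> P (e i)) -> P y -> P yV ->
  (forall x z, P x -> P z -> P (x + z)) -> (forall x z, P x -> P z -> P (x * z)) ->
  forall x, P x.

Variable us : seq S.
Local Notation p := (\prod_(c <- us) (y - kap c)).

Lemma cbmw_p_y x : x * y = y * x -> p * x = x * p.
Proof. exact: (factor_comm (cb_central D)). Qed.

Lemma cbmw_p_g i : (0 < i)%N -> (i.+1 < n)%N -> p * g i = g i * p.
Proof. by move=> i_gt0 lt_i; apply: cbmw_p_y; rewrite (cb_yg D). Qed.

Lemma cbmw_p_e i : (0 < i)%N -> (i.+1 < n)%N -> p * e i = e i * p.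
Proof. by move=> i_gt0 lt_i; apply: cbmw_p_y; rewrite (cb_ye D). Qed.

Lemma cbmw_annihilates : p * e 0 = 0 ->
  forall x j, (j.+1 < n)%N -> p * x * e j = 0.
Proof.
move=> pe0; have BR := cbmw_braid.
have gVC i x : (i.+1 < n)%N -> g i * x = x * g i -> x * gV i = gV i * x.
  by move=> lt_i; apply: (comm_inverse (cb_ggV D lt_i) (cb_gVg D lt_i)).
have gge i j : (i.+1 < n)%N -> (j.+1 < n)%N -> adj i j -> g j * e i = gV i * (e j * e i).
  by move=> lt_i lt_j aij; rewrite -(cb_gge D lt_i) // !mulrA (cb_gVg D) // mul1r.
have adjS i : adj i i.+1 by rewrite /adj eqxx.
have adjS' i : adj i.+1 i by rewrite /adj eqxx orbT.
have se i : (i.+1 < n)%N -> exists2 c, central c & g i * e i = c * e i.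
  by move=> lt_i; exists (kap rho^-1); [apply: (cb_central D)|apply: (cb_ge D)].
have eee i : (i.+2 < n)%N -> e i.+1 * e i * e i.+1 = e i.+1.
  by move=> lt_i; apply: (cb_eee D) => //; apply: ltnW.
have see i : (i.+2 < n)%N -> g i * e i.+1 = gV i.+1 * (e i * e i.+1).
  by move=> lt_i; apply: gge => //; apply: ltnW.
have rr_s i k : (i.+2 < n)%N -> (k < i)%N -> gV i.+1 * g k = g k * gV i.+1.
  by move=> lt_i lt_k; rewrite gVC //; apply: (cb_gg_far D); rewrite /far; lia.
have rr_p i : (i.+2 < n)%N -> p * gV i.+1 = gV i.+1 * p.
  by move=> lt_i; rewrite gVC // cbmw_p_g.
have sse i : (i.+2 < n)%N -> g i * g i.+1 * e i = e i.+1 * e i.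
  by move=> lt_i; apply: (cb_gge D) => //; apply: ltnW.
have ss i : (i.+1 < n)%N -> exists c c',
    [/\ central c, central c' & g i * g i = c * g i + 1 + c' * e i].
  move=> lt_i; exists (kap b), (- kap (b * rho^-1)); rewrite cbmw_gg //.
  by split=> // x; rewrite ?mulNr ?mulrN (cb_central D).
have hull_s := hull_s (rr := fun i => gV i.+1) BR (cb_ge_far D) eee see rr_s rr_p
  se sse ss cbmw_p_g cbmw_p_e pe0.
have hull_e := hull_e (rr := fun i => gV i.+1) (cb_ge_far D) eee see rr_s rr_p
  se sse cbmw_p_e pe0.
have lt_0 : (0 < n)%N by apply: ltnW.
have hull_p : right_hull n g p p.
  by have := hull_p_ts g p lt_0; rewrite mulr1.
(* Only [g 0] fails to commute with y and its inverse, so stability of the hull reduces to the coset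
   word of length one. *)
have hull_y x : p * x = x * p -> (forall i, (0 < i)%N -> (i.+1 < n)%N -> x * g i = g i * x) ->
    right_hull n g p (p * g 0 * x) -> forall u, right_hull n g p u -> right_hull n g p (u * x).
  move=> px xg px0; apply: hull_mulr; elim=> [|[|i] IHi] lt_i.
  - by rewrite mulr1 px; apply: hullM.
  - by rewrite /= mul1r.
  - rewrite [ts g i.+2]/(ts g i.+1 * g i.+1) mulrA -(mulrA _ (g i.+1)) -xg // mulrA.
    by apply: hull_s => //; apply: IHi; apply: ltnW.
have yVC x : y * x = x * y -> x * yV = yV * x by exact: (comm_inverse (cb_yyV D) (cb_yVy D)).
have p_y : p * y = y * p by apply: cbmw_p_y.
have p_yV : p * yV = yV * p by apply: yVC.
have p_be : p * (kap b * e 0) = 0.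
  by rewrite mulrA -(cb_central D) -mulrA pe0 mulr0.
have hull_gV0 : right_hull n g p (p * gV 0).
  rewrite cbmw_gV // mulrDr p_be addr0 mulrBr -(cb_central D).
  by apply: hullD; [apply: hull_s|apply/hullN/hullM].
(* Write g_0 y = (g_0 y g_0) g_0^-1; the first factor commutes with y, hence with p. *)
have hull_p_y : right_hull n g p (p * g 0 * y).
  have -> : p * g 0 * y = p * (g 0 * y * g 0) * gV 0.
    by rewrite -!mulrA (cb_ggV D) // mulr1.
  by rewrite cbmw_p_y ?mulrA -?(cb_ygyg D) // -!mulrA; do 3!apply: hullM.
(* Replace g_0 by g_0^-1 + b, the e-term being killed by p; then g_0^-1 y^-1 g_0^-1, the inverse of
   g_0 y g_0, commutes with p. *)
have hull_p_yV : right_hull n g p (p * g 0 * yV).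
  have -> : p * g 0 * yV = p * (gV 0 * yV * gV 0) * g 0 + kap b * yV * p.
    have -> : p * g 0 = p * gV 0 + kap b * p.
      by rewrite cbmw_gV // mulrDr p_be addr0 mulrBr -(cb_central D) subrK.
    rewrite mulrDl -(mulrA _ p) p_yV !mulrA; congr (_ + _).
    by rewrite -!mulrA (cb_gVg D) // mulr1.
  have -> : p * (gV 0 * yV * gV 0) = gV 0 * yV * gV 0 * p.
    apply: (@comm_inverse _ (g 0 * y * g 0)).
    - by rewrite -!mulrA (mulrA (g 0) (gV 0)) (cb_ggV D) // mul1r (mulrA y) (cb_yyV D) mul1r
        (cb_ggV D).
    - by rewrite -!mulrA (mulrA (gV 0) (g 0)) (cb_gVg D) // mul1r (mulrA yV) (cb_yVy D) mul1r
        (cb_gVg D).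
    - by rewrite cbmw_p_y // !mulrA -(cb_ygyg D).
  by apply: hullD; [apply: hull_s => //; apply: hullM|apply: hullM].
apply: (annihilates (rr := fun i => gV i.+1) (cb_ge_far D) eee see rr_s rr_p
  se sse cbmw_p_e pe0).
apply: gen => [c|k lt_k|k lt_k|||x z IHx IHz|x z IHx IHz] u Uu.
- by rewrite -(cb_central D); apply: hullM.
- exact: hull_s.
- by rewrite hull_e //; apply: hull0.
- by apply: hull_y => //; apply: (cb_yg D).
- by apply: hull_y => // i i_gt0 lt_i; rewrite yVC // (cb_yg D).
- by rewrite mulrDr; apply: hullD; [apply: IHx|apply: IHz].
- by rewrite mulrA; apply/IHz/IHx.
Qed.

End NonDegenerate.

(** For a = 0 the relation between s_i and y_i says y_{i+1} = s_i y_i s_i. *)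
Lemma hecke_jm (S : comNzRingType) (T : pzRingType) (kap : {rmorphism S -> T}) n b
    (s y : nat -> T) :
  affine_hecke kap n 0 b s y -> forall i, (i < n)%N -> y i = jm s (y 0) i.
Proof.
move=> AH; elim=> // i IHi lt_i; rewrite /= -IHi 1?ltnW // (ah_sy AH) // rmorph0 add0r.
by rewrite mulrBl -mulrA (ah_ss AH) // mulrDr mulr1 mulrA -(ah_central AH) -mulrA addrC addKr.
Qed.

Lemma hecke_cbmw (S : comUnitRingType) (T : pzRingType) (kap : {rmorphism S -> T}) n rho q
    Omega (s y : nat -> T) (yV : T) :
  affine_hecke kap n 0 (q - q^-1) s y -> (1 < n)%N -> y 0 * yV = 1 -> yV * y 0 = 1 ->
  cbmw kap n rho q Omega s (fun i => s i - kap (q - q^-1)) (fun=> 0) (y 0) yV.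
Proof.
move=> AH lt_n yyV yVy.
split=> [c x|i lt_i|i lt_i|||i lt_i|i j lt_i lt_j fij|_|j j_gt0 lt_j|i lt_i
  |k k_gt0 _|i j lt_i lt_j fij|i j lt_i lt_j fij|j j_gt0 lt_j|i lt_i|i lt_i
  |i j lt_i lt_j aij|i j lt_i lt_j aij|i j lt_i lt_j aij|i j lt_i lt_j aij|i lt_i|_|_];
  rewrite ?(mulr0, mul0r) //.
- exact: (ah_central AH).
- exact: (sVK AH).
- by rewrite mulrBl (ah_ss AH) // addrC addKr.
- exact: (ah_braid AH).
- by case/orP: fij => lt_ij; [apply: (ah_far AH)|apply/esym/(ah_far AH)].
- have y1 : y 1 = s 0 * y 0 * s 0 by apply: (hecke_jm AH lt_n).
  by rewrite -!(mulrA (y 0)) -y1; apply: (ah_yy AH) => //; apply: ltnW.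
- by apply/esym/(ah_sy_far AH) => //; [apply: ltnW|lia].
- by rewrite opprB addrC subrK subr0 mulr1.
Qed.

Lemma jm_prod_unit (S : comUnitRingType) (T : pzRingType) (kap : {rmorphism S -> T}) n rho q
    (Omega : nat -> S) (g gV e : nat -> T) (y yV : T) :
  cbmw kap n rho q Omega g gV e y yV -> forall k, (k <= n)%N ->
  exists V, V * jm_prod g y k = 1.
Proof.
move=> D; have jm_unit i : (i < n)%N -> exists V, V * jm g y i = 1.
  elim: i => [|i IHi] lt_i; first by exists yV; apply: (cb_yVy D).
  have [V jV] := IHi (ltnW lt_i); exists (gV i * V * gV i).
  by rewrite /= -!mulrA (mulrA (gV i) (g i)) (cb_gVg D) // mul1r (mulrA V) jV mul1r (cb_gVg D).
elim=> [|k IHk] le_k; first by exists 1; rewrite mul1r /jm_prod big_ord0.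
have [[V PV] [W jW]] := (IHk (ltnW le_k), jm_unit k le_k).
by exists (W * V); rewrite jm_prodS mulrA -(mulrA W) PV mulr1.
Qed.

Lemma cbmw_disjoint (S : idomainType) (T : pzRingType) (kap : {rmorphism S -> T})
    (n' : nat) (rho q : S) (Omega : nat -> S) (g gV e : nat -> T) (y yV : T) (us : seq S) :
  let n := n'.+2 in
  let p := \prod_(c <- us) (y - kap c) in
  cbmw kap n rho q Omega g gV e y yV -> q \is a GRing.unit -> (0 < size us)%N ->
  (forall P : T -> Prop,
    (forall c, P (kap c)) -> (forall i, (i.+1 < n)%N -> P (g i)) ->
    (forall i, (i.+1 < n)%N -> P (e i)) -> P y -> P yV ->
    (forall x z, P x -> P z -> P (x + z)) -> (forall x z, P x -> P z -> P (x * z)) ->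
    forall x, P x) ->
  p * e 0 = 0 -> e 0 * p = 0 ->
  (forall (E : nzRingType) (kapE : {rmorphism S -> E}) (gE gVE : nat -> E) (yE yVE : E),
     cbmw kapE n rho q Omega gE gVE (fun=> 0) yE yVE ->
     exists r : {rmorphism T -> E},
     [/\ forall c, r (kap c) = kapE c,
         forall i, (i.+1 < n)%N -> r (g i) = gE i,
         forall i, (i.+1 < n)%N -> r (e i) = 0
       & r y = yE]) ->
  forall z, ideal_gen [set p] z -> ideal_gen [set e n'] z -> z = 0.
Proof.
move=> n p D q_unit us_gt0 gen pe0 ep0 lift.
have BR := cbmw_braid D; have jmC := jm_comm BR (cb_yg D) (cb_ygyg D).
have e_last i : (i.+1 < n)%N -> ideal_gen [set e n'] (e i).
  move=> lt_i; have [k ik] : exists k, (i + k)%N = n' by exists (n' - i)%N; lia.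
  elim: k i lt_i ik => [|k IHk] i lt_i ik.
    by apply: ideal_gen_incl; rewrite -ik addn0.
  have lt_i' : (i.+2 < n)%N by rewrite /n; lia.
  have aij : adj i i.+1 by rewrite /adj eqxx.
  rewrite -(cb_eee D lt_i lt_i' aij).
  by apply: ideal_genMr; apply: ideal_genMl; apply: IHk => //; lia.
have ep x i : (i.+1 < n)%N -> e i * x * p = 0.
  have [kapc kapcE] := conv_scalars kap; move=> lt_i.
  have Dc : cbmw kapc n rho q Omega (g : nat -> T^c) gV e y yV.
    by apply: (cbmw_ext (leqnn n) (cbmw_conv D)).
  have pE : \prod_(c <- us) ((y : T^c) - kapc c) = p.
    rewrite /p -(conv_factor _ (cb_central D)).
    by apply: eq_bigr => c _; rewrite kapcE.
  have := @cbmw_annihilates S T^c kapc n rho q Omega g gV e y yV Dc _ _ us _ x i lt_i.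
  rewrite pE !convE mulrA; apply=> //.
  move=> P Pk Ps Pe Py PyV PD PM x'; apply: (gen P) => //; first by move=> c; rewrite -kapcE.
  by move=> u v Pu Pv; apply: (PM v u).
have p_y x : x * y = y * x -> p * x = x * p by apply: (cbmw_p_y D).
have y_jm i : (i < n)%N -> jm g y i * y = y * jm g y i by move=> lt_i; apply: (jmC i 0).
(* Here (a, b) = (0, q - q^-1), the root of the quadratic relation is q, and [Y] is the product of
   all the Jucys-Murphy elements. *)
apply: (@ideals_disjoint S T kap n' 0 (q - q^-1) q g e (jm g y) us (jm_prod g y n)) => //.
- by rewrite mulrBl mulVr // subrK.
- exact: (cb_central D).
- by move=> Q phi; apply: (cbmw_hecke D).
- by move=> x i; apply: (cbmw_annihilates D).
- by move=> i lt_i; apply/p_y/y_jm.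
- by move=> i; apply: (cbmw_p_g D).
- move=> E kapE sE yE yVE AH yEV; have [yyV yVy] := yEV 0.
  have [r [rk rg re ry]] := lift _ _ _ _ _ _ (hecke_cbmw rho Omega AH (isT : (1 < n)%N) yyV yVy).
  exists r; split=> // i lt_i; rewrite (hecke_jm AH) //.
  elim: i lt_i => //= i IHi lt_i; by rewrite !rmorphM rg // IHi // ltnW.
- by apply: p_y; apply/esym; apply: (jm_prod_y (cb_yg D) (cb_ygyg D)).
- have [V VY] := jm_prod_unit D (leqnn n).
  by move=> x /(congr1 ( *%R V)); rewrite mulrA VY mul1r mulr0.
move=> Q phi phi_surj phi_e; have AH := cbmw_hecke D isT phi_surj phi_e.
set Y := jm_prod g y n; pose spans := pbw_span (phi \o kap) (phi \o g) (phi \o jm g y) (@full n) n.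
have spansM u v : spans u -> spans v -> spans (u * v) by apply: (pbw_M AH).
have spans1 : spans 1 by apply/pbw_W/inW1.
have spans_jm i : (i < n)%N -> spans (phi (jm g y i)).
  by move=> lt_i; rewrite -[phi _]mulr1; apply: (pbw_yM AH).
have YC z : phi Y * z = z * phi Y.
  have [x ->] := phi_surj z; move: x {z}.
  have Yy : y * Y = Y * y := jm_prod_y (cb_yg D) (cb_ygyg D).
  apply: gen => [c|i lt_i|i lt_i|||x z Yx Yz|x z Yx Yz].
  - by rewrite -!rmorphM (cb_central D).
  - by rewrite -!rmorphM (jm_prod_g BR (cb_yg D) (cb_ygyg D)).
  - by rewrite phi_e // mulr0 mul0r.
  - by rewrite -!rmorphM Yy.
  - by rewrite -!rmorphM (comm_inverse (cb_yyV D) (cb_yVy D) Yy).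
  - by rewrite rmorphD mulrDr mulrDl Yx Yz.
  - by rewrite rmorphM mulrA Yx -mulrA Yz mulrA.
have Y_spans : spans (phi Y).
  by rewrite rmorph_prod; elim/big_rec: _ => // i x _; apply: spansM; apply: spans_jm.
have YX_spans k z : spans z -> spans (phi Y ^+ k * z).
  by move=> Xz; elim: k => [|k IHk]; rewrite ?mul1r // exprS -mulrA; apply: spansM.
split=> // z; have [x ->] := phi_surj z; move: x {z}.
have N0 x : spans (phi x) -> exists N, spans (phi Y ^+ N * phi x).
  by exists 0%N; rewrite mul1r.
apply: gen => [c|i lt_i|i lt_i|||x z [N Xx] [M Xz]|x z [N Xx] [M Xz]].
- by apply: N0; apply/pbw_W/inW_kap.
- by apply: N0; apply/pbw_W/inWs.
- by apply: N0; rewrite phi_e //; apply: pbw0.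
- by apply: N0; apply: (spans_jm 0).
(* One factor [Y] cancels the inverse of y_1 and leaves y_2 ... y_n. *)
- exists 1%N; rewrite expr1 YC -rmorphM /Y /jm_prod big_ord_recl mulrA (cb_yVy D) mul1r.
  by rewrite rmorph_prod; elim/big_rec: _ => // i u _; apply: spansM; apply: spans_jm.
- exists (N + M)%N; rewrite rmorphD mulrDr; apply: pbwD.
    by rewrite addnC exprD -mulrA; apply: YX_spans.
  by rewrite exprD -mulrA; apply: YX_spans.
- exists (N + M)%N; rewrite rmorphM exprD -(mulrA _ (_ ^+ M)) (mulrA _ (phi x)).
  have -> : phi Y ^+ M * phi x = phi x * phi Y ^+ M.
    by apply/esym/commrX; rewrite /GRing.comm YC.
  by rewrite -(mulrA (phi x)) mulrA; apply: spansM.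
Qed.

Lemma cbmw_transfer (S : comUnitRingType) (T : pzRingType) (kap : {rmorphism S -> T}) n rho q
    Omega (g gV e : nat -> T) (y yV : T) (u v : seq S) :
  (1 < n)%N -> cbmw kap n rho q Omega g gV e y yV -> \prod_(c <- u) (y - kap c) = 0 ->
  (\prod_(c <- v) (cY 2 rho q Omega u - c *: (1 : cyc_cBMW 2 rho q Omega u)))
    * cE 2 rho q Omega u 1 = 0 ->
  \prod_(c <- v) (y - kap c) * e 0 = 0.
Proof.
move=> n_gt1 D u0; have [f [fk [fg fgV] fe fy fyV]] := cfree_lift 2 g gV e y yV (cb_central D).
have frel := rel_of_cbmw (cbmw_ext n_gt1 D fk fg fgV fe fy fyV).
have [h hE] := palg_lift frel.
have h_poly us : h (cyc_poly (affine_cy1 2 rho q Omega) us) = \prod_(c <- us) (y - kap c).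
  rewrite (cyc_poly_map (g := f)) //; apply: eq_bigr => c _.
  by rewrite fy /= fk.
have [k kE] : exists k : {rmorphism cyc_cBMW 2 rho q Omega u -> T},
    forall a, k (cyc_pi (affine_cy1 2 rho q Omega) u a) = h a.
  by apply: rq_lift => _ ->; rewrite h_poly.
rewrite cyc_polyE => /(congr1 k); rewrite rmorphM rmorph0 !kE h_poly hE.
by rewrite fe.
Qed.

Lemma cBMW_bij (S : idomainType) n' (rho q : S) (Omega : nat -> S) (u : seq S) (d : nat) :
  let n := n'.+2 in q \is a GRing.unit -> (0 < size (take d u))%N ->
  (\prod_(c <- take d u) (cY 2 rho q Omega u - c *: (1 : cyc_cBMW 2 rho q Omega u)))
    * cE 2 rho q Omega u 1 = 0 ->
  set_bij (ideal_gen [set cE n rho q Omega u n'.+1])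
    (ideal_gen [set cE n rho q Omega (take d u) n'.+1])
    (theta (affine_cy1 n rho q Omega) u d).
Proof.
move=> n q_unit us_gt0 pe0; set us := take d u in us_gt0 pe0 *.
pose E := @cBMW_rel S n rho q Omega.
pose R := palg E; pose y1 : R := affine_cy1 n rho q Omega.
pose e1 : R := palg_pi _ (ce S n 1).
have D (T : pzRingType) (h : {rmorphism R -> T}) : (forall z, exists x, z = h x) ->
    let f : {rmorphism free_alg S (cgen n) -> T} := h \o palg_pi E in
    (forall z, exists x, z = f x) /\
    cbmw (scal f) n rho q Omega (fun i => f (cg S n i.+1)) (fun i => f (cgV S n i.+1))
      (fun i => f (ce S n i.+1)) (f (cy S n)) (f (cyV S n)).
  move=> h_surj f; have f_surj z : exists x, z = f x.
    by have [a ->] := h_surj z; have [b ->] := palg_pi_surj a; exists b.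
  split=> //; apply: cbmw_of_rel => [|x z /palg_pi_rel xz]; first exact: scal_central.
  by rewrite /f /= xz.
have h_poly (T : pzRingType) (h : {rmorphism R -> T}) (f := h \o palg_pi E) vs :
    h (cyc_poly y1 vs) = \prod_(c <- vs) (f (cy S n) - scal f c).
  exact: cyc_poly_map.
apply: (@theta_bij _ _ _ _ e1).
- have [_ Dc] := D _ (cyc_pi y1 u) (@cyc_pi_surj _ _ _ y1 u).
  rewrite rmorphM h_poly; apply: (cbmw_transfer _ Dc _ pe0) => //.
  by rewrite -h_poly; apply: cyc_pi_poly.
- have [f_surj Dc] := D _ (cyc_pi y1 u) (@cyc_pi_surj _ _ _ y1 u).
  set f := (f in scal f) in Dc f_surj; have [kapc kapcE] := conv_scalars (scal f).
  have Dcc := cbmw_ext (leqnn n) (cbmw_conv Dc) kapcE (fun _ _ => erefl)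
    (fun _ _ => erefl) (fun _ _ => erefl) erefl erefl.
  have prodE vs : \prod_(c <- vs) ((f (cy S n) : (cyc_cBMW n rho q Omega u)^c) - kapc c)
      = cyc_pi y1 u (cyc_poly y1 vs).
    rewrite h_poly -(conv_factor _ (cb_central Dc)).
    by apply: eq_bigr => c _; rewrite kapcE.
  rewrite rmorphM; have := cbmw_transfer _ Dcc _ pe0; rewrite !prodE convE; apply=> //.
  exact: cyc_pi_poly.
set p := cyc_poly y1 us; set X := [set z | _].
have [f_surj DT] := D _ (rq_pi X) (@rq_pi_surj _ X).
rewrite h_poly; set f := (f in scal f) in DT f_surj *.
apply: (cbmw_disjoint DT) => //.
- move=> P Pk Pg Pe Py PyV PD PM x; have [a ->] := f_surj x; move: a {x}.
  apply: cbmw_ind => // [i lt_i|a b|a b]; rewrite ?rmorphD ?rmorphM; last 2 first.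
  + exact: PD.
  + exact: PM.
  rewrite (cbmw_gV DT) //; apply: (PD); first apply: PD; first exact: Pg.
    by rewrite -rmorphN; apply: Pk.
  by apply: PM; [apply: Pk|apply: Pe].
- rewrite -h_poly -[f (ce S n 1)]/(rq_pi X e1) -rmorphM; apply/rq_pi_eq0.
  by apply: ideal_gen_incl; left.
- rewrite -h_poly -[f (ce S n 1)]/(rq_pi X e1) -rmorphM; apply/rq_pi_eq0.
  by apply: ideal_gen_incl; right.
move=> T kapT gT gVT yT yVT DE.
have [k [kk [kg kgV] ke ky kyV]] := cfree_lift n gT gVT (fun=> 0) yT yVT (cb_central DE).
have krel := rel_of_cbmw (cbmw_ext (leqnn n) DE kk kg kgV ke ky kyV).
have [h hE] := palg_lift krel.
have he1 : h e1 = 0 by rewrite hE ke.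
have [r rE] : exists r : {rmorphism ring_quot X -> T}, forall a, r (rq_pi X a) = h a.
  by apply: rq_lift => _ [] ->; rewrite rmorphM he1 ?mulr0 ?mul0r.
by exists r; split=> [c|i lt_i|i lt_i|]; rewrite /f /= rE hE ?kk ?kg ?ke ?ky.
Qed.

Theorem proposition5p11 (S : idomainType) (n r d : nat) (u : r.-tuple S)
    (n_ge2 : (2 <= n)%N) (d_gt0 : (0 < d)%N) (d_lt_r : (d < r)%N) :
  (forall (rho q : S) (Omega : nat -> S),
     rho \is a GRing.unit -> q \is a GRing.unit ->
     rho^-1 - rho = (q^-1 - q) * (Omega 0%N - 1) ->
     (forall i : 'I_r, tnth u i \is a GRing.unit) ->
     let e1 := cE 2 rho q Omega u 1 in
     let y1 := cY 2 rho q Omega u in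
     torsion_free (left_ideal_gen e1) ->
     semi_admissible d (fun i => y1 ^+ i * e1) ->
     (\prod_(c <- take d u) (y1 - c *: (1 : cyc_cBMW 2 rho q Omega u))) * e1 = 0 ->
     set_bij (ideal_gen [set cE n rho q Omega u n.-1])
             (ideal_gen [set cE n rho q Omega (take d u) n.-1])
             (theta (affine_cy1 n rho q Omega) u d))
  /\
  (forall Omega : nat -> S,
     let e1 := dE 2 Omega u 1 in
     let y1 := dY 2 Omega u 1 in
     torsion_free (left_ideal_gen e1) ->
     semi_admissible d (fun i => y1 ^+ i * e1) ->
     (\prod_(c <- take d u) (y1 - c *: (1 : cyc_dBMW 2 Omega u))) * e1 = 0 ->
     set_bij (ideal_gen [set dE n Omega u n.-1])
             (ideal_gen [set dE n Omega (take d u) n.-1])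
             (theta (affine_dy1 n Omega) u d)).
Proof.
have us_gt0 : (0 < size (take d u))%N by rewrite size_takel // size_tuple ltnW.
case: n n_ge2 => [|[|n']] // _; split.
  by move=> rho q Omega _ q_unit _ _ e1 y1 _ _; apply: cBMW_bij.
by move=> Omega e1 y1 _ _; apply: dBMW_bij.
Qed.
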